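(* Suppose that $T$ is a computable real with $0<T<1$. Let $V$ and $W$ be optimal prefix-free machines. Then the computations between $\mathrm{Pf}(Z_V(T))$ and $\operatorname{dom}W$ are bidirectional.
   Context: $\{0,1\}^*$ is the set of finite binary strings and $|x|$ is the length of $x$. A prefix-free machine is a partial recursive function $F\colon\{0,1\}^*\to\{0,1\}^*$ whose domain $\operatorname{dom}F$ is prefix-free. A prefix-free machine $V$ is optimal if for each prefix-free machine $F$ there exists $d\in\mathbb{N}$ such that for every $p\in\operatorname{dom}F$ there is $q\in\operatorname{dom}V$ with $V(q)=F(p)$ and $|q|\le|p|+d$. For a real $T$ with $0<T\le1$, $Z_V(T)=\sum_{p\in\operatorname{dom}V}2^{-|p|/T}$, which converges with $0<Z_V(T)<1$. A real $\alpha$ is computable if there is a computable sequence $\{a_n\}_{n\in\mathbb{N}}$ of rationals with $|\alpha-a_n|<2^{-n}$ for all $n\in\mathbb{N}$. For a real $\alpha$ and $n\in\mathbb{N}$, $\alpha\!\upharpoonright_n\in\{0,1\}^*$ denotes the first $n$ bits of the base-two expansion of $\alpha-\lfloor\alpha\rfloor$ with infinitely many zeros, and $\mathrm{Pf}(\alpha)=\{\alpha\!\upharpoonright_n\mid n\in\mathbb{N}\}\subset\{0,1\}^*$. For $f\colon\mathbb{N}\to\mathbb{N}$ and $A,B\subset\{0,1\}^*$, $A$ is reducible to $B$ in query size $f$ if there exists an oracle deterministic Turing machine $M$ such that $A$ is Turing reducible to $B$ via $M$ and, on every input $x\in\{0,1\}^*$, $M$ only queries strings of length at most $f(|x|)$.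 An order function is a non-decreasing total recursive function $f\colon\mathbb{N}\to\mathbb{N}$ with $\lim_{n\to\infty}f(n)=\infty$. For $A,B\subset\{0,1\}^*$, the computation from $A$ to $B$ is unidirectional if for all order functions $f$ and $g$: if $B$ is reducible to $A$ in query size $f$ and $A$ is reducible to $B$ in query size $g$, then the function $g(f(n))-n$ of $n\in\mathbb{N}$ is unbounded. The computations between $A$ and $B$ are bidirectional if the computation from $A$ to $B$ is not unidirectional and the computation from $B$ to $A$ is not unidirectional. *)

(* Defs.v *)
From HB Require Import structures.
From mathcomp Require Import all_boot all_order all_algebra.
From mathcomp Require Import all_classical all_reals all_analysis.
Import Order.TTheory GRing.Theory Num.Theory.
Import numFieldNormedType.Exports.

Set Implicit Arguments.
Unset Strict Implicit.
Unset Printing Implicit Defensive.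

Local Open Scope classical_set_scope.
Local Open Scope ring_scope.

Definition str := seq bool.

(** * Partial recursive functions (Kleene) *)

Inductive mu_code : nat -> Type :=
| Zero (n : nat) : mu_code n
| Succ : mu_code 1
| Proj (n : nat) (i : 'I_n) : mu_code n
| Comp (m n : nat) (f : mu_code m) (g : 'I_m -> mu_code n) : mu_code n
| PrimRec (n : nat) (f : mu_code n) (g : mu_code n.+2) : mu_code n.+1
| Mu (n : nat) (f : mu_code n.+1) : mu_code n.

(* [mu_eval c v y]: the partial function coded by c is defined at v, with
   value y.  The recursion variable and the variable minimized over are the
   first arguments; the step function of [PrimRec] receives the recursion
   index, the previous value and the parameters, in this order. *)
Fixpoint mu_eval (n : nat) (c : mu_code n) {struct c} :
    n.-tuple nat -> nat -> Prop :=
  match c in mu_code n return n.-tuple nat -> nat -> Prop with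
  | Zero _ => fun _ y => y = 0%N
  | Succ => fun v y => y = (thead v).+1
  | Proj _ i => fun v y => y = tnth v i
  | Comp m _ f g => fun v y =>
      exists w : m.-tuple nat,
        (forall i, mu_eval (g i) v (tnth w i)) /\ mu_eval f w y
  | PrimRec n f g => fun v =>
      let u : n.-tuple nat := behead_tuple v in
      (fix rec (k : nat) : nat -> Prop :=
         match k with
         | 0%N => mu_eval f u
         | k'.+1 => fun y =>
             exists2 z, rec k' z & mu_eval g (cons_tuple k' (cons_tuple z u)) y
         end) (thead v)
  | Mu _ f => fun v y =>
      mu_eval f (cons_tuple y v) 0%N /\
      (forall k, (k < y)%N -> exists z, mu_eval f (cons_tuple k v) z.+1)
  end.

Definition recursive_fun (f : nat -> nat) : Prop :=
  exists c : mu_code 1, forall n y, mu_eval c [tuple n] y <-> y = f n.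

(* The length-lexicographic bijection between binary strings and nat: x is sent
   to the number with binary notation 1x, minus one. *)
Definition str_code (x : str) : nat :=
  (foldl (fun (n : nat) (b : bool) => n.*2 + b)%N 1%N x).-1.

Definition partial_recursive (F : str -> option str) : Prop :=
  exists c : mu_code 1, forall x y,
    mu_eval c [tuple str_code x] y <-> omap str_code (F x) = Some y.

(** * Prefix-free machines *)

Definition domain (F : str -> option str) : set str := [set p | isSome (F p)].

Definition prefix_free (A : set str) : Prop :=
  forall p q, A p -> A q -> prefix p q -> p = q.

Definition prefix_free_machine (F : str -> option str) : Prop :=
  partial_recursive F /\ prefix_free (domain F).

Definition optimal (V : str -> option str) : Prop :=
  prefix_free_machine V /\
  forall F, prefix_free_machine F ->
    exists d : nat, forall p, domain F p ->
      exists q, [/\ domain V q, V q = F p & (size q <= size p + d)%N].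

(* The sum is taken in the extended reals; [fine] is the identity on the finite
   value it has for a prefix-free machine and 0 < T <= 1. *)
Definition partition_fun (R : realType) (V : str -> option str) (T : R) : R :=
  fine (\esum_(p in domain V) (2 `^ (- ((size p)%:R / T)))%:E).

(** * Computable reals *)

Definition computable_rat_seq (a : nat -> rat) : Prop :=
  exists s p q : nat -> nat,
    [/\ recursive_fun s, recursive_fun p, recursive_fun q &
        forall n, q n != 0%N /\ a n = (-1) ^+ s n * (p n)%:R / (q n)%:R].

Definition computable_real (R : realType) (alpha : R) : Prop :=
  exists2 a : nat -> rat, computable_rat_seq a &
    forall n, `|alpha - ratr (a n)| < 2 ^- n.

(** * Base-two expansions *)

Definition binary_expansion (R : realType) (alpha : R) (b : nat -> bool) : Prop :=
  (series (fun i => (b i)%:R * 2 ^- i.+1 : R) @ \oo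
     --> alpha - (Num.floor alpha)%:~R) /\
  (forall n, exists2 m, (n <= m)%N & b m = false).

Definition Pf (R : realType) (alpha : R) : set str :=
  [set x | exists b, binary_expansion alpha b /\ exists n, x = mkseq b n].

(** * Oracle deterministic Turing machines *)

(* Tape symbols: the blank [None], the two bits, and the auxiliary symbols
   from the finite type G. *)
Definition symbol (G : finType) : finType := option (bool + G).

Inductive direction := GoLeft | Stay | GoRight.

(* What a machine with state set Q, alphabet [symbol G] and k tapes does in a
   given state: halt with an accepting ([true]) or rejecting ([false]) verdict;
   ask the oracle and move to the first state on answer "yes", to the second on
   answer "no"; or do an ordinary step which, according to the symbols scanned
   on all tapes, changes the state and on each tape writes a symbol and moves
   the head. *)
Inductive instruction (Q G : finType) (k : nat) :=
| Halt of bool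
| Query of Q & Q
| Step of ({ffun 'I_k -> symbol G} -> Q * ('I_k -> symbol G * direction)).

Record oracle_machine := OracleMachine {
  om_state : finType;
  om_aux : finType;
  om_ntapes : nat;
  om_input : 'I_om_ntapes;
  om_query : 'I_om_ntapes;
  om_start : om_state;
  om_instr : om_state -> instruction om_state om_aux om_ntapes
}.

(* A two-way infinite tape (l, r): the scanned cell is the first one of r, the
   cells to its left are listed in l from right to left, and all the cells not
   listed are blank. *)
Definition tape (G : finType) : Type := (seq (symbol G) * seq (symbol G))%type.

Definition tape_read (G : finType) (t : tape G) : symbol G := head None t.2.

Definition tape_write_move (G : finType) (a : symbol G * direction)
    (t : tape G) : tape G :=
  let r := a.1 :: behead t.2 in
  match a.2 with
  | GoLeft => (behead t.1, head None t.1 :: r)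
  | Stay => (t.1, r)
  | GoRight => (a.1 :: t.1, behead r)
  end.

Fixpoint leading_bits (G : finType) (s : seq (symbol G)) : str :=
  match s with
  | Some (inl b) :: s' => b :: leading_bits s'
  | _ => [::]
  end.

Section Run.
Variables (M : oracle_machine) (B : set str).

Definition config : Type :=
  (om_state M * {ffun 'I_(om_ntapes M) -> tape (om_aux M)})%type.

Definition init_config (x : str) : config :=
  (om_start M,
   [ffun i => if i == om_input M
              then ([::], [seq Some (inl b) | b <- x]) else ([::], [::])]).

(* The queried string is the longest block of bits on the query tape that
   starts at the scanned cell and extends to the right. *)
Definition queried_string (c : config) : str :=
  leading_bits (c.2 (om_query M)).2.

Definition step (c : config) : config :=
  match om_instr c.1 with
  | Halt _ => c
  | Query yes no => (if queried_string c \in B then yes else no, c.2)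
  | Step delta =>
      let a := delta [ffun i => tape_read (c.2 i)] in
      (a.1, [ffun i => tape_write_move (a.2 i) (c.2 i)])
  end.

Definition config_at (x : str) (t : nat) : config :=
  iter t step (init_config x).

Definition halts_with (x : str) (b : bool) : Prop :=
  exists t, om_instr (config_at x t).1 = Halt _ _ _ b.

Definition queries (x w : str) : Prop :=
  exists t yes no, om_instr (config_at x t).1 = Query _ _ yes no /\
                   queried_string (config_at x t) = w.

End Run.

Definition turing_reducible_via (M : oracle_machine) (A B : set str) : Prop :=
  forall x, halts_with M B x (x \in A).

Definition reducible_in_query_size (f : nat -> nat) (A B : set str) : Prop :=
  exists M, turing_reducible_via M A B /\
    forall x w, queries M B x w -> (size w <= f (size x))%N.

(** * Unidirectionality and bidirectionality *)

Definition order_function (f : nat -> nat) : Prop :=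
  [/\ {homo f : m n / (m <= n)%N}, recursive_fun f & f n @[n --> \oo] --> \oo].

Definition bounded_int_seq (u : nat -> int) : Prop :=
  exists C : nat, forall n, `|u n| <= C%:Z.

Definition unidirectional (A B : set str) : Prop :=
  forall f g, order_function f -> order_function g ->
    reducible_in_query_size f B A -> reducible_in_query_size g A B ->
    ~ bounded_int_seq (fun n => (g (f n))%:Z - n%:Z).

Definition bidirectional (A B : set str) : Prop :=
  ~ unidirectional A B /\ ~ unidirectional B A.

(* Main.v *)
Require Import Defs.
From HB Require Import structures.
From mathcomp Require Import all_boot all_order all_algebra.
From mathcomp Require Import all_classical all_reals all_analysis.
From mathcomp Require Import zify ring lra.
Import Order.TTheory GRing.Theory Num.Theory.
Import numFieldNormedType.Exports.
Set Implicit Arguments.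
Unset Strict Implicit.
Unset Printing Implicit Defensive.
Local Open Scope classical_set_scope.
Local Open Scope ring_scope.

(** Let [n] be the length of an input, [Z = Z_V(T)], and call [2 ^ - (l / T)] the
    weight of a program of length [l].  The programs of [V] halting within [t]
    steps give a computable nondecreasing sequence of dyadic lower bounds
    [lower_sum t] of [Z], converging to [Z].

    The domain of [W] is decided from the first [n / T + O(1)] bits of [Z]
    ([domain_reducible_Pf]).  Let [F] be the machine that outputs the halting time
    of [W].  As [V] is optimal, for every program [p] of [W] of length [n], some
    program of [V] of length at most [n + d] outputs the halting time of [p].  Wait for
    a stage [t] with [lower_sum t] within [2 * 2 ^ - m] of [Z], where
    [m = n / T + O(1)]; a program of [V] not yet counted then has a weight below
    [2 * 2 ^ - m], hence a length above [n + d].  So the outputs of the programs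
    counted so far bound the halting times of all the programs of [W] of length [n].

    Conversely the first [n] bits of [Z] are computed from the strings of length at
    most [T n + O(1)] in the domain of [W] ([Pf_reducible_domain]).  Call it a change
    of level [n] when the first [n] bits of [lower_sum t] change at stage [t].
    A machine [G] is built that outputs the stage of each change of level [n] on a
    program of length [T n + O(1)].  As [W] is optimal, some output of [W] on a
    program of length [T n + O(1)] then exceeds the last stage at which the first
    [n] bits change.  The machine [G] exists ([request_machine]) because the
    lengths requested satisfy Kraft's inequality ([changes_weight]): the changes of
    level [n] caused by an increment [y] of the lower bounds number about
    [min 1 (2 ^ n y)], and the sum over [n] of [2 ^ - (T n) * min 1 (2 ^ n y)] is
    [O(y ^ T)] since [0 < T < 1] ([level_sum]).  The increment due to a program of
    length [l] is [2 ^ - (l / T)], whose [T]-th power is [2 ^ - l]; these sum up to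
    at most 1 over the domain of [V].

    The two query bounds are linear with slopes [1 / T] and [T], so that either
    composition differs from [n] by a bounded amount.  Both can be taken to be
    recursive and nondecreasing because [T] is computable
    ([linear_order_function]).

    On the side of machines, [comp] is a class of total functions for which a search
    for a suitable stage is easily programmed.  Partial recursive functions
    enter it through evaluations bounded by a number of stages ([stage_exists]);
    conversely its members have codes ([rec_of_comp]), which produces the
    machines [F] and [G], and counter programs ([in_place_of_comp]), which run on
    oracle Turing machines ([reducible_of_program]). *)

(** * Computable functions on the natural numbers *)

Section Pairing.
Local Open Scope nat_scope.

Fixpoint tri (n : nat) : nat := if n is m.+1 then tri m + n else 0.

Definition cpair (a b : nat) : nat := tri (a + b) + b.

(** The diagonal [a + b] of the pair coded by [n]. *)
Fixpoint diag (n : nat) : nat :=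
  if n is m.+1 then diag m + (tri (diag m).+1 <= n) else 0.

Definition pr (n : nat) : nat := n - tri (diag n).
Definition pl (n : nat) : nat := diag n - pr n.

Lemma tri_mono : {homo tri : m n / m <= n}.
Proof. by apply: homo_leq => // [y x z|n]; [exact: leq_trans | rewrite /= leq_addr]. Qed.

Lemma diagP n : tri (diag n) <= n < tri (diag n).+1.
Proof.
elim: n => [//|n /andP[IH1 IH2]]; rewrite /= -/(tri _) in IH2 *.
have [H|H] := leqP (tri (diag n) + (diag n).+1) n.+1; rewrite ?addn1 ?addn0 /=; lia.
Qed.

Lemma diag_unique n s : tri s <= n < tri s.+1 -> diag n = s.
Proof.
move=> /andP[H1 H2]; have /andP[H3 H4] := diagP n.
apply/eqP; rewrite eqn_leq; apply/andP; split; rewrite leqNgt; apply/negP => /tri_mono; lia.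
Qed.

Lemma diag_cpair a b : diag (cpair a b) = a + b.
Proof. by apply: diag_unique; rewrite /cpair /=; lia. Qed.

Lemma pr_cpair a b : pr (cpair a b) = b.
Proof. by rewrite /pr diag_cpair /cpair addKn. Qed.

Lemma pl_cpair a b : pl (cpair a b) = a.
Proof. by rewrite /pl pr_cpair diag_cpair addnK. Qed.

Lemma cpairK n : cpair (pl n) (pr n) = n.
Proof.
have := diagP n; rewrite /cpair /pl /pr /= => /andP[H1 H2].
by rewrite subnK; lia.
Qed.

Lemma cpair_ge1 a b : a <= cpair a b.
Proof.
have Ht n : n <= tri n by elim: n => //= n; lia.
by rewrite /cpair; have := Ht (a + b); lia.
Qed.

Lemma cpair_ge2 a b : b <= cpair a b.
Proof. by rewrite /cpair leq_addl. Qed.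

End Pairing.

Section Computable.
Local Open Scope nat_scope.

(** Closing the class under a total minimization only, and coding tuples by
    [cpair], avoids both partial functions and arities. *)
Inductive comp : (nat -> nat) -> Prop :=
| comp_zero : comp (fun=> 0)
| comp_succ : comp succn
| comp_pl : comp pl
| comp_pr : comp pr
| comp_cpair f g : comp f -> comp g -> comp (fun x => cpair (f x) (g x))
| comp_comp f g : comp f -> comp g -> comp (fun x => f (g x))
| comp_prec f g : comp f -> comp g ->
    comp (fun z => nat_rect (fun=> nat) (f (pl z))
                     (fun n r => g (cpair (pl z) (cpair n r))) (pr z))
| comp_mu f m : comp f -> (forall x, f (cpair x (m x)) = 0) ->
    (forall x k, k < m x -> f (cpair x k) <> 0) -> comp m.

Definition comp2 (f : nat -> nat -> nat) : Prop :=
  comp (fun z => f (pl z) (pr z)).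

Definition comp3 (f : nat -> nat -> nat -> nat) : Prop :=
  comp (fun z => f (pl z) (pl (pr z)) (pr (pr z))).

Lemma comp_ext f g : f =1 g -> comp f -> comp g.
Proof. by move=> /funext ->. Qed.

Lemma comp_id : comp (fun x => x).
Proof. by apply: (comp_ext cpairK); exact: comp_cpair comp_pl comp_pr. Qed.

Lemma comp_const n : comp (fun=> n).
Proof. elim: n => [|n IH]; [exact: comp_zero | exact: (comp_comp comp_succ IH)]. Qed.

Lemma comp_plE f : comp f -> comp (fun x => pl (f x)).
Proof. exact: (comp_comp comp_pl). Qed.

Lemma comp_prE f : comp f -> comp (fun x => pr (f x)).
Proof. exact: (comp_comp comp_pr). Qed.

Lemma comp_succE f : comp f -> comp (fun x => (f x).+1).
Proof. exact: (comp_comp comp_succ). Qed.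

(** The closure lemmas from here on have conclusions of the form
    [comp (fun x => C (f x) (g x))], which are found by unification from the body of
    the function at hand; [comp_step] relies on this. *)
Lemma comp2E f g h : comp2 f -> comp g -> comp h -> comp (fun x => f (g x) (h x)).
Proof.
move=> Hf Hg Hh; apply: (@comp_ext (fun x => (fun z => f (pl z) (pr z)) (cpair (g x) (h x)))).
  by move=> x; rewrite pl_cpair pr_cpair.
exact: comp_comp Hf (comp_cpair Hg Hh).
Qed.

Lemma comp3E f g h k : comp3 f -> comp g -> comp h -> comp k ->
  comp (fun x => f (g x) (h x) (k x)).
Proof.
move=> Hf Hg Hh Hk.
apply: (@comp_ext (fun x => (fun z => f (pl z) (pl (pr z)) (pr (pr z)))
                              (cpair (g x) (cpair (h x) (k x))))).
  by move=> x; rewrite !(pl_cpair, pr_cpair).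
exact: comp_comp Hf (comp_cpair Hg (comp_cpair Hh Hk)).
Qed.

Lemma comp_nrec n f g : comp n -> comp f -> comp3 g ->
  comp (fun x => nat_rect (fun=> nat) (f x) (g x) (n x)).
Proof.
move=> Hn Hf Hg.
have H := comp_prec Hf Hg.
apply: comp_ext (comp_comp H (comp_cpair comp_id Hn)) => x.
rewrite pl_cpair pr_cpair; congr nat_rect; apply/funext => i; apply/funext => r.
by rewrite !(pl_cpair, pr_cpair).
Qed.

End Computable.

Ltac comp_step := first
  [ assumption
  | exact: comp_id
  | exact: comp_const
  | match goal with
    | H : comp ?f |- comp (fun x => ?f (@?g x)) => apply: (comp_comp H)
    | H : comp2 ?f |- comp (fun x => ?f (@?g x) (@?h x)) => apply: (comp2E H)
    | H : comp3 ?f |- comp (fun x => ?f (@?g x) (@?h x) (@?k x)) => apply: (comp3E H)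
    end
  | apply: comp_plE | apply: comp_prE | apply: comp_succE | apply: comp_cpair ].

Section Arithmetic.
Local Open Scope nat_scope.

Lemma compD f g : comp f -> comp g -> comp (fun x => f x + g x).
Proof.
move=> Hf Hg; have H : comp3 (fun _ _ r => r.+1) by rewrite /comp3; do !comp_step.
apply: comp_ext (comp_nrec Hg Hf H) => x.
by elim: (g x) => [|n /= ->]; rewrite ?addn0 ?addnS.
Qed.

Lemma comp_pred f : comp f -> comp (fun x => (f x).-1).
Proof.
move=> Hf; have H : comp3 (fun _ i _ => i) by rewrite /comp3; do !comp_step.
by apply: comp_ext (comp_nrec Hf comp_zero H) => x; case: (f x).
Qed.

Lemma compB f g : comp f -> comp g -> comp (fun x => f x - g x).
Proof.
move=> Hf Hg.
have H : comp3 (fun _ _ r => r.-1) by apply: comp_pred; do !comp_step.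
apply: comp_ext (comp_nrec Hg Hf H) => x.
by elim: (g x) => [|n /= ->]; rewrite ?subn0 ?subnS.
Qed.

Lemma comp_leq f g : comp f -> comp g -> comp (fun x => nat_of_bool (f x <= g x)).
Proof.
move=> Hf Hg; apply: comp_ext (compB (comp_const 1) (compB Hf Hg)) => x.
by lia.
Qed.

Lemma comp_ltn f g : comp f -> comp g -> comp (fun x => nat_of_bool (f x < g x)).
Proof. by move=> Hf Hg; apply: comp_leq => //; comp_step. Qed.

Lemma comp_sum n F : comp n -> comp2 F -> comp (fun x => \sum_(i < n x) F x i).
Proof.
move=> Hn HF.
have H : comp3 (fun x i r => r + F x i) by apply: compD; do !comp_step.
apply: comp_ext (comp_nrec Hn comp_zero H) => x.
by elim: (n x) => [|m /= ->]; rewrite ?big_ord0 ?big_ord_recr.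
Qed.

Lemma comp_sum_nat n F : comp n -> comp2 F -> comp (fun x => \sum_(0 <= i < n x) F x i).
Proof. by move=> Hn HF; apply: comp_ext (comp_sum Hn HF) => x; rewrite big_mkord. Qed.

Lemma compM f g : comp f -> comp g -> comp (fun x => f x * g x).
Proof.
move=> Hf Hg; apply: comp_ext (comp_sum (F := fun x _ => g x) Hf _) => [x|].
  by rewrite sum_nat_const card_ord.
by rewrite /comp2; do !comp_step.
Qed.

Lemma compX f g : comp f -> comp g -> comp (fun x => f x ^ g x).
Proof.
move=> Hf Hg.
have H : comp3 (fun x _ r => f x * r) by apply: compM; do !comp_step.
apply: comp_ext (comp_nrec Hg (comp_const 1) H) => x.
by elim: (g x) => [|n /= ->]; rewrite ?expn0 ?expnS.
Qed.

Lemma comp_and (a b : nat -> bool) : comp a -> comp b -> comp (fun x => nat_of_bool (a x && b x)).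
Proof. by move=> Ha Hb; apply: comp_ext (compM Ha Hb) => x; rewrite mulnb. Qed.

Lemma comp_neg (a : nat -> bool) : comp a -> comp (fun x => nat_of_bool (~~ a x)).
Proof. by move=> Ha; apply: comp_ext (compB (comp_const 1) Ha) => x; case: (a x). Qed.

Lemma comp_eq f g : comp f -> comp g -> comp (fun x => nat_of_bool (f x == g x)).
Proof.
move=> Hf Hg; apply: comp_ext (comp_and (comp_leq Hf Hg) (comp_leq Hg Hf)) => x.
by rewrite eqn_leq.
Qed.

Lemma comp_if (b : nat -> bool) f g : comp b -> comp f -> comp g ->
  comp (fun x => if b x then f x else g x).
Proof.
move=> Hb Hf Hg; apply: comp_ext (compD (compM Hb Hf) (compM (comp_neg Hb) Hg)) => x.
by case: (b x); rewrite /= ?mul1n ?mul0n ?addn0.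
Qed.

(** The quotient is the number of positive multiples of [g x] up to [f x]. *)
Lemma comp_div f g : comp f -> comp g -> comp (fun x => f x %/ g x).
Proof.
move=> Hf Hg.
have HF : comp2 (fun x i => (0 < g x) && (i.+1 * g x <= f x)).
  by apply: comp_and; [apply: comp_ltn | apply: comp_leq; first apply: compM]; do !comp_step.
apply: comp_ext (comp_sum Hf HF) => x.
have [-> | g0] := posnP (g x); first by rewrite divn0 big1.
have Hq q m : \sum_(i < m) (i < q : nat) = minn m q.
  by elim: m => [|m IH]; rewrite ?big_ord0 ?min0n // big_ord_recr /= IH; lia.
rewrite -(minn_idPr (leq_div (f x) (g x))) -Hq; apply: eq_bigr => i _.
by rewrite leq_divRL // g0.
Qed.

Lemma comp_mod f g : comp f -> comp g -> comp (fun x => f x %% g x).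
Proof.
move=> Hf Hg; apply: comp_ext (compB Hf (compM (comp_div Hf Hg) Hg)) => x.
by rewrite {1}(divn_eq (f x) (g x)) addKn.
Qed.

Lemma comp_odd f : comp f -> comp (fun x => nat_of_bool (odd (f x))).
Proof. by move=> Hf; apply: comp_ext (comp_mod Hf (comp_const 2)) => x; rewrite modn2. Qed.

End Arithmetic.

(** * Step-bounded evaluation of partial recursive functions *)

Section Stages.
Local Open Scope nat_scope.

Definition enc (v : seq nat) : nat := foldr cpair 0 v.

(** [H t e] is 0 when [t] stages do not suffice, and the successor of the value
    otherwise. *)
Definition stage_fun (n : nat) (c : mu_code n) (H : nat -> nat -> nat) : Prop :=
  [/\ comp2 H,
      forall v y, mu_eval c v y <-> exists t, H t (enc v) = y.+1 &
      forall t t' e y, t <= t' -> H t e = y.+1 -> H t' e = y.+1].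

Lemma enc_cons n (v : n.+1.-tuple nat) : enc v = cpair (thead v) (enc (behead_tuple v)).
Proof. by case/tupleP: v => x u; rewrite theadE. Qed.

Lemma comp_nth_enc i : exists2 p, comp p & forall s, p (enc s) = nth 0 s i.
Proof.
elim: i => [|i [p Hp pE]].
  exists pl; first exact: comp_pl.
  by case=> [|x s]; [exact: (pl_cpair 0 0) | exact: pl_cpair].
exists (fun e => p (pr e)); first exact: comp_comp Hp comp_pr.
case=> [|x s]; last by rewrite /= pr_cpair pE.
by rewrite (pr_cpair 0 0) -[0 in LHS]/(enc [::]) pE !nth_nil.
Qed.

(** Under a composition with [m] inner functions, the stage at which all of them
    are evaluated is one test over the finite family of their stage functions. *)
Lemma comp_collect m (G : 'I_m -> nat -> nat -> nat) (s : seq 'I_m) :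
  (forall i, comp2 (G i)) ->
  exists2 K, comp2 K & forall t e,
    K t e = if all (fun i => 0 < G i t e) s
            then (enc [seq (G i t e).-1 | i <- s]).+1 else 0.
Proof.
move=> HG; elim: s => [|i s [K HK KE]].
  by exists (fun _ _ => 1); first exact: comp_const.
exists (fun t e => if (0 < G i t e) && (0 < K t e)
                   then (cpair (G i t e).-1 (K t e).-1).+1 else 0).
  have Hi := HG i.
  apply: comp_if; last exact: comp_const.
    by apply: comp_and; apply: comp_ltn => //; exact: comp_const.
  by apply: comp_succE; apply: comp_cpair; apply: comp_pred.
move=> t e; rewrite /= KE; case: (0 < G i t e) => //=.
by case: (all _ s).
Qed.

Lemma stage_comp m n (f : mu_code m) (g : 'I_m -> mu_code n) Hf G :
  stage_fun f Hf -> (forall i, stage_fun (g i) (G i)) ->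
  exists H, stage_fun (Comp f g) H.
Proof.
case=> Hf1 Hf2 Hf3 HG.
have [K HK KE] := comp_collect (enum 'I_m) (fun i => let: And3 h _ _ := HG i in h).
exists (fun t e => if 0 < K t e then Hf t (K t e).-1 else 0); split.
- rewrite /comp2; apply: comp_if; [apply: comp_ltn | | ]; rewrite -/(comp _); try exact: comp_const.
    exact: HK.
  apply: (comp2E Hf1); first exact: comp_pl.
  by apply: comp_pred.
- move=> v y /=; split=> [[w [Hw /Hf2 [t Ht]]]|[t]].
    have /choice [tt Htt] i : exists t, G i t (enc v) = (tnth w i).+1.
      by have [_ + _] := HG i => H; exact/H/Hw.
    exists (t + \sum_i tt i).
    have HGi i : G i (t + \sum_i tt i) (enc v) = (tnth w i).+1.
      have [_ _ H] := HG i; apply: H (Htt i).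
      by rewrite (bigD1 i) //=; lia.
    rewrite KE (_ : all _ _) /=; last by apply/allP => i _; rewrite HGi.
    rewrite (_ : map _ _ = w); last first.
      transitivity (val [tuple tnth w i | i < m]); last by congr val; apply: eq_from_tnth => i; rewrite tnth_mktuple.
      by apply: eq_map => i; rewrite HGi.
    by apply: Hf3 Ht; rewrite leq_addr.
  rewrite KE; case: ifP => //; case: ifP => //= /allP Hall _ Hy.
  exists [tuple (G i t (enc v)).-1 | i < m]; split; last by apply/Hf2; exists t.
  move=> i; have [_ + _] := HG i => H; apply/H; exists t; rewrite tnth_mktuple prednK //.
  by apply: Hall; rewrite mem_enum.
move=> t t' e y tt'; rewrite !KE; case: ifP => //; case: ifP => //= /allP Hall _ Hy.
have HGE i : G i t' e = G i t e.
  have [_ _ H] := HG i; have := Hall i; rewrite mem_enum => /(_ isT).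
  by case E: (G i t e) => [//|z] _; exact: H tt' E.
rewrite (_ : all _ _) /=; last by apply/allP => i /Hall; rewrite HGE.
by rewrite (eq_map (g := fun i => (G i t e).-1)) => [|i]; [exact: Hf3 Hy | rewrite HGE].
Qed.

Lemma stage_primrec n (f : mu_code n) (g : mu_code n.+2) Hf Hg :
  stage_fun f Hf -> stage_fun g Hg -> exists H, stage_fun (PrimRec f g) H.
Proof.
case=> Hf1 Hf2 Hf3 [Hg1 Hg2 Hg3].
pose R t u := nat_rect (fun=> nat) (Hf t u)
  (fun k r => if 0 < r then Hg t (cpair k (cpair r.-1 u)) else 0).
have Rmono t t' u k y : t <= t' -> R t u k = y.+1 -> R t' u k = y.+1.
  move=> tt'; elim: k y => [|k IH] y /=; first exact: Hf3.
  case: ifP => //; case E: (R t u k) => [//|z] _.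
  by rewrite (IH z) //=; exact: Hg3.
exists (fun t e => R t (pr e) (pl e)); split.
- rewrite /comp2 /R; apply: comp_nrec; first by do !comp_step.
    by apply: (comp2E Hf1); do !comp_step.
  rewrite /comp3; apply: comp_if; last exact: comp_const.
    by apply: comp_ltn; do !comp_step.
  apply: (comp2E Hg1); first by do !comp_step.
  by repeat (comp_step || apply: comp_pred).
- move=> v; rewrite enc_cons pl_cpair pr_cpair /=; set u := behead_tuple v.
  elim: (thead v) => [|k IH] y /=; first exact: Hf2.
  split=> [[z /IH [t1 H1] /Hg2 [t2]]|[t]].
    rewrite /= => H2; exists (t1 + t2).
    have -> : R (t1 + t2) (enc u) k = z.+1 by apply: Rmono H1; rewrite leq_addr.
    by apply: Hg3 H2; rewrite leq_addl.
  case: ifP => //; case E: (R t (enc u) k) => [//|z] _ H.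
  by exists z; [apply/IH; exists t | apply/Hg2; exists t].
by move=> t t' e y; exact: Rmono.
Qed.

Lemma sum_unique (P : nat -> bool) t y :
  (forall k, P k -> k = y) -> \sum_(k < t) P k * k.+1 = if (y < t) && P y then y.+1 else 0.
Proof.
move=> Hu; elim: t => [|t IH]; first by rewrite big_ord0.
rewrite big_ord_recr /= IH; case Pt: (P t).
  by rewrite -(Hu t Pt) Pt ltnn ltnSn /= mul1n.
by rewrite mul0n addn0 ltnS; case: ltngtP => //= ->; rewrite Pt.
Qed.

(** At stage [t] only candidates below [t] are tried; as at most one of them is
    acceptable, a sum selects it. *)
Lemma stage_mu n (f : mu_code n.+1) Hf :
  stage_fun f Hf -> exists H, stage_fun (Mu f) H.
Proof.
case=> Hf1 Hf2 Hf3.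
pose good t e y := (Hf t (cpair y e) == 1) &&
  (\sum_(k < y) (Hf t (cpair k e) <= 1 : nat) == 0).
have goodP t e y : reflect (Hf t (cpair y e) = 1 /\
    forall k, k < y -> exists z, Hf t (cpair k e) = z.+2) (good t e y).
  apply: (iffP andP) => [[/eqP H1]|[H1 H2]].
    rewrite sum_nat_eq0 => /forallP H2; split=> // k ky.
    have /= := H2 (Ordinal ky).
    by case: (Hf t (cpair k e)) => [|[|z]] // _; exists z.
  split; first exact/eqP.
  rewrite sum_nat_eq0; apply/forallP => k; have [z ->] := H2 k (ltn_ord k); exact.
have good_uniq t e y k : good t e y -> good t e k -> k = y.
  move=> /goodP [H1 H2] /goodP [H3 H4].
  have [/H2 [z]|/H4 [z]|//] := ltngtP k y; first by rewrite H3.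
  by rewrite H1.
pose H t e := \sum_(y < t) good t e y * y.+1.
have HP t e y : H t e = y.+1 <-> y < t /\ good t e y.
  split=> [Hy|[yt gy]]; last by rewrite /H (sum_unique _ (good_uniq _ _ _ ^~ gy)) yt gy.
  have [/existsP [k gk]|] := boolP [exists k : 'I_t, good t e k].
    move: Hy; rewrite /H (sum_unique _ (good_uniq _ _ _ ^~ gk)) ltn_ord gk.
    by case=> <-; rewrite ltn_ord.
  rewrite negb_exists => /forallP Hn; move: Hy; rewrite /H big1 // => k _.
  by rewrite (negbTE (Hn k)).
have good_mono t t' e y : t <= t' -> good t e y -> good t' e y.
  move=> tt' /goodP [H1 H2]; apply/goodP; split; first exact: Hf3 H1.
  by move=> k /H2 [z Hz]; exists z; exact: Hf3 Hz.
exists H; split.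
- apply: (comp_sum (F := fun z y => good (pl z) (pr z) y * y.+1) comp_pl).
  apply: compM; last by do !comp_step.
  apply: comp_and; first by apply: comp_eq; [apply: (comp2E Hf1) | ]; do !comp_step.
  apply: comp_eq; last exact: comp_const.
  apply: (comp_sum (F := fun x k => Hf (pl (pl x)) (cpair k (pr (pl x))) <= 1) comp_pr).
  apply: comp_leq; last exact: comp_const.
  by apply: (comp2E Hf1); do !comp_step.
- move=> v y /=; split=> [[/Hf2 [t Ht] Hk]|[t /HP [yt /goodP [H1 H2]]]].
    have /choice [T HT] k : exists T, k < y -> exists z, Hf T (cpair k (enc v)) = z.+2.
      have [ky|] := boolP (k < y); last by exists 0.
      by have [z /Hf2 [T HT]] := Hk k ky; exists T => _; exists z.
    exists (t + \sum_(k < y) T k + y.+1); apply/HP; split; first by lia.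
    apply/goodP; split; first by apply: Hf3 Ht; lia.
    move=> k ky; have [z Hz] := HT k ky; exists z; apply: Hf3 Hz.
    by rewrite (bigD1 (Ordinal ky)) //=; lia.
  split; first by apply/Hf2; exists t.
  by move=> k /H2 [z Hz]; exists z; apply/Hf2; exists t.
move=> t t' e y tt' /HP [yt gy]; apply/HP; split; first exact: leq_trans tt'.
exact: good_mono gy.
Qed.

(** Only finitely much of a computation is looked at in [t] steps, and more
    steps never change a result already found. *)
Lemma stage_exists n (c : mu_code n) : exists H, stage_fun c H.
Proof.
elim: c => {n} [n||n i|m n f [Hf If] g /choice [G IG]|n f [Hf If] g [Hg Ig]|n f [Hf If]].
- exists (fun _ _ => 1); split=> [|v y|//]; first exact: comp_const.
  by split=> [->|[_ [<-]]] //; exists 0.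
- exists (fun _ e => (pl e).+2); split=> [|v y|//]; first by do !comp_step.
  case/tupleP: v => x u; rewrite /= theadE pl_cpair.
  by split=> [->|[_ [<-]]] //; exists 0.
- have [p Hp pE] := comp_nth_enc i.
  exists (fun _ e => (p e).+1); split=> [|v y|//].
    by rewrite /comp2; do !comp_step.
  rewrite /= pE -(tnth_nth 0).
  by split=> [->|[_ [<-]]] //; exists 0.
- exact: stage_comp If IG.
- exact: stage_primrec If Ig.
- exact: stage_mu If.
Qed.

(** Search for a stage at which the evaluation has ended. *)
Lemma comp_of_recursive f : recursive_fun f -> comp f.
Proof.
case=> c Hc; have [H [H1 H2 H3]] := stage_exists c.
have Hex n : exists t, 0 < H t (cpair n 0).
  have /H2 [t Ht] : mu_eval c [tuple n] (f n) by apply/Hc.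
  by exists t; rewrite (_ : cpair n 0 = enc [tuple n]) // Ht.
pose m n := ex_minn (Hex n).
have Hm : comp m.
  apply: (@comp_mu (fun z => H (pr z) (cpair (pl z) 0) == 0 :> nat)).
  - apply: comp_eq; last exact: comp_const.
    by apply: (comp2E H1); repeat (comp_step || exact: comp_zero).
  - move=> x; rewrite pl_cpair pr_cpair /m; case: ex_minnP => t Ht _.
    by rewrite gtn_eqF.
  move=> x k; rewrite pl_cpair pr_cpair /m; case: ex_minnP => t Ht Hmin kt.
  by case: eqP => // /eqP; rewrite -leqn0 leqNgt; case: ltnP => // /Hmin; lia.
apply: (@comp_ext (fun n => (H (m n) (cpair n 0)).-1)).
  move=> n; rewrite /m; case: ex_minnP => t; case E: (H _ _) => [//|y] _ _ /=.
  by apply/Hc/H2; exists t.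
by apply: comp_pred; apply: (comp2E H1) => //; repeat (comp_step || exact: comp_zero).
Qed.

End Stages.

(** * Codes for computable functions *)

Section Codes.
Local Open Scope nat_scope.

(** Unlike [recursive_fun], this has any arity, as needed for the closure under
    composition and primitive recursion. *)
Definition rec_fun n (f : n.-tuple nat -> nat) : Prop :=
  exists c : mu_code n, forall v y, mu_eval c v y <-> y = f v.

Lemma rec_ext n (f g : n.-tuple nat -> nat) : f =1 g -> rec_fun f -> rec_fun g.
Proof. by move=> /funext ->. Qed.

Lemma rec_proj n (i : 'I_n) : rec_fun (fun v => tnth v i).
Proof. by exists (Proj i). Qed.

Lemma rec_zero n : rec_fun (fun _ : n.-tuple nat => 0).
Proof. by exists (Zero n). Qed.

Lemma rec_comp m n (f : m.-tuple nat -> nat) (g : 'I_m -> n.-tuple nat -> nat) :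
  rec_fun f -> (forall i, rec_fun (g i)) ->
  rec_fun (fun v => f [tuple g i v | i < m]).
Proof.
case=> cf Hf /choice [cg Hg]; exists (Comp cf cg) => v y /=.
split=> [[w [Hw /Hf ->]]|->].
  by congr f; apply: eq_from_tnth => i; rewrite tnth_mktuple; apply/Hg.
by exists [tuple g i v | i < m]; split; [move=> i; rewrite tnth_mktuple; apply/Hg | apply/Hf].
Qed.

Lemma rec_app1 n (f : nat -> nat) (g : n.-tuple nat -> nat) :
  rec_fun (fun v : 1.-tuple nat => f (thead v)) -> rec_fun g ->
  rec_fun (fun v => f (g v)).
Proof.
move=> Hf Hg; apply: rec_ext (rec_comp (g := fun=> g) Hf (fun=> Hg)) => v.
by rewrite /thead tnth_mktuple.
Qed.

Lemma rec_succ n (g : n.-tuple nat -> nat) : rec_fun g -> rec_fun (fun v => (g v).+1).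
Proof. by move=> Hg; apply: (@rec_app1 _ succn) => //; exists Succ. Qed.

Lemma rec_app_cons m n (f : m.+1.-tuple nat -> nat) (a : n.-tuple nat -> nat)
    (g : n.-tuple nat -> m.-tuple nat) :
  rec_fun f -> rec_fun a -> (forall i, rec_fun (fun v => tnth (g v) i)) ->
  rec_fun (fun v => f [tuple of a v :: g v]).
Proof.
move=> Hf Ha Hg.
pose G i v := if unlift ord0 i is Some j then tnth (g v) j else a v.
have HG i : rec_fun (G i) by rewrite /G; case: (unlift ord0 i).
apply: rec_ext (rec_comp Hf HG) => v; congr f; apply: eq_from_tnth => i.
rewrite tnth_mktuple /G; case: unliftP => [j|] ->; last by [].
by rewrite tnthS.
Qed.

(** [PrimRec] takes the recursion variable as first argument; composing it with the
    tuple [a v :: v] frees the recursion bound. *)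
Lemma rec_nrec n (a f : n.-tuple nat -> nat) (g : n.+2.-tuple nat -> nat) :
  rec_fun a -> rec_fun f -> rec_fun g ->
  rec_fun (fun v => nat_rect (fun=> nat) (f v)
                      (fun k r => g [tuple of k :: [tuple of r :: v]]) (a v)).
Proof.
move=> Ha [cf Hf] [cg Hg].
pose F (w : n.+1.-tuple nat) := nat_rect (fun=> nat) (f (behead_tuple w))
  (fun k r => g [tuple of k :: [tuple of r :: behead_tuple w]]) (thead w).
have HF : rec_fun F.
  exists (PrimRec cf cg) => w y; rewrite /F /=; elim: (thead w) y => [|k IH] y /=; first exact: Hf.
  split=> [[z /IH -> /Hg ->]|->]; first by congr g; apply: val_inj.
  by eexists; [apply/IH; reflexivity | apply/Hg; congr g; apply: val_inj].
apply: rec_ext (rec_app_cons HF Ha (fun i => rec_proj i)) => v.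
have Hb : behead_tuple [tuple of a v :: v] = v by exact: val_inj.
by rewrite /F theadE Hb.
Qed.

Lemma rec_pred n (g : n.-tuple nat -> nat) : rec_fun g -> rec_fun (fun v => (g v).-1).
Proof.
move=> Hg; apply: rec_ext (rec_nrec Hg (rec_zero n) (rec_proj ord0)) => v.
by case: (g v).
Qed.

Definition ord_snd n : 'I_n.+2 := lift ord0 ord0.

Lemma tnth_snd T n (a b : T) (v : n.-tuple T) : tnth [tuple of a :: [tuple of b :: v]] (ord_snd n) = b.
Proof. by rewrite (tnth_nth a). Qed.

Lemma recD n (f g : n.-tuple nat -> nat) : rec_fun f -> rec_fun g -> rec_fun (fun v => f v + g v).
Proof.
move=> Hf Hg; apply: rec_ext (rec_nrec Hg Hf (rec_succ (rec_proj (ord_snd n)))) => v.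
by elim: (g v) => [|k /= ->]; rewrite ?addn0 // tnth_snd addnS.
Qed.

Lemma recB n (f g : n.-tuple nat -> nat) : rec_fun f -> rec_fun g -> rec_fun (fun v => f v - g v).
Proof.
move=> Hf Hg; apply: rec_ext (rec_nrec Hg Hf (rec_pred (rec_proj (ord_snd n)))) => v.
by elim: (g v) => [|k /= ->]; rewrite ?subn0 // tnth_snd subnS.
Qed.

Lemma rec_leq n (f g : n.-tuple nat -> nat) : rec_fun f -> rec_fun g ->
  rec_fun (fun v => nat_of_bool (f v <= g v)).
Proof.
move=> Hf Hg; apply: rec_ext (recB (rec_succ (rec_zero n)) (recB Hf Hg)) => v.
by lia.
Qed.

Lemma rec_tri n (g : n.-tuple nat -> nat) : rec_fun g -> rec_fun (fun v => tri (g v)).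
Proof.
move=> Hg.
apply: rec_ext (rec_nrec Hg (rec_zero n)
  (recD (rec_proj (ord_snd n)) (rec_succ (rec_proj ord0)))) => v.
by elim: (g v) => [|k /= ->] //; rewrite tnth_snd.
Qed.

(** The inverse of the pairing function is reached by primitive recursion on a
    single number, the diagonal. *)
Lemma rec_diag n (g : n.-tuple nat -> nat) : rec_fun g -> rec_fun (fun v => diag (g v)).
Proof.
move=> Hg; have H1 := rec_proj (ord_snd n).
apply: rec_ext (rec_nrec Hg (rec_zero n)
  (recD H1 (rec_leq (rec_tri (rec_succ H1)) (rec_succ (rec_proj ord0))))) => v.
by elim: (g v) => [|k /= ->] //; rewrite tnth_snd.
Qed.

Lemma rec_of_comp (f : nat -> nat) n (g : n.-tuple nat -> nat) :
  comp f -> rec_fun g -> rec_fun (fun v => f (g v)).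
Proof.
have Hpr m (h : m.-tuple nat -> nat) : rec_fun h -> rec_fun (fun v => pr (h v)).
  by move=> Hh; apply: recB => //; apply: rec_tri; exact: rec_diag.
have Hpl m (h : m.-tuple nat -> nat) : rec_fun h -> rec_fun (fun v => pl (h v)).
  by move=> Hh; apply: recB; [exact: rec_diag | exact: Hpr].
have Hcp m (h k : m.-tuple nat -> nat) : rec_fun h -> rec_fun k ->
    rec_fun (fun v => cpair (h v) (k v)).
  by move=> Hh Hk; apply: recD => //; apply: rec_tri; exact: recD.
move=> Hf; elim: Hf n g => {f} [||||f g _ IHf _ IHg|f g _ IHf _ IHg|f g _ IHf _ IHg|f m _ IHf m1 m2] n u Hu.
- exact: rec_zero.
- exact: rec_succ.
- exact: Hpl.
- exact: Hpr.
- by apply: Hcp; [exact: IHf | exact: IHg].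
- by apply: IHf; exact: IHg.
- pose i2 := lift ord0 (ord_snd n).
  have H := rec_nrec (Hpr _ _ (rec_proj ord0)) (IHf _ _ (Hpl _ _ (rec_proj (ord0 : 'I_n.+1))))
    (IHg _ _ (Hcp _ _ _ (Hpl _ _ (rec_proj i2))
                 (Hcp _ _ _ (rec_proj ord0) (rec_proj (ord_snd n.+1))))).
  apply: rec_ext (rec_app_cons H Hu (fun i => rec_proj i)) => v.
  rewrite (tnth_nth 0) /=; congr nat_rect; apply/funext => k; apply/funext => r.
have [c Hc] := IHf _ _ (Hcp _ _ _ (rec_proj (ord_snd 0)) (rec_proj ord0)).
apply: rec_app1 Hu; exists (Mu c) => v y; split=> [[/Hc H1 H2]|->].
  move: H1; rewrite !(tnth_nth 0) /= -(tnth_nth 0 v ord0) => H1.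
  have [/m2 []|yk|//] := ltngtP y (m (thead v)); first by [].
  have [z /Hc] := H2 _ yk; rewrite !(tnth_nth 0) /= -(tnth_nth 0 v ord0).
  by rewrite m1.
split=> [|k km]; first by apply/Hc; rewrite !(tnth_nth 0) /= -(tnth_nth 0 v ord0) m1.
exists (f (cpair (thead v) k)).-1; apply/Hc.
rewrite !(tnth_nth 0) /= -(tnth_nth 0 v ord0) prednK // lt0n; apply/eqP; exact: m2.
Qed.

Lemma recursive_of_comp f : comp f -> recursive_fun f.
Proof.
move=> Hf; have [c Hc] := rec_of_comp Hf (rec_proj (ord0 : 'I_1)).
by exists c => n y; rewrite Hc (tnth_nth 0).
Qed.

(** [Mu] is the only source of partiality: the machines built below first search
    for a witness and then read off their output. *)
Lemma search_code (P out : nat -> nat -> nat) : comp2 P -> comp2 out ->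
  exists c : mu_code 1, forall x y, mu_eval c [tuple x] y <->
    exists r, [/\ P x r = 0, forall k, k < r -> P x k <> 0 & y = out x r].
Proof.
move=> HP Hout.
pose q (v : 2.-tuple nat) := cpair (tnth v (ord_snd 0)) (tnth v ord0).
have Hq : rec_fun q.
  by apply: recD; first apply: rec_tri; first apply: recD; exact: rec_proj.
have [cP HcP] := rec_of_comp HP Hq.
have [cO HcO] := rec_of_comp Hout Hq.
pose G (i : 'I_2) : mu_code 1 := if i == ord0 then Mu cP else Proj ord0.
have qE r x : q [tuple r; x] = cpair x r by rewrite /q !(tnth_nth 0).
have PE x r y : mu_eval cP (cons_tuple r [tuple x]) y <-> y = P x r.
  by rewrite HcP (_ : cons_tuple _ _ = [tuple r; x]) ?qE ?pl_cpair ?pr_cpair //; exact: val_inj.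
exists (Comp cO G) => x y; split=> [[w [Hw /HcO ->]]|[r [H1 H2 ->]]].
  have [/PE H1 H2] := Hw ord0; have /= H3 := Hw (ord_snd 0).
  exists (tnth w ord0); split=> //.
    by move=> k /H2 [z /PE <-].
  by rewrite /q pl_cpair pr_cpair H3.
exists [tuple r; x]; split; last by apply/HcO; rewrite qE pl_cpair pr_cpair.
move=> i; rewrite /G; case: eqP => [->|/eqP i0].
  split=> [|k kr]; first by apply/PE.
  by exists (P x k).-1; apply/PE; rewrite prednK // lt0n; apply/eqP; exact: H2.
by rewrite /= !(tnth_nth 0) /=; case: i i0 => -[|[|]].
Qed.

End Codes.

(** * Binary strings as numbers *)

Section Strings.
Local Open Scope nat_scope.

Lemma str_foldl_ge (x : str) a : a <= foldl (fun (n : nat) (b : bool) => n.*2 + b) a x.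
Proof. by elim: x a => //= b x IH a; apply: leq_trans (IH _); lia. Qed.

Lemma str_code1 (x : str) : (str_code x).+1 = foldl (fun (n : nat) (b : bool) => n.*2 + b) 1 x.
Proof. by rewrite /str_code prednK //; exact: str_foldl_ge. Qed.

(** The last bit is the parity of the code, which allows induction and decoding
    from the right end. *)
Lemma str_code_rcons x b : str_code (rcons x b) = (str_code x).*2.+1 + b.
Proof. by rewrite {1}/str_code foldl_rcons -str_code1; lia. Qed.

Lemma str_code_inj : injective str_code.
Proof.
elim/last_ind=> [|x b IH] y; first by case/lastP: y => // y c; rewrite str_code_rcons.
case/lastP: y => [|y c]; rewrite !str_code_rcons //= => H.
have Hbc : b = c by case: b H; case: c => //=; lia.
by congr rcons; [apply: IH; move: H; rewrite Hbc; lia | ].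
Qed.

Lemma str_code_onto n : exists x, str_code x == n.
Proof.
elim/ltn_ind: n => -[_|n IH]; first by exists [::].
have [|x /eqP Hx] := IH n./2; first by lia.
by exists (rcons x (odd n)); rewrite str_code_rcons Hx; apply/eqP; lia.
Qed.

Definition str_of (n : nat) : str := xchoose (str_code_onto n).

Lemma str_ofK n : str_code (str_of n) = n.
Proof. exact/eqP/(xchooseP (str_code_onto n)). Qed.

Lemma str_codeK x : str_of (str_code x) = x.
Proof. by apply: str_code_inj; rewrite str_ofK. Qed.

Lemma str_code_bound x : 2 ^ size x <= (str_code x).+1 < 2 ^ (size x).+1.
Proof.
elim/last_ind: x => [//|x b /andP[]].
by rewrite str_code_rcons size_rcons !expnS; case: b; lia.
Qed.

Lemma str_code_lt x n : (str_code x < (2 ^ n.+1).-1) = (size x <= n).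
Proof.
have /andP[H1 H2] := str_code_bound x; apply/idP/idP => [H|].
  by rewrite leqNgt; apply/negP => /(leq_pexp2l (isT : 0 < 2)); lia.
by rewrite -ltnS => /(leq_pexp2l (isT : 0 < 2)); lia.
Qed.

Lemma size_le_code x : size x <= str_code x.
Proof. by have /andP[H _] := str_code_bound x; have := ltn_expl (size x) (isT : 1 < 2); lia. Qed.

(** The length, and the value as a binary numeral, of the string coded by [c]. *)
Definition slen (c : nat) : nat := \sum_(0 <= i < c) (2 ^ i.+1 <= c.+1).
Definition sval (c : nat) : nat := c.+1 - 2 ^ slen c.

Lemma slen_code x : slen (str_code x) = size x.
Proof.
have /andP[H1 H2] := str_code_bound x; rewrite /slen.
have Hc n m : n <= m -> \sum_(0 <= i < m) (i < n : nat) = n.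
  move=> nm; suff -> : \sum_(0 <= i < m) (i < n : nat) = minn n m by exact/minn_idPl.
  elim: m {nm} => [|m IH]; first by rewrite big_nil minn0.
  by rewrite big_nat_recr //= IH; lia.
rewrite -[RHS](Hc _ _ (size_le_code x)); apply: eq_big_nat => i _; congr nat_of_bool.
apply/idP/idP => [H|H]; last by apply: leq_trans H1; rewrite leq_exp2l.
by rewrite -ltnS -(@ltn_exp2l 2) //; apply: leq_ltn_trans H2.
Qed.

Lemma sval_lt x : sval (str_code x) < 2 ^ size x.
Proof. by have /andP[_] := str_code_bound x; rewrite /sval slen_code expnS; lia. Qed.

Lemma str_code_val x : (str_code x).+1 = 2 ^ size x + sval (str_code x).
Proof. by have /andP[H _] := str_code_bound x; rewrite /sval slen_code; lia. Qed.

Lemma sval_rcons x b : sval (str_code (rcons x b)) = (sval (str_code x)).*2 + b.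
Proof.
have := str_code_val (rcons x b); have := str_code_val x.
by rewrite str_code_rcons size_rcons expnS; lia.
Qed.

Lemma sval_inj x y : size x = size y -> sval (str_code x) = sval (str_code y) -> x = y.
Proof. by move=> Hs Hv; apply: str_code_inj; have := str_code_val x; rewrite Hs Hv -str_code_val => -[]. Qed.

Lemma sval_onto n v : v < 2 ^ n -> exists2 x, size x = n & sval (str_code x) = v.
Proof.
elim: n v => [|n IH] v; first rewrite expn0 => Hv.
  by exists [::] => //; have : sval (str_code [::]) < 1 := sval_lt [::]; lia.
rewrite expnS => Hv; have [|x xn xv] := IH v./2; first by lia.
by exists (rcons x (odd v)); rewrite ?size_rcons ?xn // sval_rcons xv; lia.
Qed.

Lemma sval_cat x z : sval (str_code (x ++ z)) =
  sval (str_code x) * 2 ^ size z + sval (str_code z).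
Proof.
elim/last_ind: z => [|z b IH].
  have : sval (str_code [::]) < 1 := sval_lt [::].
  by rewrite ltnS leqn0 cats0 => /eqP ->; rewrite muln1 addn0.
by rewrite -rcons_cat !sval_rcons IH size_rcons expnS; lia.
Qed.

Lemma comp_slen f : comp f -> comp (fun x => slen (f x)).
Proof.
move=> Hf; suff H : comp slen by exact: (comp_comp H).
apply: comp_sum_nat; first by comp_step.
by apply: comp_leq; repeat (comp_step || apply: compX).
Qed.

Lemma comp_sval f : comp f -> comp (fun x => sval (f x)).
Proof.
move=> Hf; suff H : comp sval by exact: (comp_comp H).
by apply: compB; repeat (comp_step || apply: compX || apply: comp_slen).
Qed.

End Strings.

(** * Counter programs and their oracle Turing machines *)

Section Language.
Local Open Scope nat_scope.

(** Besides the usual commands on counters: [Scan r c] runs [c] once for each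
    bit of the input, adding that bit to [r] beforehand; [Push r] puts one bit
    in front of the query string; [Ask r] adds the oracle's answer to [r]. *)
Inductive cmd :=
| Inc of nat
| Dec of nat
| Seq of cmd & cmd
| While of nat & cmd
| Scan of nat & cmd
| Push of nat
| Ask of nat
| Clear.

Record pstate := PState { regs : nat -> nat; inp : str; qry : str }.

Definition upd (f : nat -> nat) (r v : nat) : nat -> nat :=
  fun j => if j == r then v else f j.

Definition setr (s : pstate) (r v : nat) : pstate :=
  PState (upd (regs s) r v) (inp s) (qry s).

Section Exec.
Variables (B : set str) (N : nat).

Inductive exec : cmd -> pstate -> pstate -> Prop :=
| exec_inc r s : exec (Inc r) s (setr s r (regs s r).+1)
| exec_dec r s : exec (Dec r) s (setr s r (regs s r).-1)
| exec_seq c1 c2 s s1 s2 : exec c1 s s1 -> exec c2 s1 s2 -> exec (Seq c1 c2) s s2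
| exec_while0 r c s : regs s r = 0 -> exec (While r c) s s
| exec_whileS r c s s1 s2 : regs s r <> 0 ->
    exec c s s1 -> exec (While r c) s1 s2 -> exec (While r c) s s2
| exec_scan0 r c s : inp s = [::] -> exec (Scan r c) s s
| exec_scanS r c s b x s1 s2 : inp s = b :: x ->
    exec c (PState (upd (regs s) r (regs s r + b)) x (qry s)) s1 ->
    exec (Scan r c) s1 s2 -> exec (Scan r c) s s2
| exec_push r s : exec (Push r) s (PState (regs s) (inp s) ((0 < regs s r) :: qry s))
| exec_ask r s : size (qry s) <= N ->
    exec (Ask r) s (setr s r (regs s r + (qry s \in B)))
| exec_clear s : exec Clear s (PState (regs s) (inp s) [::]).

End Exec.

Fixpoint reg_bound (c : cmd) : nat :=
  match c with
  | Inc r | Dec r | Push r | Ask r => r.+1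
  | Seq c1 c2 => maxn (reg_bound c1) (reg_bound c2)
  | While r c | Scan r c => maxn r.+1 (reg_bound c)
  | Clear => 0
  end.

Inductive finstr :=
| FInit | FInc of nat | FDec of nat | FJz of nat & nat | FJmp of nat
| FScan of nat & nat | FLeft | FWrite of nat | FAsk | FClear | FHalt of bool.

Fixpoint csize (c : cmd) : nat :=
  match c with
  | Inc _ | Dec _ | Clear => 1
  | Push _ | Ask _ => 2
  | Seq c1 c2 => csize c1 + csize c2
  | While _ c | Scan _ c => (csize c).+2
  end.

(** [o] is the address at which the code is placed; jumps are absolute. *)
Fixpoint flat (o : nat) (c : cmd) : seq finstr :=
  match c with
  | Inc r => [:: FInc r]
  | Dec r => [:: FDec r]
  | Seq c1 c2 => flat o c1 ++ flat (o + csize c1) c2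
  | While r c => FJz r (o + (csize c).+2) :: flat o.+1 c ++ [:: FJmp o]
  | Scan r c => FScan r (o + (csize c).+2) :: flat o.+1 c ++ [:: FJmp o]
  | Push r => [:: FLeft; FWrite r]
  | Ask r => [:: FAsk; FInc r]
  | Clear => [:: FClear]
  end.

Lemma size_flat o c : size (flat o c) = csize c.
Proof.
elim: c o => //= [c1 IH1 c2 IH2|r c IH|r c IH] o.
- by rewrite size_cat IH1 IH2.
- by rewrite size_cat IH /= addn1.
by rewrite size_cat IH /= addn1.
Qed.

End Language.

Section Machine.
Local Open Scope nat_scope.

Notation sym := (symbol unit).
Definition mark : sym := Some (inr tt).

(** A counter with value [n] is a tape whose head is [n] cells to the right of
    the only marked cell, the other cells being blank. *)
Definition counter_rep (n : nat) (t : tape unit) : Prop :=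
  exists j l, if n is m.+1 then t.1 = nseq m None ++ mark :: l /\ t.2 = nseq j None
              else t.1 = l /\ t.2 = mark :: nseq j None.

Definition bits (x : str) : seq sym := [seq Some (inl b) | b <- x].

Definition string_rep (x : str) (t : tape unit) : Prop :=
  exists j, t.2 = bits x ++ nseq j None.

Lemma counter_stay n t : counter_rep n t ->
  counter_rep n (tape_write_move (tape_read t, Stay) t).
Proof.
case: t => l r [j [l']]; case: n => [|m] /= [-> ->] /=; first by exists j, l'.
by case: j => [|j]; [exists 1, l' | exists j.+1, l'].
Qed.

Lemma counter_inc n t : counter_rep n t ->
  counter_rep n.+1 (tape_write_move (tape_read t, GoRight) t).
Proof.
case: t => l r [j [l']]; case: n => [|m] /= [-> ->] /=; first by exists j, l'.
by exists j.-1, l'; case: j.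
Qed.

Lemma counter_dec n t : counter_rep n.+1 t ->
  counter_rep n (tape_write_move (tape_read t, GoLeft) t).
Proof.
case: t => l r [j [l']]; case: n => [|m] /= [-> ->] /=.
  by exists j.-1.+1, l'; case: j.
by exists j.-1.+2, l'; case: j.
Qed.

Lemma counter_read n t : counter_rep n t -> (tape_read t == mark) = (n == 0).
Proof. by case: t => l r [j [l']]; case: n => [|m] /= [-> ->] //=; case: j. Qed.

Lemma string_stay x t : string_rep x t ->
  string_rep x (tape_write_move (tape_read t, Stay) t).
Proof. by case: t => l r [j /= ->]; case: x => [|b x]; [exists j.-1.+1; case: j | exists j]. Qed.

Lemma string_read x t : string_rep x t ->
  tape_read t = if x is b :: _ then Some (inl b) else None.
Proof. by case: t => l r [j /= ->]; case: x => [|b x] //; case: j. Qed.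

Lemma string_right b x t a : string_rep (b :: x) t ->
  string_rep x (tape_write_move (a, GoRight) t).
Proof. by case: t => l r [j /= ->]; exists j. Qed.

Lemma string_push b x t : string_rep x t ->
  string_rep (b :: x) (tape_write_move (Some (inl b), Stay)
                         (tape_write_move (tape_read t, GoLeft) t)).
Proof. by case: t => l r [j /= ->]; case: x => [|c x]; [exists j.-1.+1; case: j | exists j]. Qed.

Lemma leading_bits_rep x t : string_rep x t -> leading_bits t.2 = x.
Proof.
by case: t => l r [j /= ->]; elim: x => [|b x IH] /=; [case: j | rewrite IH].
Qed.

Variables (K : nat) (code : seq finstr).
Notation ix := 'I_K.+2.

Definition act (a : {ffun ix -> sym}) (j : nat) (w : sym * direction) (i : ix) :
  sym * direction := if i == j :> nat then w else (a i, Stay).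

Definition fdelta (f : finstr) (pc : nat) (a : {ffun ix -> sym}) :
    nat * (ix -> sym * direction) :=
  let rd j := a (inord j) in
  let nop := fun i => (a i, Stay) in
  match f with
  | FInit => (pc.+1, fun i : ix => if 1 < (i : nat) then (mark, Stay) else (a i, Stay))
  | FInc r => (pc.+1, act a r.+2 (rd r.+2, GoRight))
  | FDec r => (pc.+1, if rd r.+2 == mark then nop else act a r.+2 (rd r.+2, GoLeft))
  | FJz r o => (if rd r.+2 == mark then o else pc.+1, nop)
  | FJmp o => (o, nop)
  | FScan r o =>
      if rd 0 is Some (inl b)
      then (pc.+1, fun i : ix => if i == 0 :> nat then (rd 0, GoRight)
                            else if b then act a r.+2 (rd r.+2, GoRight) i else (a i, Stay))
      else (o, nop)
  | FLeft => (pc.+1, act a 1 (rd 1, GoLeft))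
  | FWrite r => (pc.+1, act a 1 (Some (inl (rd r.+2 != mark)), Stay))
  | FClear =>
      if rd 1 is Some (inl b) then (pc, act a 1 (None, GoRight)) else (pc.+1, nop)
  | FAsk | FHalt _ => (pc, nop)
  end.

Definition machine : oracle_machine :=
  @OracleMachine 'I_(size code).+1 unit K.+2 (inord 0) (inord 1) ord0
    (fun q => match nth (FHalt false) code q with
              | FHalt b => Halt _ _ _ b
              | FAsk => Query _ _ (inord q.+1) (inord q.+2)
              | f => Step (fun a => let p := fdelta f q a in (inord p.1, p.2))
              end).

Variables (B : set str) (N : nat).
Notation tapes := {ffun ix -> tape unit}.

Definition cfg (pc : nat) (tau : tapes) : config machine := (inord pc, tau).

Definition query_ok (c : config machine) : Prop :=
  forall yes no, om_instr c.1 = Query _ _ yes no -> size (queried_string c) <= N.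

(** Executions are compared together with the bound on the strings they query. *)
Definition runs (c c' : config machine) : Prop :=
  exists t, iter t (step B) c = c' /\ forall i, i < t -> query_ok (iter i (step B) c).

Lemma runs_trans c1 c2 c3 : runs c1 c2 -> runs c2 c3 -> runs c1 c3.
Proof.
case=> t [<- H1] [u [<- H2]]; exists (u + t); split; first by rewrite iterD.
move=> i Hi; have [/H1 //|ti] := ltnP i t.
by rewrite -(subnK ti) iterD; apply: H2; lia.
Qed.

Lemma runs_step c : query_ok c -> runs c (step B c).
Proof. by move=> H; exists 1; split=> // -[]. Qed.

(** Nothing is asked of the left parts of the input and query tapes: the input head
    never moves left, and the query head does so only to overwrite. *)
Definition rep (s : pstate) (tau : tapes) : Prop :=
  [/\ string_rep (inp s) (tau (inord 0)), string_rep (qry s) (tau (inord 1)) &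
      forall r, r < K -> counter_rep (regs s r) (tau (inord r.+2))].

Definition code_at (o : nat) (l : seq finstr) : Prop :=
  o + size l <= size code /\ forall i, i < size l -> nth (FHalt false) code (o + i) = nth (FHalt false) l i.

Lemma code_at_cat o l1 l2 : code_at o (l1 ++ l2) -> code_at o l1 /\ code_at (o + size l1) l2.
Proof.
case; rewrite size_cat => H1 H2; split; split; try lia.
  by move=> i Hi; rewrite H2 ?nth_cat ?Hi //; lia.
by move=> i Hi; rewrite -addnA H2 ?nth_cat; [rewrite ltnNge leq_addr /= addKn | lia].
Qed.

Lemma code_at_cons o f l : code_at o (f :: l) ->
  [/\ o < size code, nth (FHalt false) code o = f & code_at o.+1 l].
Proof.
rewrite -cat1s => /code_at_cat [[/= H1 H2] H3]; split.
- by lia.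
- by have := H2 0 isT; rewrite addn0.
by rewrite addn1 in H3.
Qed.

Definition fstep (f : finstr) (pc : nat) (tau : tapes) : nat * tapes :=
  let p := fdelta f pc [ffun i => tape_read (tau i)] in
  (p.1, [ffun i => tape_write_move (p.2 i) (tau i)]).

Lemma step_cfg pc (tau : tapes) f : pc < size code -> nth (FHalt false) code pc = f ->
  (if f is FAsk then false else if f is FHalt _ then false else true) ->
  runs (cfg pc tau) (cfg (fstep f pc tau).1 (fstep f pc tau).2).
Proof.
move=> Hpc Hf Hn.
have Hi : om_instr (cfg pc tau).1 =
    Step (fun a => let p := fdelta f pc a in (inord p.1, p.2)) :> instruction (om_state machine) _ _.
  by rewrite /= inordK ?Hf; [case: f Hf Hn | lia].
have -> : cfg (fstep f pc tau).1 (fstep f pc tau).2 = step B (cfg pc tau) by rewrite /step Hi.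
by apply: runs_step => y n; rewrite Hi.
Qed.

Lemma ask_cfg pc (tau : tapes) w : pc < size code -> nth (FHalt false) code pc = FAsk ->
  string_rep w (tau (inord 1)) -> size w <= N ->
  runs (cfg pc tau) (cfg (if w \in B then pc.+1 else pc.+2) tau).
Proof.
move=> Hpc Hf Hw Hs.
have Hi : om_instr (cfg pc tau).1 = Query _ _ (inord pc.+1) (inord pc.+2) :> instruction (om_state machine) _ _.
  by rewrite /= inordK ?Hf //; lia.
have Hq : queried_string (cfg pc tau) = w by exact: leading_bits_rep.
have -> : cfg (if w \in B then pc.+1 else pc.+2) tau = step B (cfg pc tau).
  by rewrite /step Hi Hq; case: ifP.
by apply: runs_step => y n _; rewrite Hq.
Qed.

Definition nop_tapes (tau : tapes) : tapes :=
  [ffun i => tape_write_move (tape_read (tau i), Stay) (tau i)].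

(** A step rewrites the scanned symbol on every tape, even where nothing is meant
    to happen; this materializes a blank cell but represents the same state. *)
Lemma rep_nop s (tau : tapes) : rep s tau -> rep s (nop_tapes tau).
Proof.
case=> H1 H2 H3; split=> [||r rK]; rewrite ffunE; try exact: string_stay.
exact/counter_stay/H3.
Qed.

Lemma fstep_nop f pc (tau : tapes) o :
  fdelta f pc [ffun i => tape_read (tau i)] =
    (o, fun i => ([ffun i => tape_read (tau i)] i, Stay)) ->
  fstep f pc tau = (o, nop_tapes tau).
Proof. by rewrite /fstep => -> /=; congr pair; apply/ffunP => i; rewrite !ffunE. Qed.

Lemma val_inord j : j < K.+2 -> (inord j : ix) = j :> nat.
Proof. by move=> H; rewrite inordK. Qed.

Lemma rep_act s (tau : tapes) r (w : sym * direction) n :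
  r < K -> rep s tau -> counter_rep n (tape_write_move w (tau (inord r.+2))) ->
  rep (setr s r n) [ffun i => tape_write_move
    (act [ffun i => tape_read (tau i)] r.+2 w i) (tau i)].
Proof.
move=> rK [H1 H2 H3] H; split=> [||q qK]; rewrite ffunE /act ?val_inord //= ?ffunE.
- exact: string_stay.
- exact: string_stay.
rewrite /upd !eqSS; case: eqP => [->|_] //.
exact/counter_stay/H3.
Qed.

(** Induction on the execution, not on the command: a loop is unfolded once per
    iteration, and its code is entered again at the same address. *)
Lemma exec_runs c s s' : exec B N c s s' -> forall o tau,
  code_at o (flat o c) -> reg_bound c <= K -> rep s tau ->
  exists tau', rep s' tau' /\ runs (cfg o tau) (cfg (o + csize c) tau').
Proof.
elim=> {c s s'}.
- move=> r s o tau /= /code_at_cons [Ho Hc _] rK Hs.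
  have [H1 H2 H3] := Hs.
  exists (fstep (FInc r) o tau).2; split; last by rewrite addn1; exact: (step_cfg tau Ho Hc).
  by apply: rep_act => //; rewrite ffunE; apply/counter_inc/H3.
- move=> r s o tau /= /code_at_cons [Ho Hc _] rK Hs.
  have [H1 H2 H3] := Hs.
  exists (fstep (FDec r) o tau).2; split; last by rewrite addn1; exact: (step_cfg tau Ho Hc).
  case E: (regs s r) => [|n].
    rewrite (@fstep_nop _ _ _ o.+1) /=; last first.
      by rewrite ffunE (counter_read (H3 _ rK)) E.
    rewrite (_ : setr _ _ _ = s); first exact: rep_nop.
    by case: s {Hs H1 H2 H3} E => f i q /= E; congr PState; apply/funext => j; rewrite /upd; case: eqP => // ->.
  rewrite /fstep /= ffunE (counter_read (H3 _ rK)) E.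
  by apply: rep_act => //; apply: counter_dec; rewrite -E; exact: H3.
- move=> c1 c2 s s1 s2 _ IH1 _ IH2 o tau /= /code_at_cat []; rewrite size_flat => A1 A2.
  rewrite geq_max => /andP [K1 K2] /(IH1 _ _ A1 K1) [tau1 [R1 T1]].
  have [tau2 [R2 T2]] := IH2 _ _ A2 K2 R1.
  by exists tau2; split=> //; rewrite addnA; exact: runs_trans T2.
- move=> r c s r0 o tau /= /code_at_cons [Ho Hc _]; rewrite geq_max => /andP [rK _] Hs.
  have [_ _ H3] := Hs.
  exists (nop_tapes tau); split; first exact: rep_nop.
  have := step_cfg tau Ho Hc isT; rewrite (@fstep_nop _ _ _ (o + (csize c).+2)) //=.
  by rewrite ffunE (counter_read (H3 _ rK)) r0.
- move=> r c s s1 s2 r0 _ IH1 _ IH2 o tau /= HA; rewrite geq_max => /andP [rK cK] Hs.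
  have [Ho Hc /code_at_cat [A1]] := code_at_cons HA.
  rewrite size_flat => /code_at_cons [Ho2 Hc2 _].
  have [_ _ H3] := Hs.
  have S1 := step_cfg tau Ho Hc isT.
  rewrite (@fstep_nop _ _ _ o.+1) /= in S1; last first.
    by rewrite ffunE (counter_read (H3 _ rK)); case: eqP.
  have [tau1 [R1 T1]] := IH1 _ _ A1 cK (rep_nop Hs).
  have S2 := step_cfg tau1 Ho2 Hc2 isT.
  rewrite (@fstep_nop _ _ _ o) //= in S2.
  have [|tau2 [R2 T2]] := IH2 o _ HA _ (rep_nop R1); first by rewrite /= geq_max rK.
  exists tau2; split=> //; apply: runs_trans S1 _; apply: runs_trans T1 _.
  exact: runs_trans S2 _.
- move=> r c s i0 o tau /= /code_at_cons [Ho Hc _]; rewrite geq_max => /andP [rK _] Hs.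
  have [H1 _ _] := Hs.
  exists (nop_tapes tau); split; first exact: rep_nop.
  have := step_cfg tau Ho Hc isT; rewrite (@fstep_nop _ _ _ (o + (csize c).+2)) //=.
  by rewrite ffunE (string_read H1) i0.
- move=> r c s b x s1 s2 ib _ IH1 _ IH2 o tau /= HA; rewrite geq_max => /andP [rK cK] Hs.
  have [Ho Hc /code_at_cat [A1]] := code_at_cons HA.
  rewrite size_flat => /code_at_cons [Ho2 Hc2 _].
  have [H1 H2 H3] := Hs; rewrite ib in H1.
  have S1 := step_cfg tau Ho Hc isT.
  have R0 : rep (PState (upd (regs s) r (regs s r + b)) x (qry s)) (fstep (FScan r (o + (csize c).+2)) o tau).2.
    rewrite /fstep /= !ffunE (string_read H1); split=> [||q qK] /=; rewrite ffunE val_inord //=.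
    - exact: string_right H1.
    - rewrite /act val_inord //= ffunE; case: (b); exact: string_stay.
    rewrite /act val_inord //= ffunE /upd !eqSS; case: eqP => [->|_] /=.
      case: (b); first by rewrite addn1; apply/counter_inc/H3.
      by rewrite addn0; apply/counter_stay/H3.
    by case: (b); apply/counter_stay/H3.
  have E1 : (fstep (FScan r (o + (csize c).+2)) o tau).1 = o.+1.
    by rewrite /fstep /= ffunE (string_read H1).
  rewrite E1 in S1.
  have [tau1 [R1 T1]] := IH1 _ _ A1 cK R0.
  have S2 := step_cfg tau1 Ho2 Hc2 isT.
  rewrite (@fstep_nop _ _ _ o) //= in S2.
  have [|tau2 [R2 T2]] := IH2 o _ HA _ (rep_nop R1); first by rewrite /= geq_max rK.
  exists tau2; split=> //; apply: runs_trans S1 _; apply: runs_trans T1 _.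
  exact: runs_trans S2 _.
- move=> r s o tau /= /code_at_cons [Ho Hc /code_at_cons [Ho2 Hc2 _]] rK [H1 H2 H3].
  have S1 := step_cfg tau Ho Hc isT.
  set tau1 := (fstep FLeft o tau).2 in S1.
  have S2 := step_cfg tau1 Ho2 Hc2 isT.
  exists (fstep (FWrite r) o.+1 tau1).2; split; last by rewrite addn2; exact: runs_trans S1 S2.
  have E0 : tau1 (inord 0) = tape_write_move (tape_read (tau (inord 0)), Stay) (tau (inord 0)).
    by rewrite /tau1 /fstep /= ffunE /act val_inord //= ffunE.
  have E1 : tau1 (inord 1) = tape_write_move (tape_read (tau (inord 1)), GoLeft) (tau (inord 1)).
    by rewrite /tau1 /fstep /= ffunE /act val_inord //= ffunE.
  have E2 q : q < K -> counter_rep (regs s q) (tau1 (inord q.+2)).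
    move=> qK; rewrite /tau1 /fstep /= ffunE /act val_inord //= ffunE.
    exact/counter_stay/H3.
  rewrite /fstep /=; split=> [||q qK]; rewrite ffunE /act val_inord //= ffunE.
  - by rewrite E0; exact/string_stay/string_stay.
  - by rewrite (counter_read (E2 _ rK)) lt0n E1; exact: string_push.
  exact/counter_stay/E2.
- move=> r s Hq o tau /= /code_at_cons [Ho Hc /code_at_cons [Ho2 Hc2 _]] rK Hs.
  have [H1 H2 H3] := Hs.
  have S1 := ask_cfg Ho Hc H2 Hq.
  case: ifP S1 => /= wB S1; last first.
    exists tau; rewrite addn2 addn0; split=> //.
    suff -> : setr s r (regs s r) = s by [].
    by case: s {Hs H1 H2 H3 Hq wB S1} => f i q; congr PState; apply/funext => j; rewrite /upd; case: eqP => // ->.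
  exists (fstep (FInc r) o.+1 tau).2; split.
    by rewrite addn1; apply: rep_act => //; rewrite ffunE; apply/counter_inc/H3.
  by rewrite addn2; apply: runs_trans S1 _; exact: (step_cfg tau Ho2 Hc2).
move=> [f x w] o tau /= /code_at_cons [Ho Hc _] _ [/= H1 H2 H3].
elim: w tau H1 H2 H3 => [|b w IH] tau H1 H2 H3.
  exists (nop_tapes tau); split; first exact: rep_nop.
  have := step_cfg tau Ho Hc isT; rewrite (@fstep_nop _ _ _ o.+1) ?addn1 //=.
  by rewrite ffunE (string_read H2).
have S1 := step_cfg tau Ho Hc isT.
have E1 : (fstep FClear o tau).1 = o by rewrite /fstep /= ffunE (string_read H2).
rewrite E1 in S1.
have Ef : (fstep FClear o tau).2 = [ffun i => tape_write_move
    (act [ffun i => tape_read (tau i)] 1 (None, GoRight) i) (tau i)].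
  by rewrite /fstep /= ffunE (string_read H2).
have [|||tau' [R T]] := IH (fstep FClear o tau).2; last by exists tau'; split=> //; exact: runs_trans T.
- by rewrite Ef ffunE /act val_inord //= ffunE; exact: string_stay.
- by rewrite Ef ffunE /act val_inord //=; exact: string_right H2.
by move=> r rK; rewrite Ef ffunE /act val_inord //= ffunE; exact/counter_stay/H3.
Qed.

End Machine.

Section Reduction.
Local Open Scope nat_scope.

Definition start_state (x : str) : pstate := PState (fun=> 0) x [::].

(** After the program has ended the machine stays in a halting state, so that all
    queries occur during the bounded execution. *)
Lemma reducible_of_program (P : cmd) (z : nat) (A B : set str) (f : nat -> nat) :
  (forall x, exists2 s, exec B (f (size x)) P (start_state x) s & (0 < regs s z) = (x \in A)) ->
  reducible_in_query_size f A B.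
Proof.
move=> HP; pose K := maxn (reg_bound P) z.+1.
pose code := FInit :: flat 1 P ++ [:: FJz z (csize P).+3; FHalt true; FHalt false].
pose M := machine K code.
have szc : size code = (csize P).+4 by rewrite /= size_cat size_flat /= addn3.
have main x : exists tau, runs B (f (size x)) (init_config M x)
    (@cfg K code (if x \in A then (csize P).+2 else (csize P).+3) tau).
  have [s Hs zA] := HP x; set N := f (size x).
  have [Ho Hc HA] : [/\ 0 < size code, nth (FHalt false) code 0 = FInit &
      code_at code 1 (behead code)] by split=> //; split.
  have [AP] := code_at_cat HA; rewrite size_flat add1n => /code_at_cons [Ho2 Hc2 _].
  pose tau0 := (init_config M x).2.
  have S0 := step_cfg (K := K) B N tau0 Ho Hc isT.
  have R0 : rep (start_state x) (fstep (K := K) FInit 0 tau0).2.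
    split=> [||r rK]; rewrite ffunE /= inordK // /= !ffunE.
    - rewrite eqxx; apply: string_stay; exists 0; by rewrite /= cats0.
    - rewrite -val_eqE /= !inordK //=; apply: (@string_stay [::]); by exists 0.
    by rewrite -val_eqE /= !inordK //=; exists 0, [::].
  have [|tau1 [R1 T1]] := exec_runs Hs AP _ R0; first by rewrite /K leq_maxl.
  have S2 := step_cfg (K := K) B N tau1 Ho2 Hc2 isT.
  have zK : z < K by rewrite /K leq_max ltnSn orbT.
  have [_ _ H3] := R1.
  rewrite (@fstep_nop _ _ _ _ (if x \in A then (csize P).+2 else (csize P).+3)) in S2; last first.
    by rewrite /= ffunE (counter_read (H3 _ zK)) -zA lt0n; case: (_ == 0).
  exists (nop_tapes tau1).
  rewrite (_ : init_config M x = cfg code 0 tau0); last first.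
    by congr pair; apply: val_inj; rewrite /= inordK.
  apply: runs_trans S0 _; rewrite add1n in T1; exact: runs_trans T1 S2.
have haltE x tau : om_instr (@cfg K code
    (if x \in A then (csize P).+2 else (csize P).+3) tau).1 = Halt _ _ _ (x \in A).
  have Hi : (if x \in A then (csize P).+2 else (csize P).+3) < (size code).+1.
    by rewrite szc; case: ifP => _; lia.
  have Hn : nth (FHalt false) code (if x \in A then (csize P).+2 else (csize P).+3) = FHalt (x \in A).
    case: ifP => _; rewrite /code /= nth_cat size_flat ltnNge ?leqnSn ?leqW //=.
      by rewrite subSnn.
    by rewrite (_ : (csize P).+2 - csize P = 2) //; lia.
  by rewrite /= (inordK Hi) Hn.
exists M; split=> [x|x w].
  by have [tau [t [H _]]] := main x; exists t; rewrite /config_at H.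
case=> t [yes [no [Hi <-]]]; have [tau [u [Hu Hq]]] := main x.
have [tu|ut] := ltnP t u; first exact: Hq tu _ _ Hi.
have stay k : config_at M B x (k + u) = cfg code (if x \in A then (csize P).+2 else (csize P).+3) tau.
  by rewrite /config_at iterD Hu; elim: k => //= k ->; rewrite /step haltE.
by move: Hi; rewrite -(subnK ut) stay haltE.
Qed.

End Reduction.

(** * Counter programs for computable functions *)

Section ExecLemmas.
Local Open Scope nat_scope.

Lemma pstate_ext s s' : regs s =1 regs s' -> inp s = inp s' -> qry s = qry s' -> s = s'.
Proof. by case: s => f x q; case: s' => g y p /= /funext -> -> ->. Qed.

Lemma exec_eq B N c s s1 s2 : exec B N c s s1 -> s1 = s2 -> exec B N c s s2.
Proof. by move=> H <-. Qed.

Lemma exec_seq_eq B N c1 c2 s s1 s2 s3 :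
  exec B N c1 s s1 -> s1 = s2 -> exec B N c2 s2 s3 -> exec B N (Seq c1 c2) s s3.
Proof. by move=> H <-; exact: exec_seq. Qed.

(** The loops below are specified by the state [S i] in which [i] iterations
    remain. *)
Lemma exec_while B N r c (S : nat -> pstate) n :
  regs (S 0) r = 0 ->
  (forall i, i < n -> regs (S i.+1) r <> 0 /\ exec B N c (S i.+1) (S i)) ->
  exec B N (While r c) (S n) (S 0).
Proof.
move=> S0; elim: n => [|n IH] H; first exact: exec_while0.
have [H1 H2] := H n (ltnSn n).
by apply: exec_whileS H1 H2 _; apply: IH => i Hi; apply: H; exact: ltnW.
Qed.

End ExecLemmas.

Ltac st_eq :=
  apply: pstate_ext => //= ?; rewrite /upd /=;
  repeat (case: eqP => ? //=); subst; try lia; try congruence.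

Ltac reg_eq := rewrite /= /upd /=; repeat (case: eqP => ? //=); subst; try lia; try congruence.

Section CounterPrograms.
Local Open Scope nat_scope.
Implicit Types (B : set str) (N : nat) (s : pstate).

(** Loops consume their counter; a copy needs a second register to restore it. *)
Definition Clr r := While r (Dec r).
Definition Move r t := While r (Seq (Dec r) (Inc t)).
Definition Dup r t u := While r (Seq (Dec r) (Seq (Inc t) (Inc u))).
Definition Copy r t u := Seq (Dup r t u) (Move u r).

Lemma exec_clr B N r s : exec B N (Clr r) s (setr s r 0).
Proof.
have -> : s = setr s r (regs s r) by st_eq.
rewrite (_ : setr (setr _ _ _) r 0 = setr s r 0); last by st_eq.
apply: (exec_while (S := fun i => setr s r i)); first by rewrite /= /upd eqxx.
move=> i _; rewrite /= /upd eqxx; split=> //.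
by apply: exec_eq (exec_dec _ _ _ _) _; st_eq.
Qed.

Lemma exec_move B N r t s : r != t ->
  exec B N (Move r t) s (setr (setr s t (regs s t + regs s r)) r 0).
Proof.
move=> /eqP rt; pose S i := setr (setr s t (regs s t + (regs s r - i))) r i.
have -> : s = S (regs s r) by rewrite /S; st_eq.
rewrite (_ : setr _ r 0 = S 0); last by rewrite /S; st_eq.
apply: exec_while; first by rewrite /= /upd eqxx.
move=> i; rewrite /= /upd eqxx => Hi; split=> //.
apply: exec_seq (exec_dec _ _ _ _) _.
by apply: exec_eq (exec_inc _ _ _ _) _; rewrite /S; st_eq.
Qed.

Lemma exec_dup B N r t u s : r != t -> r != u -> t != u ->
  exec B N (Dup r t u) s
    (setr (setr (setr s t (regs s t + regs s r)) u (regs s u + regs s r)) r 0).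
Proof.
move=> /eqP rt /eqP ru /eqP tu.
pose S i := setr (setr (setr s t (regs s t + (regs s r - i))) u (regs s u + (regs s r - i))) r i.
have -> : s = S (regs s r) by rewrite /S; st_eq.
rewrite (_ : setr _ r 0 = S 0); last by rewrite /S; st_eq.
apply: exec_while; first by rewrite /= /upd eqxx.
move=> i; rewrite /= /upd eqxx => Hi; split=> //.
apply: exec_seq (exec_dec _ _ _ _) _; apply: exec_seq (exec_inc _ _ _ _) _.
by apply: exec_eq (exec_inc _ _ _ _) _; rewrite /S; st_eq.
Qed.

Lemma exec_copy B N r t u s : r != t -> r != u -> t != u -> regs s u = 0 ->
  exec B N (Copy r t u) s (setr s t (regs s t + regs s r)).
Proof.
move=> rt ru tu u0; apply: exec_seq (exec_dup _ _ _ rt ru tu) _.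
apply: exec_eq (exec_move _ _ _ _) _; first by rewrite eq_sym.
by move: rt ru tu => /eqP rt /eqP ru /eqP tu; st_eq.
Qed.

(** Turns [a], [b] into [cpair a b], 0: the second loop adds the triangular
    number of [a + b]. *)
Definition Pair a b t u :=
  Seq (Dup b a t) (Seq (While a (Seq (Dec a) (Seq (Inc t) (Copy a t u)))) (Move t a)).

Lemma exec_pair B N a b t u s : uniq [:: a; b; t; u] -> regs s t = 0 -> regs s u = 0 ->
  exec B N (Pair a b t u) s (setr (setr s a (cpair (regs s a) (regs s b))) b 0).
Proof.
rewrite /= !inE !negb_or => /and4P[/and3P[ab at_ au] /andP[bt bu] tu _] t0 u0.
have [ba ta] : b != a /\ t != a by rewrite !(eq_sym _ a).
move: (ab) (at_) (au) (bt) (bu) (tu) => /eqP ? /eqP ? /eqP ? /eqP ? /eqP ? /eqP ?.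
apply: exec_seq (exec_dup _ _ _ ba bt at_) _.
pose x := regs s a; pose y := regs s b.
pose S i := setr (setr (setr s b 0) t (y + (tri (x + y) - tri i))) a i.
apply: (@exec_seq_eq _ _ _ _ _ (S 0) (S 0)) => //.
  apply: (@exec_eq _ _ _ _ (S 0)) => //.
  rewrite (_ : setr _ _ _ = S (x + y)); last by rewrite /S; st_eq.
  apply: exec_while; first by rewrite /= /upd eqxx.
  move=> i Hi; rewrite /= /upd eqxx; split=> //.
  apply: exec_seq (exec_dec _ _ _ _) _; apply: exec_seq (exec_inc _ _ _ _) _.
  apply: exec_eq (exec_copy _ _ at_ au tu _) _; first by reg_eq.
  have Ht : tri i.+1 <= tri (x + y) by exact: tri_mono.
  by rewrite /S /= in Ht *; st_eq.
apply: exec_eq (exec_move _ _ _ ta) _.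
by rewrite /S /cpair -/x -/y; st_eq; rewrite /x /y /=; lia.
Qed.

(** Walks along the diagonals, from the pair coded by 0 to the one coded by
    the value of [r]. *)
Definition Unpair r a b f g :=
  While r (Seq (Dec r) (Seq (Copy a g f) (Seq (Inc f)
    (Seq (While g (Seq (Clr g) (Seq (Dec f) (Seq (Dec a) (Inc b)))))
         (While f (Seq (Dec f) (Seq (Move b a) (Inc a)))))))).

Lemma exec_once B N r c s s1 :
  regs s r <> 0 -> exec B N c s s1 -> regs s1 r = 0 -> exec B N (While r c) s s1.
Proof. by move=> r0 H H1; apply: exec_whileS r0 H _; exact: exec_while0. Qed.

(** One step of the walk through the pairs in the order of their codes. *)
Lemma cpair_next n :
  (pl n.+1, pr n.+1) = if pl n is x.+1 then (x, (pr n).+1) else ((pr n).+1, 0).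
Proof.
rewrite -{1 2}(cpairK n); case: (pl n) => [|x].
  rewrite (_ : (cpair 0 (pr n)).+1 = cpair (pr n).+1 0) ?pl_cpair ?pr_cpair //.
  by rewrite /cpair !addn0 add0n /=; lia.
rewrite (_ : (cpair x.+1 (pr n)).+1 = cpair x (pr n).+1) ?pl_cpair ?pr_cpair //.
by rewrite /cpair addSn !addnS.
Qed.

Lemma exec_unpair B N r a b f g s : uniq [:: r; a; b; f; g] ->
  regs s a = 0 -> regs s b = 0 -> regs s f = 0 -> regs s g = 0 ->
  exec B N (Unpair r a b f g) s
    (setr (setr (setr s a (pl (regs s r))) b (pr (regs s r))) r 0).
Proof.
rewrite /= !inE !negb_or => /and5P[/and4P[ra rb rf rg] /and3P[ab af ag] /andP[bf bg] fg _].
have [ba gf] : b != a /\ g != f by rewrite !(eq_sym b) !(eq_sym g).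
move: (ra) (rb) (rf) (rg) (ab) (af) (ag) (bf) (bg) (fg).
do 10! move=> /eqP ?.
move=> a0 b0 f0 g0.
set n := regs s r.
pose S i := setr (setr (setr s a (pl (n - i))) b (pr (n - i))) r i.
rewrite (_ : setr _ r 0 = S 0); last by rewrite /S subn0.
have -> : s = S n by rewrite /S subnn (_ : pl 0 = 0) // (_ : pr 0 = 0) //; st_eq.
apply: exec_while; first by rewrite /= /upd eqxx.
move=> i Hi; split; first by rewrite /= /upd eqxx.
have := cpair_next (n - i.+1); rewrite -subSn // subSS.
set x := pl (n - i.+1); set y := pr (n - i.+1) => E.
apply: exec_seq (exec_dec _ _ _ _) _.
apply: (@exec_seq_eq _ _ _ _ _ _ (setr (setr (setr (setr s a x) b y) r i) g x)).
- by apply: exec_copy => //; rewrite /S; reg_eq.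
- by rewrite /S -/x -/y; st_eq.
apply: exec_seq (exec_inc _ _ _ _) _.
case Ex : x E => [|x'] [E1 E2].
  apply: exec_seq; first by apply: exec_while0; reg_eq.
  apply: exec_once; first by reg_eq.
    apply: exec_seq (exec_dec _ _ _ _) _.
    apply: exec_seq (exec_move _ _ _ ba) _.
    apply: exec_eq (exec_inc _ _ _ _) _.
    by rewrite /S E1 E2; st_eq.
  by rewrite /S; reg_eq.
apply: exec_seq.
  apply: exec_once; first by reg_eq.
    apply: exec_seq (exec_clr _ _ _ _) _.
    apply: exec_seq (exec_dec _ _ _ _) _.
    apply: exec_seq (exec_dec _ _ _ _) _.
    by apply: exec_inc.
  by reg_eq.
apply: (@exec_eq _ _ _ _ (S i)) => //.
rewrite [X in exec _ _ _ X](_ : _ = S i); last by rewrite /S E1 E2; st_eq.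
by apply: exec_while0; rewrite /S; reg_eq.
Qed.

(** The registers from [k] on are scratch registers, zero before and after; as
    [k] is arbitrary, programs can be nested without interfering. *)
Definition in_place (f : nat -> nat) : Prop := forall r k, r < k -> exists P, forall B N s,
  (forall j, k <= j -> regs s j = 0) -> exec B N P s (setr s r (f (regs s r))).

Lemma in_place_cpair f g : in_place f -> in_place g -> in_place (fun x => cpair (f x) (g x)).
Proof.
move=> Hf Hg r k rk.
have [P HP] := Hf r k.+1 (leqW rk); have [Q HQ] := Hg k k.+1 (ltnSn k).
exists (Seq (Copy r k k.+1) (Seq P (Seq Q (Pair r k k.+1 k.+2)))) => B N s s0.
have [e1 e2 e3] : [/\ regs s k = 0, regs s k.+1 = 0 & regs s k.+2 = 0] by split; apply: s0; lia.
apply: exec_seq; first by apply: exec_copy; rewrite ?e2 //; apply/eqP; lia.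
apply: exec_seq; first by apply: HP => j kj; have := s0 j (ltnW kj); reg_eq.
apply: exec_seq; first by apply: HQ => j kj; have := s0 j (ltnW kj); reg_eq.
apply: exec_eq; first apply: exec_pair; try reg_eq.
  by rewrite /= !inE !negb_or; repeat (apply/andP; split); apply/eqP; lia.
by rewrite e1; st_eq.
Qed.

Lemma in_place_pl : in_place pl.
Proof.
move=> r k rk; exists (Seq (Unpair r k k.+1 k.+2 k.+3) (Seq (Clr k.+1) (Move k r))) => B N s s0.
have [e1 e2 e3 e4] : [/\ regs s k = 0, regs s k.+1 = 0, regs s k.+2 = 0 & regs s k.+3 = 0].
  by split; apply: s0; lia.
apply: exec_seq; first apply: exec_unpair => //.
  by rewrite /= !inE !negb_or; repeat (apply/andP; split => //); apply/eqP; lia.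
apply: exec_seq (exec_clr _ _ _ _) _.
apply: exec_eq; first by apply: exec_move; apply/eqP; lia.
by st_eq.
Qed.

Lemma in_place_pr : in_place pr.
Proof.
move=> r k rk; exists (Seq (Unpair r k k.+1 k.+2 k.+3) (Seq (Clr k) (Move k.+1 r))) => B N s s0.
have [e1 e2 e3 e4] : [/\ regs s k = 0, regs s k.+1 = 0, regs s k.+2 = 0 & regs s k.+3 = 0].
  by split; apply: s0; lia.
apply: exec_seq; first apply: exec_unpair => //.
  by rewrite /= !inE !negb_or; repeat (apply/andP; split => //); apply/eqP; lia.
apply: exec_seq (exec_clr _ _ _ _) _.
apply: exec_eq; first by apply: exec_move; apply/eqP; lia.
by st_eq.
Qed.

Lemma in_place_comp f g : in_place f -> in_place g -> in_place (fun x => f (g x)).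
Proof.
move=> Hf Hg r k rk; have [P HP] := Hf r k rk; have [Q HQ] := Hg r k rk.
exists (Seq Q P) => B N s s0; apply: exec_seq (HQ _ _ _ s0) _.
apply: exec_eq; first by apply: HP => j kj; have := s0 j kj; reg_eq.
by st_eq.
Qed.

Lemma in_place_prec f g : in_place f -> in_place g ->
  in_place (fun z => nat_rect (fun=> nat) (f (pl z))
                   (fun n r => g (cpair (pl z) (cpair n r))) (pr z)).
Proof.
move=> Hf Hg r k rk.
have [P HP] : exists P, forall B N s, (forall j, k.+3 <= j -> regs s j = 0) ->
    exec B N P s (setr s r (f (regs s r))) by apply: Hf; lia.
have [Q HQ] : exists P, forall B N s, (forall j, k.+3 <= j -> regs s j = 0) ->
    exec B N P s (setr s r (g (regs s r))) by apply: Hg; lia.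
have [n1 n2 n3] : [/\ r != k, r != k.+1 & r != k.+2] by split; apply/eqP; lia.
exists (Seq (Unpair r k k.+1 k.+2 k.+3) (Seq (Copy k r k.+2) (Seq P (Seq
  (While k.+1 (Seq (Dec k.+1) (Seq (Copy k k.+3 k.+4) (Seq (Copy k.+2 k.+4 k.+4.+1)
     (Seq (Pair k.+4 r k.+4.+1 k.+4.+2) (Seq (Pair k.+3 k.+4 k.+4.+1 k.+4.+2)
     (Seq (Move k.+3 r) (Seq Q (Inc k.+2))))))))) (Seq (Clr k) (Clr k.+2)))))) => B N s s0.
have z j : k <= j -> regs s j = 0 := s0 j.
set a := pl (regs s r); set n := pr (regs s r).
pose R i := nat_rect (fun=> nat) (f a) (fun n r => g (cpair a (cpair n r))) i.
pose S i := setr (setr (setr (setr s k a) k.+1 i) k.+2 (n - i)) r (R (n - i)).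
apply: exec_seq.
  apply: exec_unpair; try by apply: z; lia.
  by rewrite /= !inE !negb_or; repeat (apply/andP; split => //); apply/eqP; lia.
apply: exec_seq.
  apply: exec_copy; try by apply/eqP; lia.
  by have := z k.+2; reg_eq.
apply: (@exec_seq_eq _ _ _ _ _ _ (S n)).
- by apply: HP => j kj; have := z j; reg_eq.
- by have e2 : regs s k.+2 = 0 by [apply: z; lia]; rewrite /S subnn -/a -/n; st_eq.
apply: (@exec_seq_eq _ _ _ _ _ (S 0) (S 0)) => //.
  apply: exec_while; first by rewrite /S; reg_eq.
  move=> i Hi; split; first by rewrite /S; reg_eq.
  have [z3 z4 z5 z6] : [/\ regs s k.+3 = 0, regs s k.+4 = 0, regs s k.+4.+1 = 0 & regs s k.+4.+2 = 0].
    by split; apply: z; lia.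
  pose S1 := setr (S i.+1) k.+1 i.
  have S1k : regs S1 k = a by rewrite /S1 /S; reg_eq.
  have S12 : regs S1 k.+2 = n - i.+1 by rewrite /S1 /S; reg_eq.
  have S1r : regs S1 r = R (n - i.+1) by rewrite /S1 /S; reg_eq.
  have S13 j : k.+3 <= j -> regs S1 j = 0 by move=> kj; have := z j; rewrite /S1 /S; reg_eq.
  apply: (@exec_seq_eq _ _ _ _ _ _ S1); first exact: exec_dec.
    by rewrite /S1 (_ : regs (S i.+1) k.+1 = i.+1) //; rewrite /S; reg_eq.
  have [t3 t4 t5 t6] : [/\ regs S1 k.+3 = 0, regs S1 k.+4 = 0, regs S1 k.+4.+1 = 0 & regs S1 k.+4.+2 = 0].
    by split; apply: S13; lia.
  apply: (@exec_seq_eq _ _ _ _ _ _ (setr S1 k.+3 a)).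
  - by apply: exec_copy; rewrite ?t4 //; apply/eqP; lia.
  - by rewrite S1k t3; st_eq.
  apply: (@exec_seq_eq _ _ _ _ _ _ (setr (setr S1 k.+3 a) k.+4 (n - i.+1))).
  - by apply: exec_copy; try (by apply/eqP; lia); reg_eq.
  - rewrite (_ : regs _ k.+4 = 0); last by reg_eq.
    by rewrite (_ : regs _ k.+2 = n - i.+1); last by reg_eq.
  apply: (@exec_seq_eq _ _ _ _ _ _
    (setr (setr (setr S1 k.+3 a) k.+4 (cpair (n - i.+1) (R (n - i.+1)))) r 0)).
  - apply: exec_pair; try reg_eq.
    by rewrite /= !inE !negb_or; repeat (apply/andP; split => //); apply/eqP; lia.
  - rewrite (_ : regs _ k.+4 = n - i.+1); last by reg_eq.
    rewrite (_ : regs _ r = R (n - i.+1)); last by reg_eq.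
    by st_eq.
  apply: (@exec_seq_eq _ _ _ _ _ _
    (setr (setr S1 k.+3 (cpair a (cpair (n - i.+1) (R (n - i.+1))))) r 0)).
  - apply: exec_pair; try reg_eq.
    by rewrite /= !inE !negb_or; repeat (apply/andP; split => //); apply/eqP; lia.
  - rewrite (_ : regs _ k.+3 = a); last by reg_eq.
    rewrite (_ : regs _ k.+4 = cpair (n - i.+1) (R (n - i.+1))); last by reg_eq.
    by st_eq.
  apply: (@exec_seq_eq _ _ _ _ _ _ (setr S1 r (cpair a (cpair (n - i.+1) (R (n - i.+1)))))).
  - by apply: exec_move; apply/eqP; lia.
  - by clearbody S1; st_eq.
  apply: exec_seq.
    by apply: HQ => j kj; have := S13 j kj; reg_eq.
  apply: exec_eq (exec_inc _ _ _ _) _.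
  rewrite (_ : regs (setr S1 r _) r = (cpair a (cpair (n - i.+1) (R (n - i.+1))))); last by reg_eq.
  rewrite -[g _]/(R (n - i.+1).+1) subnSK //.
  by rewrite /S1 /S; st_eq.
apply: exec_seq (exec_clr _ _ _ _) _; apply: exec_eq (exec_clr _ _ _ _) _.
have [z0 z1 z2] : [/\ regs s k = 0, regs s k.+1 = 0 & regs s k.+2 = 0] by split; apply: z; lia.
by rewrite /S subn0; st_eq.
Qed.


(** Register [k] counts the candidates and register [k.+1] is the loop flag, set by
    the value of [f] at the candidate just tried. *)
Lemma in_place_mu f m : in_place f -> (forall x, f (cpair x (m x)) = 0) ->
  (forall x i, i < m x -> f (cpair x i) <> 0) -> in_place m.
Proof.
move=> Hf m0 m1 r k rk.
have [P HP] : exists P, forall B N s, (forall j, k.+3 <= j -> regs s j = 0) ->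
    exec B N P s (setr s k.+2 (f (regs s k.+2))) by apply: Hf; lia.
exists (Seq (Inc k.+1) (Seq
  (While k.+1 (Seq (Copy r k.+2 k.+3) (Seq (Copy k k.+3 k.+4)
     (Seq (Pair k.+2 k.+3 k.+4 k.+4.+1) (Seq P (Seq (Clr k.+1)
       (Seq (Move k.+2 k.+1) (Inc k))))))))
  (Seq (Dec k) (Seq (Clr r) (Move k r))))) => B N s z.
set x := regs s r; set n := m x.
pose fl j := if j is 0 then 0 else if j == n.+1 then 1 else f (cpair x (n - j)).
pose S j := setr (setr s k (n.+1 - j)) k.+1 (fl j).
have zz : [/\ regs s k = 0, regs s k.+1 = 0, regs s k.+2 = 0, regs s k.+3 = 0 & regs s k.+4 = 0].
  by split; apply: z; lia.
have [z0 z1 z2 z3 z4] := zz.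
apply: (@exec_seq_eq _ _ _ _ _ _ (S n.+1)); first exact: exec_inc.
  by rewrite /S /fl eqxx subnn z1; st_eq.
apply: (@exec_seq_eq _ _ _ _ _ (S 0) (S 0)) => //.
  apply: exec_while; first by rewrite /S; reg_eq.
  move=> i Hi; split.
    rewrite /= /upd eqxx /=; case: eqP => // /eqP Hn; apply: m1; rewrite -/n.
    by move: Hn; lia.
  have Sk : regs (S i.+1) k = n - i by rewrite /S; reg_eq.
  have Sr : regs (S i.+1) r = x by rewrite /S; reg_eq.
  have Sj j : k.+2 <= j -> regs (S i.+1) j = 0 by move=> kj; have := z j; rewrite /S; reg_eq.
  have [t2 t3 t4 t5] : [/\ regs (S i.+1) k.+2 = 0, regs (S i.+1) k.+3 = 0,
      regs (S i.+1) k.+4 = 0 & regs (S i.+1) k.+4.+1 = 0] by split; apply: Sj; lia.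
  apply: (@exec_seq_eq _ _ _ _ _ _ (setr (S i.+1) k.+2 x)).
  - by apply: exec_copy; rewrite ?t3 //; apply/eqP; lia.
  - by rewrite Sr t2.
  apply: (@exec_seq_eq _ _ _ _ _ _ (setr (setr (S i.+1) k.+2 x) k.+3 (n - i))).
  - by apply: exec_copy; try (by apply/eqP; lia); reg_eq.
  - rewrite (_ : regs _ k.+3 = 0); last by reg_eq.
    by rewrite (_ : regs _ k = n - i); last by reg_eq.
  apply: (@exec_seq_eq _ _ _ _ _ _ (setr (S i.+1) k.+2 (cpair x (n - i)))).
  - apply: exec_pair; try reg_eq.
    by rewrite /= !inE !negb_or; repeat (apply/andP; split => //); apply/eqP; lia.
  - rewrite (_ : regs _ k.+2 = x); last by reg_eq.
    rewrite (_ : regs _ k.+3 = n - i); last by reg_eq.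
    by apply: pstate_ext => // j; rewrite /= /upd; repeat (case: eqP => ? //=); subst; try lia; rewrite ?t3.
  apply: (@exec_seq_eq _ _ _ _ _ _ (setr (S i.+1) k.+2 (f (cpair x (n - i))))).
  - by apply: HP => j kj; have := Sj j; reg_eq.
  - rewrite (_ : regs _ k.+2 = cpair x (n - i)); last by reg_eq.
    by st_eq.
  apply: exec_seq (exec_clr _ _ _ _) _.
  apply: exec_seq; first by apply: exec_move; apply/eqP; lia.
  apply: exec_eq (exec_inc _ _ _ _) _.
  have fE : fl i = f (cpair x (n - i)).
    rewrite /fl; case: i Hi {Sk Sr Sj t2 t3 t4 t5} => [_|i Hi]; first by rewrite subn0 m0.
    by rewrite (_ : (i.+1 == n.+1) = false) //; apply/eqP; lia.
  rewrite (_ : S i = setr (setr (S i.+1) k (n - i).+1) k.+1 (f (cpair x (n - i)))); last first.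
    by rewrite -fE /S; st_eq.
  move: Sk t2; set s1 := S i.+1 => Sk t2.
  by apply: pstate_ext => // j; rewrite /= /upd /=; repeat (case: eqP => ? //=); subst; try lia.
apply: exec_seq (exec_dec _ _ _ _) _; apply: exec_seq (exec_clr _ _ _ _) _.
apply: exec_eq; first by apply: exec_move; apply/eqP; lia.
by rewrite /S; st_eq.
Qed.

Lemma in_place_of_comp f : comp f -> in_place f.
Proof.
elim=> {f} [||||f g _ Hf _ Hg|f g _ Hf _ Hg|f g _ Hf _ Hg|f m _ Hf m0 m1].
- by move=> r k _; exists (Clr r) => B N s _; exact: exec_clr.
- by move=> r k _; exists (Inc r) => B N s _; exact: exec_inc.
- exact: in_place_pl.
- exact: in_place_pr.
- exact: in_place_cpair.
- exact: in_place_comp.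
- exact: in_place_prec.
exact: in_place_mu Hf m0 m1.
Qed.

End CounterPrograms.

(** * Deciding a set with an oracle *)

Section Decide.
Local Open Scope nat_scope.
Implicit Types (B : set str) (N : nat) (s : pstate).

Definition Double r t u := Seq (Dup r t u) (Seq (Move t r) (Move u r)).

Lemma exec_double B N r t u s : uniq [:: r; t; u] -> regs s t = 0 -> regs s u = 0 ->
  exec B N (Double r t u) s (setr s r (regs s r).*2).
Proof.
rewrite /= !inE !negb_or => /and3P[/andP[rt ru] tu _] t0 u0.
have [tr ur] : t != r /\ u != r by rewrite !(eq_sym _ r).
move: (rt) (ru) (tu) => /eqP ? /eqP ? /eqP ?.
apply: exec_seq (exec_dup _ _ _ rt ru tu) _.
apply: exec_seq (exec_move _ _ _ tr) _.
by apply: exec_eq (exec_move _ _ _ ur) _; st_eq.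
Qed.

(** The numeral in register 0 starts as 1 and receives the input bits, so that
    its predecessor is finally the code of the input. *)
Definition ReadInput := Seq (Inc 0) (Seq (Scan 1 (Seq (Double 0 2 3) (Move 1 0))) (Dec 0)).

Lemma exec_read B N x : exec B N ReadInput (start_state x)
  (PState (upd (fun=> 0) 0 (str_code x)) [::] [::]).
Proof.
pose S x v := PState (upd (fun=> 0) 0 v) x [::].
apply: (@exec_seq_eq _ _ _ _ _ _ (S x 1)); [exact: exec_inc | by rewrite /S; st_eq |].
apply: (@exec_seq_eq _ _ _ _ _ (S [::] (str_code x).+1) (S [::] (str_code x).+1)) => //; last first.
  by apply: exec_eq (exec_dec _ _ _ _) _; rewrite /S; st_eq.
rewrite str_code1.
suff H v : exec B N (Scan 1 (Seq (Double 0 2 3) (Move 1 0))) (S x v)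
    (S [::] (foldl (fun (n : nat) (b : bool) => n.*2 + b) v x)) by exact: H.
elim: x v => [|b x IH] v; first exact: exec_scan0.
apply: exec_scanS; [reflexivity | | exact: IH].
apply: exec_seq; first by apply: exec_double.
apply: exec_eq; first exact: exec_move.
by rewrite /S; st_eq.
Qed.

Lemma comp_half f : comp f -> comp (fun x => (f x)./2).
Proof. by move=> Hf; apply: comp_ext (comp_div Hf (comp_const 2)) => x; rewrite divn2. Qed.

(** The bits are pushed from the last to the first: a code [m > 0] is that of a
    string ending with the bit [~~ odd m], the rest of which has code [m.-1./2]. *)
Lemma write_query : exists P, forall B N s w, (forall j, 12 <= j -> regs s j = 0) ->
  regs s 3 = str_code w -> regs s 4 = 0 ->
  exec B N P s (PState (upd (regs s) 3 0) (inp s) (w ++ qry s)).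
Proof.
have Hh : comp (fun m => m.-1./2) by apply: comp_half; apply: comp_pred; exact: comp_id.
have Ho : comp (fun m => ~~ odd m : nat) by apply/comp_neg/comp_odd/comp_id.
have [P HP] : exists P, forall B N s, (forall j, 12 <= j -> regs s j = 0) ->
  exec B N P s (setr s 3 (regs s 3).-1./2) by exact: (in_place_of_comp Hh).
have [Q HQ] : exists P, forall B N s, (forall j, 12 <= j -> regs s j = 0) ->
  exec B N P s (setr s 4 (~~ odd (regs s 4))) by exact: (in_place_of_comp Ho).
exists (While 3 (Seq (Copy 3 4 12) (Seq Q (Seq P (Seq (Push 4) (Clr 4)))))) => B N s w.
elim/last_ind: w s => [|w b IH] s z e3 e4.
  rewrite (_ : PState _ _ _ = s); first exact: exec_while0.
  by apply: pstate_ext => //= j; rewrite /upd; case: eqP => // ->; rewrite e3.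
rewrite str_code_rcons in e3; set c := str_code w in e3.
pose s1 := PState (upd (regs s) 3 c) (inp s) (b :: qry s).
apply: (@exec_whileS _ _ _ _ _ s1); first by rewrite e3.
  apply: (@exec_seq_eq _ _ _ _ _ _ (setr s 4 (regs s 3))).
  - by apply: exec_copy => //; apply: z.
  - by rewrite e4.
  apply: (@exec_seq_eq _ _ _ _ _ _ (setr s 4 b)).
  - by apply: HQ => j kj; have := z j kj; reg_eq.
  - rewrite [regs _ 4]/= /upd /= e3 (_ : ~~ odd _ = b :> nat); first by st_eq.
    by case: (b); rewrite ?addn1 ?addn0 /= odd_double.
  apply: (@exec_seq_eq _ _ _ _ _ _ (setr (setr s 4 b) 3 c)).
  - by apply: HP => j kj; have := z j kj; reg_eq.
  - rewrite [regs _ 3]/= /upd /= e3 (_ : _./2 = c) //.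
    by case: (b); lia.
  apply: exec_seq (exec_push _ _ _ _) _; apply: exec_eq (exec_clr _ _ _ _) _.
  apply: pstate_ext => //= [j|]; last by case: (b).
  by rewrite /upd /=; case: eqP => [->|_] //; case: eqP.
have := IH s1; rewrite /s1 /= cat_rcons => H.
apply: exec_eq.
  by apply: H => //; move=> j kj; have := z j kj; rewrite /upd; case: eqP => // ?; subst.
by apply: pstate_ext => //= j; rewrite /upd; case: eqP.
Qed.

Definition answers B n := \sum_(0 <= i < n) (str_of i \in B) * 2 ^ i.

(** Asking in decreasing order of the codes makes the answers accumulate as
    binary digits by doubling: the [i]-th digit is the answer for the [i]-th
    string. *)
Lemma query_all : exists P, forall B N s,
  (forall j, 2 < j -> regs s j = 0) -> qry s = [::] ->
  (forall i, i < regs s 2 -> size (str_of i) <= N) ->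
  exec B N P s (setr (setr s 2 0) 6 (answers B (regs s 2))).
Proof.
have [P HP] := write_query.
exists (While 2 (Seq (Dec 2) (Seq (Copy 2 3 4) (Seq P (Seq (Ask 5) (Seq Clear
  (Seq (Double 6 12 13) (Move 5 6)))))))) => B N s z q0 Hs.
set n := regs s 2; rewrite -/n in Hs.
pose a j := \sum_(j <= i < n) (str_of i \in B) * 2 ^ (i - j).
pose S j := setr (setr s 2 j) 6 (a j).
have -> : answers B n = a 0 by apply: eq_bigr => i _; rewrite subn0.
have z6 : regs s 6 = 0 by exact: z.
rewrite -[setr (setr s 2 0) 6 _]/(S 0).
have -> : s = S n by rewrite /S /a big_geq //; st_eq.
apply: exec_while => [//|i Hi]; split=> //.
pose s1 := setr (S i.+1) 2 i.
apply: (@exec_seq_eq _ _ _ _ _ _ s1) => //; first exact: exec_dec.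
have z1 j : 2 < j -> j != 6 -> regs s1 j = 0.
  by move=> Hj /eqP j6; rewrite /s1 /S /= /upd; do 2! (case: eqP => //= ?; subst => //); exact: z.
have s12 : regs s1 2 = i by [].
have s16 : regs s1 6 = a i.+1 by [].
have s1q : qry s1 = [::] by [].
have s1E : S i = setr s1 6 (a i) by rewrite /s1 /S; st_eq.
clearbody s1.
apply: (@exec_seq_eq _ _ _ _ _ _ (setr s1 3 i)).
- by apply: exec_copy => //; apply: z1.
- by rewrite z1 // s12.
apply: (@exec_seq_eq _ _ _ _ _ _ (PState (regs s1) (inp s1) (str_of i))).
- apply: (HP _ _ _ (str_of i)); rewrite ?str_ofK //.
    by move=> j Hj; rewrite /= /upd; case: eqP => [?|_]; [subst | apply: z1; lia].
  by rewrite /= /upd /= z1.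
- apply: pstate_ext => //= [j|]; last by rewrite s1q cats0.
  by rewrite /upd; case: eqP => // ->; rewrite z1.
apply: exec_seq; first by apply: exec_ask; apply: Hs.
apply: (@exec_seq_eq _ _ _ _ _ _ (setr s1 5 (str_of i \in B))).
- exact: exec_clear.
- by apply: pstate_ext => //= j; rewrite /upd; case: eqP => // _; rewrite z1.
apply: exec_seq; first by apply: exec_double => //; rewrite /= /upd /=; apply: z1.
apply: exec_eq; first exact: exec_move.
rewrite s1E /= /upd /= s16.
have -> : a i = (a i.+1).*2 + (str_of i \in B).
  rewrite /a big_ltn // subnn muln1 addnC -mul2n big_distrr /=; congr (_ + _).
  apply: eq_big_nat => k /andP[ik _]; rewrite mulnCA -expnS; congr (_ * 2 ^ _); lia.
have e5 : regs s1 5 = 0 by exact: z1.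
by st_eq.
Qed.

(** The verdict [D t a X] of stage [t] is 0 as long as nothing is decided, then 1
    to reject or 2 to accept.  Keeping the search for [t] outside of [D] lets [D]
    be total although the search ends only for the true answers [a]. *)
Lemma reducible_by_stages (bnd : nat -> nat) (D : nat -> nat -> nat -> nat)
    (A B : set str) (f : nat -> nat) :
  comp bnd -> comp3 D ->
  (forall x i, i < bnd (str_code x) -> size (str_of i) <= f (size x)) ->
  (forall x, let D' t := D t (answers B (bnd (str_code x))) (str_code x) in
     (exists t, D' t <> 0) /\ forall t, D' t <> 0 -> D' t = (x \in A).+1) ->
  reducible_in_query_size f A B.
Proof.
move=> Hb HD Hsz HDA.
have [Pb HPb] : exists P, forall B N s, (forall j, 12 <= j -> regs s j = 0) ->
  exec B N P s (setr s 2 (bnd (regs s 2))) by exact: (in_place_of_comp Hb).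
have [PD HPD] : exists P, forall B N s, (forall j, 12 <= j -> regs s j = 0) ->
  exec B N P s (setr s 8 (let z := regs s 8 in D (pl z) (pl (pr z)) (pr (pr z)))).
  exact: (in_place_of_comp HD).
have Hz : comp (fun v => v == 0 : nat) by apply: comp_eq; [exact: comp_id | exact: comp_const].
have [Pz HPz] : exists P, forall B N s, (forall j, 12 <= j -> regs s j = 0) ->
  exec B N P s (setr s 11 (regs s 11 == 0)) by exact: (in_place_of_comp Hz).
have [PQ HPQ] := query_all.
pose Stage := Seq (Dec 11) (Seq (Copy 7 8 12) (Seq (Copy 6 9 12) (Seq (Copy 0 10 12)
  (Seq (Pair 9 10 12 13) (Seq (Pair 8 9 12 13) (Seq PD (Seq (Copy 8 11 12) (Seq Pz (Inc 7))))))))).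
apply: (@reducible_of_program (Seq ReadInput (Seq (Copy 0 2 3) (Seq Pb (Seq PQ
  (Seq (Inc 11) (Seq (While 11 Stage) (Dec 8))))))) 8) => x.
set N := f (size x); set X := str_code x; set n := bnd X; set a := answers B n.
have /= [Hex Hval] := HDA x; rewrite -/X -/n -/a in Hex Hval.
pose Dx t := D t a X.
have Hex' : exists t, Dx t != 0 by have [t Ht] := Hex; exists t; apply/eqP.
have [m Hm Hmin] := ex_minnP Hex'.
pose s0 := PState (upd (upd (fun=> 0) 0 X) 6 a) [::] [::].
pose S j := setr (setr (setr s0 7 (m.+1 - j)) 8 (if j == 0 then Dx m else 0)) 11 (j != 0).
exists (setr (S 0) 8 (Dx m).-1); last first.
  by rewrite /= /upd /= /Dx Hval; [case: (x \in A) | exact/eqP].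
apply: exec_seq (exec_read _ _ _) _.
apply: exec_seq; first by apply: exec_copy.
apply: exec_seq; first by apply: HPb => j; case: j => // -[|[|j]].
apply: (@exec_seq_eq _ _ _ _ _ _ s0).
- apply: HPQ => //; first by case=> [|[|[|j]]].
  by move=> i; apply: Hsz.
- by apply: pstate_ext => // -[|[|[|[|[|[|[|j]]]]]]].
apply: (@exec_seq_eq _ _ _ _ _ _ (S m.+1)); first exact: exec_inc.
  by apply: pstate_ext => // j; rewrite /= /upd /= subnn; do 12! (case: j => [//|j]).
apply: (@exec_seq_eq _ _ _ _ _ (S 0) (S 0)) => //; last exact: exec_dec.
apply: exec_while => // i Hi; split=> //.
have Hi0 : (i != 0) = (Dx (m - i) == 0).
  case: i Hi => [|i] Hi; first by rewrite subn0 (negbTE Hm).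
  by apply/esym/eqP; case E: (Dx _) => [//|d]; have := Hmin (m - i.+1); rewrite E; lia.
have Hi1 : (if i == 0 then Dx m else 0) = Dx (m - i).
  by case: i Hi Hi0 => [|i] Hi; rewrite ?subn0 // => /esym/eqP.
pose s1 := setr s0 7 (m - i).
have s1z j : 7 < j -> regs s1 j = 0 by do 8! (case: j => [//|j]).
have [r0 r6 r7] : [/\ regs s1 0 = X, regs s1 6 = a & regs s1 7 = m - i] by [].
have -> : S i = setr (setr (setr s1 7 (m - i).+1) 8 (Dx (m - i))) 11 (Dx (m - i) == 0).
  by rewrite /S /s1 Hi0 Hi1 subSn //; st_eq.
have S1E : setr (S i.+1) 11 0 = s1.
  rewrite /S /s1 /=; apply: pstate_ext => // j; rewrite /= /upd; do 8! (case: j => [//|j]); by do 4! (case: j => [//|j]).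
apply: (@exec_seq_eq _ _ _ _ _ _ s1 _ (exec_dec _ _ _ _)) => //.
clearbody s1.
apply: (@exec_seq_eq _ _ _ _ _ _ (setr s1 8 (m - i))).
- by apply: exec_copy => //; apply: s1z.
- by rewrite r7 s1z.
apply: (@exec_seq_eq _ _ _ _ _ _ (setr (setr s1 8 (m - i)) 9 a)).
- by apply: exec_copy => //; apply: s1z.
- by rewrite /= /upd /= r6 s1z.
apply: (@exec_seq_eq _ _ _ _ _ _ (setr (setr (setr s1 8 (m - i)) 9 a) 10 X)).
- by apply: exec_copy => //; apply: s1z.
- by rewrite /= /upd /= r0 s1z.
apply: (@exec_seq_eq _ _ _ _ _ _ (setr (setr s1 8 (m - i)) 9 (cpair a X))).
- by apply: exec_pair => //; apply: s1z.
- by rewrite /= /upd /=; apply: pstate_ext => //= j; rewrite /upd; do 3! (case: eqP => //= ?; subst => //); rewrite s1z.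
apply: (@exec_seq_eq _ _ _ _ _ _ (setr s1 8 (cpair (m - i) (cpair a X)))).
- by apply: exec_pair => //; apply: s1z.
- by rewrite /= /upd /=; apply: pstate_ext => //= j; rewrite /upd; do 3! (case: eqP => //= ?; subst => //); rewrite s1z.
apply: (@exec_seq_eq _ _ _ _ _ _ (setr s1 8 (Dx (m - i)))).
- by apply: HPD => j Hj; rewrite /= /upd; case: eqP => [?|_]; [subst | apply: s1z; lia].
- by rewrite /= /upd /= !(pl_cpair, pr_cpair); st_eq.
apply: exec_seq; first by apply: exec_copy => //; apply: s1z.
apply: exec_seq; first by apply: HPz => j Hj; rewrite /= /upd; do 2! (case: eqP => [?|_]; [subst=> // | ]); apply: s1z; lia.
apply: exec_eq (exec_inc _ _ _ _) _.
by rewrite /= /upd /= s1z // add0n r7; apply: pstate_ext => //= j; rewrite /upd; do 3! (case: eqP => //= ?; subst => //).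
Qed.

End Decide.

(** * The partition function as a limit of finite sums *)

Section Kraft.
Variable R : realType.

(** Induction on the maximal length: without the empty string, the set splits
    according to the first bit into two prefix-free sets of shorter strings, each
    of which counts for one half. *)
Lemma kraft_bounded (n : nat) (s : seq str) :
  uniq s -> (forall p, p \in s -> (size p <= n)%N) ->
  (forall p q, p \in s -> q \in s -> prefix p q -> p = q) ->
  \sum_(p <- s) 2 ^- size p <= 1 :> R.
Proof.
elim: n s => [|n IH] s us sn pf.
  case: s us sn pf => [|p [|q s]] us sn pf; first by rewrite big_nil.
    by rewrite big_seq1 invf_le1 ?exprn_ege1 ?ler1n ?exprn_gt0.
  have [hp hq] : p = [::] /\ q = [::].
    by split; apply: size0nil; apply/eqP; rewrite -leqn0 sn // !inE eqxx ?orbT.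
  by move: us; rewrite hp hq.
have [e_s|nes] := boolP ([::] \in s).
  have all0 p : p \in s -> p = [::] by move=> ps; rewrite -(pf _ _ e_s ps (prefix0s p)).
  rewrite big_seq (eq_bigr (fun=> 1)) => [|p /all0 ->]; last by rewrite expr0 invr1.
  rewrite -big_seq big_const_seq count_predT iter_addr_0.
  suff : (size s <= 1)%N by case: (size s) => [|[|]] // _; rewrite ?mulr0n ?mulr1n.
  by apply: (@uniq_leq_size _ s [:: [::]]) => // p /all0 ->; rewrite inE.
pose sb b := [seq behead p | p <- s & head false p == b].
have cons_s b p : (p \in sb b) = (b :: p \in s).
  apply/mapP/idP => [[q]|bp]; last by exists (b :: p); rewrite ?mem_filter //= eqxx.
  rewrite mem_filter => /andP[/eqP <-]; case: q => [/(negP nes) //|c q] /= + ->; exact.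
have sumE b : \sum_(p <- s | head false p == b) 2 ^- size p = 2^-1 * \sum_(p <- sb b) 2 ^- size p :> R.
  rewrite big_map big_filter mulr_sumr [LHS]big_seq_cond [RHS]big_seq_cond.
  apply: eq_bigr => p /andP[ps _]; case: p ps => [/(negP nes)//|c q _] /=.
  by rewrite exprS invfM.
have le1 b : \sum_(p <- sb b) 2 ^- size p <= 1 :> R.
  apply: IH => [|p|p q].
  - rewrite map_inj_in_uniq ?filter_uniq // => p q; rewrite !mem_filter.
    case: p => [/andP[_ /(negP nes)//]|c p]; case: q => [_ /andP[_ /(negP nes)//]|c' q] /=.
    by move=> /andP[/eqP -> _] /andP[/eqP -> _] ->.
  - by rewrite cons_s => /sn.
  - rewrite !cons_s => ps qs pq.
    have /(_ _)/wrap[|[]//] := pf _ _ ps qs; by rewrite /= eqxx.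
rewrite (bigID (fun p => head false p == true)) /= sumE.
rewrite (eq_bigl (fun p => head false p == false)) => [|p]; last by case: (head _ _).
rewrite sumE; have := le1 true; have := le1 false; lra.
Qed.

Lemma kraft (s : seq str) : uniq s ->
  (forall p q, p \in s -> q \in s -> prefix p q -> p = q) ->
  \sum_(p <- s) 2 ^- size p <= 1 :> R.
Proof.
move=> us; apply: (@kraft_bounded (\sum_(p <- s) size p)) => // p ps.
by rewrite (big_rem p) //= leq_addr.
Qed.

Definition in_dom (V : str -> option str) (i : nat) : bool := isSome (V (str_of i)).

Lemma kraft_nat (V : str -> option str) n : prefix_free (domain V) ->
  \sum_(0 <= i < n | in_dom V i) 2 ^- slen i <= 1 :> R.
Proof.
move=> pf; have := @kraft [seq str_of i | i <- [seq i <- iota 0 n | in_dom V i]].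
rewrite big_map big_filter /index_iota subn0.
rewrite (eq_bigr (fun i => 2 ^- slen i)) => [|i _]; last by rewrite -slen_code str_ofK.
apply.
  rewrite map_inj_uniq ?filter_uniq ?iota_uniq // => i j /(congr1 str_code).
  by rewrite !str_ofK.
move=> p q /mapP[i + ->] /mapP[j + ->]; rewrite !mem_filter => /andP[di _] /andP[dj _].
exact: pf.
Qed.

Definition weight (T : R) (l : nat) : R := 2 `^ (- (l%:R / T)).

Lemma weight_gt0 T l : 0 < weight T l.
Proof. by rewrite powR_gt0. Qed.

Lemma weight_le T l : 0 < T -> T <= 1 -> weight T l <= 2 ^- l.
Proof.
move=> T0 T1; rewrite /weight powRN -powR_mulrn // lef_pV2 ?posrE ?powR_gt0 //.
by rewrite ler_powR ?ler1n // ler_pdivlMr // ler_piMr.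
Qed.

(** Kraft's inequality bounds the partial sums, in the length-lexicographic order
    of the programs; so the extended real sum is finite, and [fine] loses
    nothing. *)
Lemma partition_fun_sup (V : str -> option str) (T : R) :
  prefix_free (domain V) -> 0 < T -> T <= 1 ->
  let S n := \sum_(0 <= i < n | in_dom V i) weight T (slen i) in
  (forall n, S n <= partition_fun V T) /\
  (forall e, 0 < e -> exists n, partition_fun V T - e < S n).
Proof.
move=> pf T0 T1 S.
have S1 n : S n <= 1.
  apply: le_trans (kraft_nat n pf); apply: ler_sum => i _; exact: weight_le.
have Smono : {homo S : m n / (m <= n)%N >-> m <= n}.
  apply: homo_leq => // [y x z|n]; first exact: le_trans.
  rewrite /S !(big_mkcond (in_dom V)) big_nat_recr //= lerDl; case: ifP => // _.
  exact: ltW (weight_gt0 _ _).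
have Sub : has_ubound (range S) by exists 1 => _ [n _ <-].
suff ZE : partition_fun V T = sup (range S).
  split=> [n|e e0]; first by rewrite ZE; apply: ub_le_sup => //; exists n.
  have hs : has_sup (range S) by split=> //; exists (S 0%N), 0%N.
  have [_ [n _ <-] Hn] := sup_adherent e0 hs.
  by exists n; rewrite ZE.
rewrite /partition_fun.
rewrite (reindex_esum [set i | in_dom V i] (domain V) str_of); last first.
  split=> [i //|i j _ _ /(congr1 str_code)|p dp]; first by rewrite !str_ofK.
  by exists (str_code p); rewrite /= /in_dom str_codeK.
rewrite -nneseries_esum => [|i _]; last by rewrite lee_fin powR_ge0.
rewrite (_ : (fun n => _) = EFin \o S); last first.
  apply/funext => n; rewrite /= -sumEFin; apply: eq_bigr => i _.
  by rewrite /weight -slen_code str_ofK.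
by rewrite EFin_lim ?fine_lim //; [rewrite /=; apply/cvg_lim => //; exact: nondecreasing_cvgn
  | apply/cvg_ex; exists (sup (range S)); exact: nondecreasing_cvgn].
Qed.

End Kraft.

Section Expansion.
Variable R : realType.

Lemma binary_digits_sum (b : nat -> bool) n :
  series (fun i => (b i)%:R * 2 ^- i.+1 : R) n = (sval (str_code (mkseq b n)))%:R / 2 ^+ n.
Proof.
elim: n => [|n IH].
  have : (sval (str_code [::]) < 1)%N := sval_lt [::].
  by rewrite ltnS leqn0 => /eqP ->; rewrite mul0r /series /= big_geq.
rewrite seriesSr IH mkseqS sval_rcons natrD -mul2n natrM exprS; field.
by rewrite ?expf_neq0.
Qed.

(** The partial sums stay below the limit, and a zero digit beyond [n] keeps the
    limit strictly below the next multiple of [2 ^ - n]. *)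
Lemma binary_expansion_unique (a : R) (b : nat -> bool) n : binary_expansion a b ->
  (sval (str_code (mkseq b n)))%:R <= 2 ^+ n * (a - (Num.floor a)%:~R) <
  (sval (str_code (mkseq b n)))%:R + 1.
Proof.
move=> [cvb zb]; set u := series _ in cvb; set a' := a - _ in cvb *.
have u_le : {homo u : m k / (m <= k)%N >-> m <= k}.
  apply: homo_leq => // [y x z|k]; first exact: le_trans.
  by rewrite /u seriesSr lerDl mulr_ge0.
have u_lea m : u m <= a'.
  rewrite -(cvg_lim (@Rhausdorff R) cvb); apply: nondecreasing_cvgn_le => //.
  by apply/cvg_ex; exists a'.
have [m nm bm] := zb n.
have u_tail k : u (m.+1 + k)%N <= u n + 2 ^- n - 2 ^- m.+1.
  have tail j i : u (j + i)%N <= u j + 2 ^- j - 2 ^- (j + i).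
    elim: i => [|i IH]; first by rewrite addn0 addrK.
    rewrite addnS /u seriesSr -/u (le_trans (lerD IH (lexx _))) //.
    have : (b (j + i)%N)%:R <= 1 :> R by case: (b _).
    rewrite exprS invfM; have : 0 < 2 ^- (j + i) :> R by rewrite invr_gt0 exprn_gt0.
    nra.
  have H1 := tail m.+1 k; have H2 := tail n (m - n)%N.
  rewrite subnKC // in H2.
  have H3 : u m.+1 = u m by rewrite /u seriesSr bm mul0r addr0.
  have : 0 < 2 ^- (m.+1 + k) :> R by rewrite invr_gt0 exprn_gt0.
  rewrite H3 in H1; move: H1 H2; rewrite exprS invfM; lra.
have a'_le : a' <= u n + 2 ^- n - 2 ^- m.+1.
  rewrite -(cvg_lim (@Rhausdorff R) cvb); apply: limr_le.
    by apply/cvg_ex; exists a'.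
  by exists m.+1 => // k /= mk; rewrite -(subnKC mk).
have p2 : 0 < 2 ^+ n :> R by rewrite exprn_gt0.
have m0 : 0 < 2 ^- m.+1 :> R by rewrite invr_gt0 exprn_gt0.
have uE : (sval (str_code (mkseq b n)))%:R = 2 ^+ n * u n.
  by rewrite /u binary_digits_sum mulrCA divff ?mulr1 // gt_eqF.
rewrite uE ler_pM2l // u_lea /= -ltr_pdivlMl // mulrDr mulrA mulVf ?gt_eqF // mul1r mulr1.
by apply: le_lt_trans a'_le _; lra.
Qed.

(** The [i]-th digit is the parity of [2 ^ i.+1 * a] rounded down; if all digits from
    some point on were 1, then [a] would equal the upper end of a dyadic interval
    that excludes it. *)
Lemma binary_expansion_exists (a : R) : 0 <= a -> exists b, binary_expansion a b.
Proof.
move=> a0; pose v n := Num.truncn (2 ^+ n * a).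
have p2 n : 0 < 2 ^+ n :> R by rewrite exprn_gt0.
have vP n : (v n)%:R <= 2 ^+ n * a < (v n)%:R + 1.
  by rewrite natr1 truncn_itv // mulr_ge0 // ltW.
have fl : (Num.floor a)%:~R = (v 0%N)%:R :> R.
  have := vP 0%N; rewrite expr0 mul1r => va.
  by rewrite (@floor_def _ a (Posz (v 0%N))) // intrD.
have vS n : ((v n).*2 <= v n.+1 <= (v n).*2.+1)%N.
  have /andP[H1 H2] := vP n; have /andP[H3 H4] := vP n.+1.
  rewrite exprS -mulrA in H3 H4.
  have E1 : ((v n).*2)%:R = 2 * (v n)%:R :> R by rewrite -mul2n natrM.
  by apply/andP; split; rewrite -ltnS -(ltr_nat R) -!natr1 E1; lra.
pose b i := odd (v i.+1).
have vE n : v n.+1 = ((v n).*2 + b n)%N.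
  rewrite /b; have := vS n; lia.
have uE n : series (fun i => (b i)%:R * 2 ^- i.+1 : R) n = (v n)%:R / 2 ^+ n - (v 0%N)%:R.
  elim: n => [|n IH]; first by rewrite /series /= big_geq // expr0 divr1 subrr.
  rewrite seriesSr IH vE natrD -mul2n natrM exprS; field.
  by rewrite expf_neq0.
have u_dist n : `|a - (v 0%N)%:R - ((v n)%:R / 2 ^+ n - (v 0%N)%:R)| <= 2 ^- n.
  have /andP[H1 H2] := vP n.
  have -> : a - (v 0%N)%:R - ((v n)%:R / 2 ^+ n - (v 0%N)%:R) = (2 ^+ n * a - (v n)%:R) / 2 ^+ n.
    by field; rewrite expf_neq0.
  rewrite normrM [X in _ * X]gtr0_norm ?invr_gt0 // ler_piMl ?invr_ge0 ?(ltW (p2 n)) //.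
  by rewrite ger0_norm; lra.
exists b; split.
  rewrite fl; apply/cvgrPdist_le => e e0.
  have := @cvg_geometric R 1 2^-1; rewrite ger0_norm // => /(_ _)/wrap[|]; first by lra.
  move=> /cvgrPdist_le /(_ e e0) [N _ HN]; exists N => // n Nn; rewrite uE.
  apply: le_trans (u_dist n) _; have := HN n Nn.
  rewrite sub0r normrN /geometric /= mul1r exprVn ger0_norm // invr_ge0; exact: ltW.
move=> n; apply: contrapT => Hn.
have b1 m : (n <= m)%N -> b m = true.
  by move=> nm; apply/negP => bm; apply: Hn; exists m => //; apply/negbTE/negP.
have vk k : ((v (n + k)%N)%:R + 1) / 2 ^+ (n + k) = ((v n)%:R + 1) / 2 ^+ n :> R.
  elim: k => [|k IH]; first by rewrite addn0.
  rewrite -IH addnS vE b1 ?leq_addr // addn1 -natr1 -mul2n natrM exprS; field.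
  by rewrite expf_neq0.
have /andP[_ vn] := vP n.
pose e := ((v n)%:R + 1) / 2 ^+ n - a.
have e0 : 0 < e by rewrite subr_gt0 ltr_pdivlMr // mulrC.
have := @cvg_geometric R 1 2^-1; rewrite ger0_norm // => /(_ _)/wrap[|]; first by lra.
have e2 : 0 < e / 2 by rewrite divr_gt0.
move=> /cvgrPdist_le /(_ _ e2) [N _ HN].
have := HN (n + N)%N (leq_addl _ _); have /andP[H1 H2] := vP (n + N)%N.
rewrite sub0r normrN /geometric /= mul1r exprVn ger0_norm ?invr_ge0 ?(ltW (p2 _)) // => H3.
have : e <= 2 ^- (n + N).
  rewrite /e -(vk N) mulrDl mul1r -[leLHS]addrA [_ - a]addrC addrA -[leRHS]add0r lerD2r subr_le0.
  by rewrite ler_pdivrMr // mulrC.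
by move: H3; lra.
Qed.

(** The first bits of [a] are a number: [2 ^ size x * a] rounded down, modulo the
    integer part. *)
Lemma Pf_sval (a : R) x (v : nat) : 0 <= a ->
  v%:R <= 2 ^+ size x * a < v%:R + 1 ->
  (x \in Pf a) = (sval (str_code x) == v %% 2 ^ size x)%N.
Proof.
move=> a0; set n := size x => va.
have p2 : 0 < 2 ^+ n :> R by rewrite exprn_gt0.
pose f := Num.truncn a.
have fl : (Num.floor a)%:~R = f%:R :> R.
  have /andP[H1 H2] := truncn_itv a0.
  by rewrite (@floor_def _ a (Posz f)) // intrD natr1 H1.
have key b : binary_expansion a b -> sval (str_code (mkseq b n)) = (v %% 2 ^ n)%N.
  move=> /(binary_expansion_unique n); rewrite fl; set w := sval _ => H.
  have -> : v = (w + f * 2 ^ n)%N.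
    have : v%:R < (w + f * 2 ^ n)%N%:R + 1 :> R /\ (w + f * 2 ^ n)%N%:R < v%:R + 1 :> R.
      by rewrite natrD natrM natrX; lra.
    by rewrite !natr1 !ltr_nat; lia.
  by rewrite addnC modnMDl modn_small // -[X in (_ < 2 ^ X)%N](size_mkseq b n); exact: sval_lt.
apply/idP/eqP => [|xv].
  by rewrite inE => -[b [Hb [m xm]]]; rewrite xm -(key b Hb) /n xm size_mkseq.
have [b Hb] := binary_expansion_exists a0.
rewrite inE; exists b; split=> //; exists n.
by apply: sval_inj; rewrite ?size_mkseq // xv key.
Qed.

End Expansion.

(** * Computable reals *)

Section Approximation.
Variable R : realType.

(** Approximations with denominators [2 ^ i] keep all later tests within the natural
    numbers. *)
Definition dyadic_approx (y : R) (C : nat -> nat) : Prop :=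
  comp C /\ forall i, `|(C i)%:R - y * 2 ^+ i| <= 2.

Lemma divn_real (a d : nat) : (0 < d)%N ->
  (a %/ d)%:R <= a%:R / d%:R :> R /\ a%:R / d%:R < (a %/ d)%:R + 1 :> R.
Proof.
move=> d0; have dR : 0 < d%:R :> R by rewrite ltr0n.
rewrite ler_pdivlMr // -natrM ler_nat leq_divM natr1 ltr_pdivrMr // -natrM ltr_nat.
by rewrite ltn_ceil.
Qed.

Lemma dyadic_of_quotients (y : R) (u v : nat -> nat) : comp u -> comp v ->
  (forall i, (0 < v i)%N) -> (forall i, `|(u i)%:R / (v i)%:R - y| * 2 ^+ i <= 1) ->
  exists C, dyadic_approx y C.
Proof.
move=> Hu Hv v0 H; exists (fun i => (u i * 2 ^ i) %/ v i)%N; split.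
  by apply: comp_div => //; apply: compM => //; apply: compX; do !comp_step.
move=> i; have [H1 H2] := divn_real (u i * 2 ^ i)%N (v0 i).
have := H i; rewrite -[X in _ * X]gtr0_norm ?exprn_gt0 // -normrM mulrBl.
rewrite !ler_norml => /andP[H3 H4].
by move: H1 H2 H3 H4; rewrite natrM natrX -mulrA (mulrC (2 ^+ i)) mulrA; lra.
Qed.

Lemma pow2_unbounded (x : R) : exists n : nat, x <= 2 ^+ n.
Proof.
have [n Hn] : exists n : nat, x <= n%:R.
  by exists (Num.truncn x).+1; exact/ltW/truncnS_gt.
by exists n; apply: le_trans Hn _; rewrite -natrX ler_nat ltnW // ltn_expl.
Qed.

Variables (T : R) (T_gt0 : 0 < T).

(** Signs can be dropped, since taking the absolute value of an approximation does
    not increase its distance to [T > 0]. *)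
Lemma computable_real_quotients : computable_real T -> exists P Q : nat -> nat,
  [/\ comp P, comp Q, forall n, (0 < Q n)%N & forall n, `|(P n)%:R / (Q n)%:R - T| < 2 ^- n].
Proof.
case=> a [s [p [q [_ /comp_of_recursive Hp /comp_of_recursive Hq Ha]]]] HT.
exists p, q; split=> // n; have [q0 aE] := Ha n; first by rewrite lt0n.
apply: le_lt_trans (HT n); rewrite distrC.
have -> : (p n)%:R / (q n)%:R = `|ratr (a n)| :> R.
  rewrite aE rmorphM /= rmorphM fmorphV rmorphXn !rmorph_nat rmorphN1 normrM normrM.
  by rewrite normrX normrN1 expr1n mul1r !ger0_norm ?invr_ge0.
by rewrite -{1}(gtr0_norm T_gt0) ler_dist_dist.
Qed.

Lemma dyadic_T : computable_real T -> exists C, dyadic_approx T C.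
Proof.
move=> /computable_real_quotients [P [Q [HP HQ Q0 PQ]]].
apply: (dyadic_of_quotients HP HQ Q0) => i.
by rewrite -ler_pdivlMr ?exprn_gt0 // mul1r ltW.
Qed.

(** Inversion is Lipschitz near [T]; the shift [N] absorbs the Lipschitz constant
    and keeps the approximations above [T / 2]. *)
Lemma dyadic_invT : computable_real T -> exists C, dyadic_approx T^-1 C.
Proof.
move=> /computable_real_quotients [P [Q [HP HQ Q0 PQ]]].
have [N HN] := pow2_unbounded (2 / T + 2 / T ^+ 2).
have t0 : 0 < T^-1 by rewrite invr_gt0.
have t2 : 0 < T ^- 2 by rewrite invr_gt0 exprn_gt0.
have small i : [/\ 0 < 2 ^- (i + N) :> R, 2 ^- (i + N) <= T / 2 & 2 ^- (i + N) * 2 ^+ i * 2 * T ^- 2 <= 1].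
  have p0 k : 0 < 2 ^+ k :> R by rewrite exprn_gt0.
  have HN1 : 2 / T <= 2 ^+ N by move: HN t2; lra.
  have HN2 : 2 * T ^- 2 <= 2 ^+ N by move: HN t0; lra.
  split; first by rewrite invr_gt0.
    rewrite -lef_pV2 ?posrE ?invr_gt0 ?divr_gt0 // invrK invfM invrK mulrC.
    by apply: le_trans HN1 _; rewrite exprD ler_peMl ?(ltW (p0 _)) // exprn_ege1 ?ler1n.
  rewrite exprD invfM -!mulrA (mulrCA (2 ^- N)) mulKf ?gt_eqF //.
  by rewrite mulrC ler_pdivrMr // mul1r.
have PQ_ge i : T / 2 <= (P (i + N)%N)%:R / (Q (i + N)%N)%:R.
  have [_ H1 _] := small i; have := PQ (i + N)%N; rewrite ltr_norml => /andP[H2 _].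
  by move: H1 H2; lra.
have P0 i : (0 < P (i + N))%N.
  rewrite lt0n; apply/negP => /eqP E; have := PQ_ge i; by rewrite E mul0r leNgt divr_gt0.
apply: (@dyadic_of_quotients _ (fun i => Q (i + N)%N) (fun i => P (i + N)%N)) => //.
- by apply: (comp_comp HQ); apply: compD; do !comp_step.
- by apply: (comp_comp HP); apply: compD; do !comp_step.
move=> i; pose y : R := (P (i + N)%N)%:R / (Q (i + N)%N)%:R.
have y0 : 0 < y by apply: lt_le_trans (PQ_ge i); rewrite divr_gt0.
have -> : (Q (i + N)%N)%:R / (P (i + N)%N)%:R = y^-1 by rewrite invf_div.
have -> : y^-1 - T^-1 = (T - y) * (y^-1 * T^-1) by field; rewrite !gt_eqF.
have [H1 H2 H3] := small i.
have yi : y^-1 <= 2 * T^-1.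
  rewrite (_ : 2 * T^-1 = (T / 2)^-1); last by field; rewrite gt_eqF.
  have T2 : 0 < T / 2 by rewrite divr_gt0.
  by rewrite lef_pV2 ?posrE //; exact: (PQ_ge i).
have yp : 0 < y^-1 by rewrite invr_gt0.
rewrite normrM distrC [X in _ * X * _]gtr0_norm ?mulr_gt0 //.
have H4 := ltW (PQ (i + N)%N); rewrite -/y in H4.
have E : y^-1 * T^-1 <= 2 * T ^- 2.
  rewrite [leRHS](_ : _ = 2 * T^-1 * T^-1); last by field; rewrite gt_eqF.
  by rewrite ler_pM2r.
apply: le_trans H3; rewrite [leRHS](_ : _ = 2 ^- (i + N) * (2 * T ^- 2) * 2 ^+ i); last by ring.
rewrite ler_pM2r ?exprn_gt0 //; apply: ler_pM => //.
by rewrite ltW // mulr_gt0.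
Qed.

End Approximation.

Section Linear.
Variable R : realType.

(** Rounding [y n] down at precision [2 ^- (n + s)]: since the error is far
    below [y], consecutive values cannot decrease. *)
Lemma linear_order_function (y : R) C : 0 < y -> dyadic_approx y C ->
  exists phi : nat -> nat, [/\ comp phi, {homo phi : m n / (m <= n)%N} &
    forall n, `|(phi n)%:R - y * n%:R| <= 2].
Proof.
move=> y0 [HC CP].
(* Two consecutive roundings err by at most [2 * 2 ^ - s] each, which must not
   exceed [y] together. *)
have [s Hs] := pow2_unbounded (4 / y + 2).
have s0 k : 0 < 2 ^+ k :> R by rewrite exprn_gt0.
have ys : 4 <= y * 2 ^+ s.
  have : 4 / y <= 2 ^+ s by move: Hs; lra.
  by rewrite ler_pdivrMr // mulrC.
have s2 : 2 <= 2 ^+ s :> R.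
  by have : 0 < 4 / y by [rewrite divr_gt0]; move: Hs; lra.
pose z n : R := (n * C (n + s)%N)%:R / 2 ^+ (n + s).
have zP n : `|z n - y * n%:R| * 2 ^+ s <= 2.
  have -> : z n - y * n%:R = ((C (n + s)%N)%:R - y * 2 ^+ (n + s)) * (n%:R / 2 ^+ (n + s)).
    by rewrite /z natrM; field; rewrite gt_eqF.
  rewrite normrM [`|n%:R / _|]ger0_norm; last by rewrite divr_ge0 // ltW.
  rewrite (_ : _ * _ * 2 ^+ s = `|(C (n + s)%N)%:R - y * 2 ^+ (n + s)| * (n%:R / 2 ^+ n)); last first.
    by rewrite exprD; field; rewrite !gt_eqF.
  have n1 : n%:R / 2 ^+ n <= 1 :> R.
    by rewrite ler_pdivrMr // mul1r -natrX ler_nat ltnW // ltn_expl.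
  have n0 : 0 <= n%:R / 2 ^+ n :> R by rewrite divr_ge0 // ltW.
  have Cn := CP (n + s)%N; rewrite -[leRHS]mulr1; exact: ler_pM.
pose phi n := ((n * C (n + s)) %/ 2 ^ (n + s))%N.
have phiz n : (phi n)%:R <= z n /\ z n < (phi n)%:R + 1.
  have := @divn_real R (n * C (n + s))%N (2 ^ (n + s))%N; rewrite expn_gt0 => /(_ isT).
  by rewrite natrX.
exists phi; split.
- by apply: comp_div; [apply: compM; [|apply: (comp_comp HC)] | apply: compX];
    repeat (comp_step || apply: compD).
- apply: homo_leq => // [n m k|n]; first exact: leq_trans.
  have [H1 _] := phiz n; have [_ H2] := phiz n.+1.
  have zz : z n <= z n.+1.
    have A := zP n; have A' := zP n.+1.
    rewrite -ler_pdivlMr // ler_norml in A; rewrite -ler_pdivlMr // ler_norml in A'.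
    move: A A' => /andP[_ H4] /andP[H3 _].
    have : 4 / 2 ^+ s <= y by rewrite ler_pdivrMr.
    by move: H3 H4; rewrite -natr1; lra.
  rewrite -ltnS -(ltr_nat R) -natr1; apply: le_lt_trans H1 _; exact: le_lt_trans zz H2.
move=> n; have [H1 H2] := phiz n; have := zP n.
have : `|z n - y * n%:R| * 2 <= `|z n - y * n%:R| * 2 ^+ s by rewrite ler_wpM2l.
move=> H3 H4; have : `|z n - y * n%:R| <= 1 by lra.
by rewrite !ler_norml; move: H1 H2; lra.
Qed.

(** The Lipschitz constant of [2 `^ (- u)] on [u >= 0] is [ln 2 <= 1]. *)
Lemma pow2N_lipschitz (u v : R) : 0 <= u -> 0 <= v ->
  `|2 `^ (- u) - 2 `^ (- v)| <= `|u - v|.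
Proof.
wlog uv : u v / u <= v => [H|] u0 v0.
  by have [/H|/ltW /H] := leP u v; [exact | rewrite distrC (distrC u); exact].
have ln2_le1 : ln 2 <= 1 :> R.
  rewrite -ler_expR lnK ?posrE //.
  by have := @expR_ge1Dx R 1; lra.
have ln2_ge0 : 0 <= ln 2 :> R by rewrite ln_ge0 // ler1n.
have E w : 2 `^ w = expR (w * ln 2) :> R by rewrite /powR pnatr_eq0.
have le1 : 2 `^ (- u) <= 1 :> R.
  by rewrite E -[leRHS]expR0 ler_expR mulNr oppr_le0 mulr_ge0.
have H : 2 `^ (- v) = 2 `^ (- u) * 2 `^ (u - v) :> R.
  by rewrite -powRD ?pnatr_eq0 ?implybT //; congr (_ `^ _); lra.
have H2 : 1 - (v - u) <= 2 `^ (u - v) :> R.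
  have := @expR_ge1Dx R ((u - v) * ln 2); rewrite -E; apply: le_trans.
  nra.
have H3 : 2 `^ (u - v) <= 1 :> R.
  by rewrite E -[leRHS]expR0 ler_expR mulr_le0_ge0 // subr_le0.
have p0 : 0 < 2 `^ (- u) :> R by rewrite powR_gt0.
have -> : 2 `^ (- u) - 2 `^ (- v) = 2 `^ (- u) * (1 - 2 `^ (u - v)) by rewrite H mulrBr mulr1.
rewrite ger0_norm; last by apply: mulr_ge0; [exact: ltW | rewrite subr_ge0].
rewrite ler0_norm ?subr_le0 //; nra.
Qed.

(** The numerator of [2 ^ - (l y)] at precision [2 ^- m], found by raising
    candidates to the power [2 ^ i] until the exponent is an integer. *)
Lemma pow2N_approx (y : R) C : 0 < y -> dyadic_approx y C ->
  exists E : nat -> nat -> nat, comp2 E /\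
    forall l m, `|(E l m)%:R - 2 `^ (- (l%:R * y)) * 2 ^+ m| <= 2.
Proof.
move=> y0 [HC CP].
pose I l m := (m + l + 1)%N.
pose E l m := (\sum_(0 <= a < 2 ^ m)
   (a.+1 ^ (2 ^ I l m) * 2 ^ (l * C (I l m)) <= 2 ^ (m * 2 ^ I l m)))%N.
exists E; split.
  rewrite /comp2 /E /I; apply: comp_sum_nat; first by apply: compX; do !comp_step.
  by apply: comp_leq; repeat (comp_step || apply: compX || apply: compM || apply: compD || apply: (comp_comp HC)).
move=> l m; set i := I l m; set c := C i.
have p0 k : 0 < 2 ^+ k :> R by rewrite exprn_gt0.
pose t : R := c%:R / 2 ^+ i.
have t0 : 0 <= t by rewrite divr_ge0 // ltW.
pose w : R := 2 `^ (m%:R - l%:R * t).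
have w0 : 0 <= w by exact: powR_ge0.
have testE a : (a.+1 ^ (2 ^ i) * 2 ^ (l * c) <= 2 ^ (m * 2 ^ i))%N = (a.+1%:R <= w).
  rewrite -(ler_nat R) natrM !natrX -ler_pdivlMr // -[in RHS](@ler_pXn2r _ (2 ^ i)) ?nnegrE ?expn_gt0 //.
  congr (_ <= _); rewrite -[RHS]powR_mulrn // /w -powRrM mulrBl natrX.
  rewrite (_ : l%:R * t * 2 ^+ i = (l * c)%:R); last by rewrite natrM /t; field; rewrite gt_eqF.
  rewrite powRD ?pnatr_eq0 ?implybT // powRN powR_mulrn //; congr (_ / _).
  by rewrite -[2 ^+ i]natrX -natrM powR_mulrn.
have wm : w <= 2 ^+ m.
  by rewrite /w -powR_mulrn // ler_powR ?ler1n // gerBl mulr_ge0.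
have EE : E l m = Num.truncn w.
  have sumE k n : (\sum_(0 <= a < n) (a < k : nat))%N = minn k n.
    elim: n => [|n IH]; first by rewrite big_nil minn0.
    by rewrite big_nat_recr //= IH; lia.
  rewrite /E -/i -/c (eq_bigr (fun a => (a < Num.truncn w)%N : nat)) => [|a _]; last first.
    by rewrite testE truncn_gt_nat.
  rewrite sumE; apply/minn_idPl.
  by rewrite -(ler_nat R) natrX (le_trans _ wm) // truncn_le.
have /andP[H1 H2] := truncn_itv w0.
rewrite -natr1 in H2; rewrite EE.
have tl : l%:R * `|t - y| * 2 ^+ m <= 1.
  have -> : t - y = (c%:R - y * 2 ^+ i) / 2 ^+ i by rewrite /t; field; rewrite gt_eqF.
  rewrite normrM [X in _ * (_ * X)]gtr0_norm ?invr_gt0 // -!mulrA.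
  have : `|c%:R - y * 2 ^+ i| <= 2 by exact: CP.
  have : 0 <= `|c%:R - y * 2 ^+ i| by [].
  move: `|c%:R - y * 2 ^+ i| => D D0 D2; rewrite /i /I !exprD expr1.
  rewrite (_ : (2 ^+ m * 2 ^+ l * 2)^-1 * 2 ^+ m = (2 ^+ l * 2)^-1); last by field; rewrite !gt_eqF.
  rewrite mulrCA -[leRHS](@mulVf _ 2) // mulrC; apply: ler_pM; rewrite ?mulr_ge0 ?invr_ge0 ?(ltW (p0 _)) //.
    rewrite invfM mulrA ler_piMl ?invr_ge0 // ler_pdivrMr // mul1r -natrX ler_nat ltnW // ltn_expl //.
have H3 : `|2 `^ (- (l%:R * t)) - 2 `^ (- (l%:R * y))| <= l%:R * `|t - y|.
  apply: le_trans (pow2N_lipschitz _ _) _; try by rewrite mulr_ge0 // ltW.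
  by rewrite -mulrBr normrM normr_nat.
have wE : w = 2 `^ (- (l%:R * t)) * 2 ^+ m.
  by rewrite /w addrC powRD ?pnatr_eq0 ?implybT // powR_mulrn.
have : `|w - 2 `^ (- (l%:R * y)) * 2 ^+ m| <= 1.
  rewrite wE -mulrBl normrM [X in _ * X]gtr0_norm //.
  by apply: le_trans tl; rewrite ler_pM2r.
by rewrite !ler_norml; move: H1 H2; lra.
Qed.

End Linear.

(** * Bounding the number of changes of the leading bits *)

Section MinSum.
Variables (R : realType) (T : R).
Hypotheses (T_gt0 : 0 < T) (T_lt1 : T < 1).

Definition rate : R := 2 `^ (- T).

Lemma rate_gt0 : 0 < rate. Proof. by rewrite powR_gt0. Qed.

Lemma powR2_gt1 (r : R) : 0 < r -> 1 < 2 `^ r :> R.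
Proof.
move=> r0; have : 1 `^ r < 2 `^ r :> R by rewrite gt0_ltr_powR ?nnegrE ?ltr1n.
by rewrite powR1.
Qed.

Lemma rate_lt1 : rate < 1.
Proof. by rewrite /rate powRN invf_lt1 ?powR_gt0 ?powR2_gt1. Qed.

Lemma rateX n : rate ^+ n = (2 ^- n) `^ T.
Proof.
rewrite -powR_mulrn ?powR_ge0 // -powRrM -powR_invn // -powRrM.
by congr (_ `^ _); rewrite mulrC mulNr mulrN.
Qed.

Lemma geometric_sum_le (a : R) n : 0 < a -> a < 1 -> \sum_(0 <= i < n) a ^+ i <= (1 - a)^-1.
Proof.
move=> a0 a1; have a1' : 0 < 1 - a by rewrite subr_gt0.
rewrite -[leRHS]mul1r ler_pdivlMr // mulrC big_mkord -opprB mulNr -subrX1 opprB gerBl.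
by rewrite exprn_ge0 // ltW.
Qed.

(** Levels [n] with [2 ^ n y < 1] give an increasing geometric sum, those with
    [2 ^ n y >= 1] a decreasing one; both are dominated by the term where they
    meet, which is about [y ^ T]. *)
Lemma level_sum : exists2 C : R, 0 <= C & forall (y : R) M, 0 <= y ->
  \sum_(0 <= n < M) rate ^+ n * Num.min 1 (2 ^+ n * y) <= C * y `^ T.
Proof.
pose b : R := 2 * rate.
have r0 := rate_gt0; have r1 := rate_lt1.
have bE : b = 2 `^ (1 - T).
  by rewrite powRD ?pnatr_eq0 ?implybT // powRr1.
have b1 : 1 < b by rewrite bE powR2_gt1 // subr_gt0.
have b0 : 0 < b by lra.
exists (b / (b - 1) + (1 - rate)^-1).
  by rewrite addr_ge0 // ?divr_ge0 ?invr_ge0 ?subr_ge0 // ltW.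
move=> y M; rewrite le_eqVlt => /predU1P [<-|y0].
  rewrite powR0 ?gt_eqF // mulr0 big1 // => n _.
  by rewrite mulr0 minEle ler10 mulr0.
have [m0 Hm0] := pow2_unbounded y^-1.
have [N0 HN0 HN] := ex_minnP (ex_intro (fun n => y^-1 <= 2 ^+ n) m0 Hm0).
have term_ge0 n : 0 <= rate ^+ n * Num.min 1 (2 ^+ n * y).
  by rewrite mulr_ge0 ?exprn_ge0 ?(ltW r0) // le_min ler01 mulr_ge0 ?exprn_ge0 // ltW.
have ext : \sum_(0 <= n < M) rate ^+ n * Num.min 1 (2 ^+ n * y) <=
    \sum_(0 <= n < N0 + M) rate ^+ n * Num.min 1 (2 ^+ n * y).
  by rewrite (big_cat_nat (leq0n M) (leq_addl N0 M)) /= lerDl sumr_ge0.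
apply: le_trans ext _; rewrite (big_cat_nat (leq0n N0) (leq_addr M N0)) /= mulrDl.
apply: lerD; last first.
  rewrite -{1}[N0]add0n big_addn (addnC N0) addnK.
  have yT : rate ^+ N0 <= y `^ T.
    rewrite rateX ge0_ler_powR ?nnegrE ?invr_ge0 ?exprn_ge0 ?(ltW T_gt0) ?(ltW y0) //.
    by rewrite -[leRHS]invrK lef_pV2 // posrE ?invr_gt0 // exprn_gt0.
  apply: le_trans (_ : rate ^+ N0 * (1 - rate)^-1 <= _); last first.
    by rewrite mulrC ler_wpM2l // invr_ge0 subr_ge0 ltW.
  apply: le_trans (_ : rate ^+ N0 * \sum_(0 <= n < M) rate ^+ n <= _); last first.
    by rewrite ler_wpM2l ?exprn_ge0 ?(ltW r0) //; exact: geometric_sum_le.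
  rewrite mulr_sumr; apply: ler_sum => n _.
  by rewrite addnC exprD ler_piMr ?mulr_ge0 ?exprn_ge0 ?(ltW r0) // ge_min lexx.
have [N00|N00] := posnP N0.
  by rewrite N00 big_geq // !mulr_ge0 ?powR_ge0 ?invr_ge0 ?subr_ge0 // ltW.
apply: le_trans (_ : \sum_(0 <= n < N0) y * b ^+ n <= _).
  apply: ler_sum => n _.
  rewrite [leRHS](_ : _ = rate ^+ n * (2 ^+ n * y)); last by rewrite /b exprMn; ring.
  by rewrite ler_wpM2l ?exprn_ge0 ?(ltW r0) // ge_min lexx orbT.
rewrite -mulr_sumr.
have b1' : 0 < b - 1 by rewrite subr_gt0.
have gs : \sum_(0 <= n < N0) b ^+ n <= b ^+ N0 / (b - 1).
  by rewrite ler_pdivlMr // mulrC big_mkord -subrX1 gerBl.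
apply: le_trans (ler_wpM2l (ltW y0) gs) _.
rewrite mulrA [leRHS]mulrAC ler_pM2r ?invr_gt0 //.
case: N0 HN {HN0 gs} N00 => [//|N] HN _.
have yN : 2 ^+ N <= y^-1.
  by rewrite leNgt; apply/negP => /ltW /HN; rewrite ltnn.
rewrite exprS mulrCA ler_pM2l //.
have -> : b ^+ N = (2 ^+ N) `^ (1 - T).
  by rewrite bE -powR_mulrn ?powR_ge0 // -powRrM mulrC powRrM powR_mulrn.
have -> : y `^ T = y * (y^-1) `^ (1 - T).
  rewrite -powR_inv1 ?(ltW y0) // -powRrM -{2}[y]powRr1 ?(ltW y0) // -powRD; last by rewrite (gt_eqF y0) implybT.
  by congr (_ `^ _); lra.
by rewrite ler_pM2l // ge0_ler_powR ?nnegrE ?invr_ge0 ?exprn_ge0 ?subr_ge0 ?(ltW T_lt1) ?(ltW y0).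
Qed.

End MinSum.

(** * Computable approximation of the partition function from below *)

Section WeightApprox.
Variables (R : realType) (T : R).
Hypotheses (T_gt0 : 0 < T).

(** Subtracting 4 units in the last place makes the approximations strict lower
    bounds that increase with the precision. *)
Lemma weight_approx : computable_real T -> exists K E,
  [/\ comp2 E,
      forall l t, (E l t)%:R / 2 ^+ (K.+2 * t) < weight T l,
      forall l t, weight T l - 6 * 2 ^- (K.+2 * t) <= (E l t)%:R / 2 ^+ (K.+2 * t),
      forall l t, (E l t)%:R / 2 ^+ (K.+2 * t) <= (E l t.+1)%:R / 2 ^+ (K.+2 * t.+1) :> R &
      forall l, 2 ^- (K.+1 * l) <= weight T l].
Proof.
move=> /(dyadic_invT T_gt0) [C HC].
have Ti : 0 < T^-1 by rewrite invr_gt0.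
have [E0 [HE0 E0P]] := pow2N_approx Ti HC.
have [K HK] : exists K : nat, T^-1 <= K%:R.
  by exists (Num.truncn T^-1).+1; exact/ltW/truncnS_gt.
have p0 k : 0 < 2 ^+ k :> R by rewrite exprn_gt0.
pose E l t := (E0 l (K.+2 * t) - 4)%N.
have E0b l m : weight T l * 2 ^+ m - 2 <= (E0 l m)%:R <= weight T l * 2 ^+ m + 2.
  by have := E0P l m; rewrite ler_norml -/(weight T l) => /andP[H1 H2]; apply/andP; split; lra.
have Ege l t : weight T l * 2 ^+ (K.+2 * t) - 6 <= (E l t)%:R.
  have /andP[H1 _] := E0b l (K.+2 * t)%N.
  have : (E0 l (K.+2 * t))%:R <= (E l t + 4)%N%:R :> R by rewrite ler_nat addnC -leq_subLR.
  by rewrite natrD; lra.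
have Ele l t : (E l t = 0)%N \/ (E l t)%:R <= weight T l * 2 ^+ (K.+2 * t) - 2.
  have /andP[_ H2] := E0b l (K.+2 * t)%N.
  have [H|H] := leqP (E0 l (K.+2 * t)) 4; first by left; apply/eqP; rewrite subn_eq0.
  right; have : (E l t + 4)%N%:R = (E0 l (K.+2 * t))%:R :> R by congr _%:R; rewrite /E subnK // ltnW.
  by rewrite natrD; lra.
exists K, E; split.
- rewrite /comp2 /E; apply: compB; last exact: comp_const.
  apply: (comp2E HE0); first by do !comp_step.
  by apply: compM; do !comp_step.
- move=> l t; rewrite ltr_pdivrMr //; have := weight_gt0 T l; have := p0 (K.+2 * t)%N.
  move=> p1 w0; have [->|H] := Ele l t; first by rewrite mulr_gt0.
  by apply: le_lt_trans H _; lra.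
- move=> l t; rewrite ler_pdivlMr // mulrBl -mulrA mulVf ?gt_eqF // mulr1; exact: Ege.
- move=> l t; have [->|H] := Ele l t; first by rewrite mul0r divr_ge0 // ltW.
  rewrite mulnS exprD invfM mulrA ler_pM2r ?invr_gt0 // ler_pdivlMr //.
  have H' := Ege l t.+1; rewrite mulnS exprD in H'.
  apply: le_trans H'; apply: le_trans (ler_wpM2r (ltW (p0 _)) H) _.
  have K4 : 4 <= 2 ^+ K.+2 :> R.
    have : 1 <= 2 ^+ K :> R by rewrite exprn_ege1 // ler1n.
    by rewrite !exprS; lra.
  by move: K4; lra.
move=> l; rewrite /weight powRN -powR_mulrn // lef_pV2 ?posrE ?powR_gt0 //.
rewrite ler_powR ?ler1n // natrM mulrC ler_wpM2r // -natr1.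
by apply: le_trans HK _; rewrite lerDl.
Qed.

End WeightApprox.

Section MachineStages.

Lemma machine_stages (F : str -> option str) : partial_recursive F -> exists H,
  [/\ comp2 H,
      forall p y, (exists t, H t (str_code p) = y.+1) <-> omap str_code (F p) = Some y &
      forall t t' q y, (t <= t')%N -> H t q = y.+1 -> H t' q = y.+1].
Proof.
case=> c Hc; have [H0 [H1 H2 H3]] := stage_exists c.
exists (fun t q => H0 t (cpair q 0)); split=> [|p y|t t' q y].
- by apply: (comp2E H1); repeat (comp_step || exact: comp_zero).
- by rewrite -Hc H2 /=.
exact: H3.
Qed.

End MachineStages.

Section LowerSums.
Variables (R : realType) (T : R).
Hypotheses (T_gt0 : 0 < T) (T_lt1 : T < 1).
Variables (V : str -> option str) (H : nat -> nat -> nat).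
Hypothesis V_prefix_free : prefix_free (domain V).
Hypothesis H_val : forall p y,
  (exists t, H t (str_code p) = y.+1) <-> omap str_code (V p) = Some y.
Hypothesis H_mono : forall t t' q y, (t <= t')%N -> H t q = y.+1 -> H t' q = y.+1.
Variables (K : nat) (E : nat -> nat -> nat).
Hypothesis E_lt : forall l t, (E l t)%:R / 2 ^+ (K.+2 * t) < weight T l.
Hypothesis E_ge : forall l t,
  weight T l - 6 * 2 ^- (K.+2 * t) <= (E l t)%:R / 2 ^+ (K.+2 * t).
Hypothesis E_mono : forall l t,
  (E l t)%:R / 2 ^+ (K.+2 * t) <= (E l t.+1)%:R / 2 ^+ (K.+2 * t.+1) :> R.
Hypothesis K_big : forall l, 2 ^- (K.+1 * l) <= weight T l.

(** The condition [q < t] makes the programs counted at stage [t] finitely many. *)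
Definition halted t q : bool := (q < t)%N && (0 < H t q)%N.

Definition lower_num t : nat := (\sum_(0 <= q < t) halted t q * E (slen q) t)%N.

Definition lower_sum t : R := (lower_num t)%:R / 2 ^+ (K.+2 * t).

(** The first [n] bits, integer part included, of the lower bound of stage [t]. *)
Definition leading n t : nat := ((2 ^ n * lower_num t) %/ 2 ^ (K.+2 * t))%N.

Notation Z := (partition_fun V T).
Notation wt q := (weight T (slen q)).

Let e q t : R := (E (slen q) t)%:R / 2 ^+ (K.+2 * t).
Let c t q : R := (halted t q)%:R * e q t.

Let p0 k : 0 < 2 ^+ k :> R. Proof. by rewrite exprn_gt0. Qed.
Let e_ge0 q t : 0 <= e q t. Proof. by rewrite divr_ge0 // ltW. Qed.
Let wt_gt0 q : 0 < wt q. Proof. exact: weight_gt0. Qed.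

Lemma halted_mono t t' q : (t <= t')%N -> halted t q -> halted t' q.
Proof.
move=> tt' /andP[qt]; case Ey: (H t q) => [//|y] _.
by rewrite /halted (leq_trans qt tt') (H_mono tt' Ey).
Qed.

Lemma halted_dom t q : halted t q -> in_dom V q.
Proof.
move=> /andP[_]; case Ey: (H t q) => [//|y] _.
have : omap str_code (V (str_of q)) = Some y by apply/H_val; exists t; rewrite str_ofK.
by rewrite /in_dom; case: (V _).
Qed.

Lemma dom_halted q : in_dom V q -> exists t, halted t q.
Proof.
rewrite /in_dom; case Vq: (V (str_of q)) => [w|//] _.
have [t] : exists t, H t (str_code (str_of q)) = (str_code w).+1.
  by apply/H_val; rewrite Vq.
rewrite str_ofK => Ht; exists (maxn q.+1 t).
by rewrite /halted (H_mono (leq_maxr _ _) Ht) leq_max leqnn.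
Qed.

Lemma halted_all n : exists t, (n <= t)%N /\ forall q, (q < n)%N -> in_dom V q -> halted t q.
Proof.
elim: n => [|n [t [nt IH]]]; first by exists 0%N.
have [t' Ht'] : exists t', in_dom V n -> halted t' n.
  by case: (boolP (in_dom V n)) => [/dom_halted [t' ?]|_]; [exists t' | exists 0%N].
exists (maxn n.+1 (maxn t t')); split; first by rewrite leq_maxl.
move=> q; rewrite ltnS leq_eqVlt => /predU1P [->|qn] dq.
  by apply: halted_mono (Ht' dq); rewrite !leq_max leqnn !orbT.
by apply: halted_mono (IH q qn dq); rewrite !leq_max leqnn !orbT.
Qed.

Lemma lower_sumE t M : (t <= M)%N -> lower_sum t = \sum_(0 <= q < M) c t q.
Proof.
move=> tM; rewrite (big_cat_nat (leq0n t) tM) /= [X in _ = _ + X]big1_seq => [|q].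
  rewrite addr0 /lower_sum /lower_num natr_sum mulr_suml; apply: eq_bigr => q _.
  by rewrite /c /e natrM mulrA.
rewrite mem_index_iota => /andP[_ /andP[tq _]];
  by rewrite /c /halted ltnNge tq mul0r.
Qed.

Lemma c_mono t q : c t q <= c t.+1 q.
Proof.
rewrite /c; case Ht: (halted t q); last by rewrite mul0r mulr_ge0.
by rewrite (halted_mono (leqnSn t) Ht) !mul1r; exact: E_mono.
Qed.

Lemma lower_sum_mono : {homo lower_sum : t t' / (t <= t')%N >-> t <= t'}.
Proof.
apply: homo_leq => // [y x z|t]; first exact: le_trans.
rewrite (lower_sumE (leqnSn t)) (lower_sumE (leqnn t.+1)).
by apply: ler_sum => q _; exact: c_mono.
Qed.

Let c_le t q : c t q <= if in_dom V q then wt q else 0.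
Proof.
rewrite /c; case Ht: (halted t q).
  by rewrite (halted_dom Ht) mul1r ltW //; exact: E_lt.
by rewrite mul0r; case: ifP => // _; exact: ltW.
Qed.

Let sup_le M : \sum_(0 <= q < M) (if in_dom V q then wt q else 0) <= Z.
Proof.
have [SZ _] := partition_fun_sup V_prefix_free T_gt0 (ltW T_lt1).
by rewrite -big_mkcond; exact: SZ.
Qed.

Lemma lower_sum_lt q t : in_dom V q -> lower_sum t < Z.
Proof.
move=> dq; set M := maxn t q.+1.
rewrite (lower_sumE (leq_maxl t q.+1)); apply: lt_le_trans (sup_le M).
rewrite !big_mkord; have qM : (q < M)%N by rewrite leq_max leqnn orbT.
rewrite (bigD1 (Ordinal qM)) //= [ltRHS](bigD1 (Ordinal qM)) //=.
apply: ltr_leD; last by apply: ler_sum => i _; exact: c_le.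
rewrite dq /c; case: (halted t q); last by rewrite mul0r.
by rewrite mul1r; exact: E_lt.
Qed.

(** The whole weight of a program not yet counted is still missing. *)
Lemma lower_sum_missing q t : in_dom V q -> ~~ halted t q -> lower_sum t + wt q <= Z.
Proof.
move=> dq nh; set M := maxn t q.+1.
rewrite (lower_sumE (leq_maxl t q.+1)); apply: le_trans (sup_le M).
rewrite !big_mkord; have qM : (q < M)%N by rewrite leq_max leqnn orbT.
rewrite (bigD1 (Ordinal qM)) //= [leRHS](bigD1 (Ordinal qM)) //= dq.
have -> : c t q = 0 by rewrite /c (negbTE nh) mul0r.
rewrite add0r [leLHS]addrC lerD2l.
by apply: ler_sum => i _; exact: c_le.
Qed.

(** Take finitely many programs that carry all but [eps / 2] of the sum, wait until
    all of them have halted, and until their approximations are good enough. *)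
Lemma lower_sum_sup (eps : R) : 0 < eps -> exists t, Z - eps < lower_sum t.
Proof.
move=> e0; have [_ SZ] := partition_fun_sup V_prefix_free T_gt0 (ltW T_lt1).
have [|n Hn] := SZ (eps / 2); first by rewrite divr_gt0.
have [t0 [nt0 Ht0]] := halted_all n.
have [m Hm] := pow2_unbounded (12 * n%:R / eps).
pose t := maxn t0 m; exists t.
have nt : (n <= t)%N by rewrite leq_max nt0.
have small : n%:R * (6 * 2 ^- (K.+2 * t)) <= eps / 2.
  rewrite mulrA -/(_ / _) ler_pdivrMr //.
  rewrite ler_pdivrMr // in Hm.
  have : 2 ^+ m <= 2 ^+ (K.+2 * t) :> R.
    rewrite -!natrX ler_nat leq_exp2l // (@leq_trans t) ?leq_maxr //.
    by rewrite leq_pmull.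
  by move: Hm; nra.
rewrite (lower_sumE (leqnn t)) (big_cat_nat (leq0n n) nt) /=.
have H1 : 0 <= \sum_(n <= q < t) c t q by apply: sumr_ge0 => q _; rewrite mulr_ge0.
suff H2 : \sum_(0 <= q < n | in_dom V q) wt q - n%:R * (6 * 2 ^- (K.+2 * t)) <= \sum_(0 <= q < n) c t q.
  by move: Hn; lra.
rewrite lerBlDr big_mkcond -[n in n%:R](subn0 n) -sumr_const_nat mulr_suml -big_split /=.
apply: ler_sum_nat => q /andP[_ qn].
rewrite mul1r /c; case: (boolP (in_dom V q)) => dq; last first.
  by rewrite addr_ge0 ?mulr_ge0 ?invr_ge0 ?(ltW (p0 _)).
rewrite (halted_mono (leq_maxl _ _) (Ht0 q qn dq)) mul1r -lerBlDr; exact: E_ge.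
Qed.

Let delta t q : R := c t.+1 q - c t q.

Let delta_ge0 t q : 0 <= delta t q.
Proof. by rewrite subr_ge0 c_mono. Qed.

Let weight_pow q : (wt q) `^ T = 2 ^- slen q.
Proof.
rewrite /weight -powRrM -powR_invn //; congr (_ `^ _).
by field; rewrite gt_eqF.
Qed.

(** A program contributes its whole weight when it halts, and at most
    [6 * 2 ^- t] times its weight when its approximation is refined at stage [t]. *)
Lemma delta_pow t q : (delta t q) `^ T <=
  ((halted t.+1 q)%:R - (halted t q)%:R + 6 `^ T * rate T ^+ t) * (if in_dom V q then 2 ^- slen q else 0).
Proof.
have T0 : T != 0 by rewrite gt_eqF.
have rt : 0 <= 6 `^ T * rate T ^+ t by rewrite mulr_ge0 ?powR_ge0 // exprn_ge0 // powR_ge0.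
have dwt : delta t q <= if in_dom V q then wt q else 0.
  apply: le_trans (c_le t.+1 q); rewrite /delta gerBl.
  by rewrite mulr_ge0.
case Ht1: (halted t.+1 q); last first.
  have Ht : halted t q = false by apply/negP => /(halted_mono (leqnSn t)); rewrite Ht1.
  have -> : delta t q = 0 by rewrite /delta /c Ht1 Ht !mul0r subrr.
  rewrite powR0 // Ht subrr add0r mulr_ge0 //.
  by case: ifP => // _; rewrite invr_ge0 ltW.
rewrite (halted_dom Ht1) in dwt *; rewrite -weight_pow.
case Ht: (halted t q); last first.
  rewrite subr0 (le_trans (_ : _ <= wt q `^ T)) //.
    by rewrite ge0_ler_powR ?nnegrE ?delta_ge0 // ltW.
  by rewrite ler_peMl ?powR_ge0 // lerDl.
rewrite subrr add0r rateX -!powRM ?mulr_ge0 ?invr_ge0 ?(ltW (p0 _)) ?(ltW (wt_gt0 _)) //.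
rewrite ge0_ler_powR ?nnegrE ?delta_ge0 ?mulr_ge0 ?invr_ge0 ?(ltW (p0 _)) ?(ltW (wt_gt0 _)) ?(ltW T_gt0) //.
rewrite /delta /c Ht1 Ht !mul1r.
have H1 := E_lt (slen q) t.+1; have H2 := E_ge (slen q) t.
apply: le_trans (_ : 6 * 2 ^- (K.+2 * t) <= _); first by rewrite /e; lra.
rewrite -mulrA ler_pM2l // (_ : (K.+2 * t = t + K.+1 * t)%N); last by rewrite mulSn.
rewrite exprD invfM ler_pM2l ?invr_gt0 //.
apply: le_trans (K_big _); rewrite lef_pV2 ?posrE //.
rewrite -!natrX ler_nat leq_exp2l // leq_mul2l /=.
have /andP[qt _] := Ht.
by apply: leq_trans (ltnW qt); rewrite -[X in (_ <= X)%N]str_ofK -{1}(str_ofK q) slen_code size_le_code.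
Qed.

Let min1D (x y : R) : 0 <= x -> 0 <= y -> Num.min 1 (x + y) <= Num.min 1 x + Num.min 1 y.
Proof. by move=> x0 y0; rewrite !minEle; do !case: ifP => //; lra. Qed.

Let min1_sum M (F : nat -> R) (n : nat) : (forall q, 0 <= F q) ->
  Num.min 1 (2 ^+ n * \sum_(0 <= q < M) F q) <= \sum_(0 <= q < M) Num.min 1 (2 ^+ n * F q).
Proof.
move=> F0; elim: M => [|M IH]; first by rewrite !big_geq // mulr0 minEle ler10.
rewrite !big_nat_recr //= mulrDr; apply: le_trans (min1D _ _) _.
- by rewrite mulr_ge0 ?(ltW (p0 _)) // sumr_ge0.
- by rewrite mulr_ge0 ?(ltW (p0 _)).
by rewrite lerD2r.
Qed.

Lemma leading_real n t : (leading n t)%:R <= 2 ^+ n * lower_sum t < (leading n t)%:R + 1.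
Proof.
have := @divn_real R (2 ^ n * lower_num t)%N (2 ^ (K.+2 * t))%N.
rewrite expn_gt0 => /(_ isT); rewrite natrM !natrX -mulrA => -[H1 H2].
by apply/andP.
Qed.

(** Each change of the leading [n] bits is paid by the growth of the sum, up to
    the fractional part carried along. *)
Lemma leading_changes n M :
  \sum_(0 <= t < M) (leading n t.+1 != leading n t)%:R <=
  2 * \sum_(0 <= t < M) Num.min 1 (2 ^+ n * (lower_sum t.+1 - lower_sum t)) :> R.
Proof.
pose fr t := 2 ^+ n * lower_sum t - (leading n t)%:R.
have fr_b t : 0 <= fr t /\ fr t < 1.
  by have /andP[H1 H2] := leading_real n t; rewrite /fr; split; lra.
have fr0 : fr 0%N = 0.
  have l0 : lower_num 0 = 0%N by rewrite /lower_num big_geq.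
  by rewrite /fr /leading /lower_sum l0 !muln0 div0n mul0r mulr0 subrr.
suff Hs : \sum_(0 <= t < M) (leading n t.+1 != leading n t)%:R <=
    2 * \sum_(0 <= t < M) Num.min 1 (2 ^+ n * (lower_sum t.+1 - lower_sum t)) - fr M.
  by apply: le_trans Hs _; have [H1 _] := fr_b M; lra.
elim: M => [|M IH]; first by rewrite !big_geq // fr0 mulr0 subr0.
rewrite !big_nat_recr //=.
suff Hs : (leading n M.+1 != leading n M)%:R <=
    2 * Num.min 1 (2 ^+ n * (lower_sum M.+1 - lower_sum M)) - fr M.+1 + fr M.
  by move: IH Hs; lra.
have Hm : 2 ^+ n * lower_sum M <= 2 ^+ n * lower_sum M.+1.
  by rewrite ler_pM2l // lower_sum_mono.
rewrite mulrBr; have [f1 f2] := fr_b M; have [f3 f4] := fr_b M.+1.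
move: f1 f2 f3 f4; rewrite /fr.
move: (2 ^+ n * lower_sum M) (2 ^+ n * lower_sum M.+1) Hm => x y xy f1 f2 f3 f4.
case: eqP => [e0|/eqP ne] /=; first by rewrite e0 in f3 f4 *; rewrite minEle; case: ifP; lra.
have ge1 : (leading n M)%:R + 1 <= (leading n M.+1)%:R :> R.
  rewrite natr1 ler_nat ltn_neqAle eq_sym ne /= -ltnS -(ltr_nat R) -natr1; lra.
by rewrite minEle; case: ifP; lra.
Qed.

(** Summing over the levels first turns the increments into their [T]-th powers,
    whose sum over the stages is [O(2 ^ - l)] for a program of length [l]; the sum
    over the programs is then bounded by Kraft's inequality. *)
Lemma changes_weight : exists2 C : R, 0 <= C & forall M,
  \sum_(0 <= n < M) \sum_(0 <= t < M) (leading n t.+1 != leading n t)%:R * rate T ^+ n <= C.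
Proof.
have [C C0 HC] := level_sum T_gt0 T_lt1.
have r0 := rate_gt0 T; have r1 := rate_lt1 T_gt0.
pose D := 1 + 6 `^ T * (1 - rate T)^-1.
have D0 : 0 <= D by rewrite addr_ge0 // mulr_ge0 ?powR_ge0 // invr_ge0 subr_ge0 ltW.
exists (2 * (C * D)); first by rewrite !mulr_ge0.
move=> M.
apply: le_trans (_ : 2 * \sum_(0 <= n < M) \sum_(0 <= t < M) \sum_(0 <= q < M.+1)
    rate T ^+ n * Num.min 1 (2 ^+ n * delta t q) <= _).
  rewrite mulr_sumr; apply: ler_sum => n _.
  rewrite -mulr_suml mulrC.
  apply: le_trans (ler_wpM2l (exprn_ge0 _ (ltW r0)) (leading_changes n M)) _.
  rewrite mulrCA ler_pM2l // mulr_sumr; apply: ler_sum_nat => t /andP[_ tM].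
  rewrite -mulr_sumr ler_wpM2l ?exprn_ge0 ?(ltW r0) //.
  rewrite (lower_sumE (leqW (ltnW tM))) (@lower_sumE t.+1 M.+1) ?(leqW tM) //.
  by rewrite -sumrB; exact: (min1_sum _ _ (delta_ge0 t)).
rewrite ler_pM2l //.
rewrite (eq_bigr (fun n => \sum_(0 <= q < M.+1) \sum_(0 <= t < M)
    rate T ^+ n * Num.min 1 (2 ^+ n * delta t q))) => [|n _]; last by rewrite exchange_big.
rewrite exchange_big /=.
apply: le_trans (_ : \sum_(0 <= q < M.+1) (C * D) * (if in_dom V q then 2 ^- slen q else 0) <= _); last first.
  rewrite -mulr_sumr ler_piMr ?mulr_ge0 // -big_mkcond; exact: kraft_nat.
apply: ler_sum => q _; rewrite exchange_big /=.
set k := (if in_dom V q then _ else _).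
have k0 : 0 <= k by rewrite /k; case: ifP => // _; rewrite invr_ge0 ltW.
apply: le_trans (_ : C * \sum_(0 <= t < M) (delta t q) `^ T <= _).
  rewrite mulr_sumr; apply: ler_sum => t _; exact: HC.
rewrite -mulrA ler_wpM2l //.
apply: le_trans (ler_sum _ (fun t _ => delta_pow t q)) _.
rewrite -/k -mulr_suml ler_wpM2r // big_split /= telescope_sumr // -mulr_sumr.
apply: lerD; last by rewrite ler_wpM2l ?powR_ge0 //; exact: geometric_sum_le.
by rewrite [halted 0 q]/halted ltn0 subr0; case: (halted M q); rewrite ?ler01.
Qed.

End LowerSums.

(** * Machines built by search *)

Section SearchMachines.

Lemma search_machine (P out : nat -> nat -> nat) : comp2 P -> comp2 out ->
  exists F, [/\ partial_recursive F,
    forall p, (exists r, P (str_code p) r = 0%N) -> exists r,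
      [/\ P (str_code p) r = 0%N, forall k, (k < r)%N -> P (str_code p) k <> 0%N &
          F p = Some (str_of (out (str_code p) r))] &
    forall p, domain F p -> exists r, P (str_code p) r = 0%N].
Proof.
move=> HP Hout; have [c Hc] := search_code HP Hout.
pose F p := if pselect (exists r, P (str_code p) r == 0%N) is left ex
            then Some (str_of (out (str_code p) (ex_minn ex))) else None.
have FP p : (exists r, P (str_code p) r = 0%N) -> exists r,
    [/\ P (str_code p) r = 0%N, forall k, (k < r)%N -> P (str_code p) k <> 0%N &
        F p = Some (str_of (out (str_code p) r))].
  case=> r0 /eqP Hr0; rewrite /F; case: pselect => [ex|[]]; last by exists r0.
  case: ex_minnP => r /eqP Pr rmin; exists r; split=> // k kr /eqP /rmin.
  by rewrite leqNgt kr.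
exists F; split=> //.
  exists c => x y; rewrite Hc; split=> [[r [Pr rmin ->]]|].
    have [|r' [Pr' rmin' ->]] := FP x; first by exists r.
    rewrite /= str_ofK; congr (Some (out _ _)).
    by have [/rmin|/rmin'|] := ltngtP r' r.
  rewrite /F; case: pselect => //= ex; case: ex_minnP => r /eqP Pr rmin [<-].
  exists r; rewrite str_ofK; split=> // k kr /eqP /rmin.
  by rewrite leqNgt kr.
by move=> p; rewrite /domain /F /=; case: pselect => // -[r /eqP Hr] _; exists r.
Qed.

End SearchMachines.

Section Requests.
Variable R : realType.

(** The left end of the interval of the reals whose expansion starts with [x]. *)
Definition dyadic_left (x : str) : R := (sval (str_code x))%:R / 2 ^+ size x.

Lemma prefix_interval x y : prefix x y ->
  dyadic_left x <= dyadic_left y /\ dyadic_left y < dyadic_left x + 2 ^- size x.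
Proof.
move=> /prefixP [z ->]; rewrite /dyadic_left sval_cat size_cat exprD.
have p0 k : 0 < 2 ^+ k :> R by rewrite exprn_gt0.
have z0 : 0 <= (sval (str_code z))%:R / 2 ^+ size z :> R by rewrite divr_ge0 // ltW.
have z1 : (sval (str_code z))%:R / 2 ^+ size z < 1 :> R.
  by rewrite ltr_pdivrMr // mul1r -natrX ltr_nat sval_lt.
have -> : (sval (str_code x) * 2 ^ size z + sval (str_code z))%N%:R / (2 ^+ size x * 2 ^+ size z) =
    (sval (str_code x))%:R / 2 ^+ size x + (sval (str_code z))%:R / 2 ^+ size z * 2 ^- size x :> R.
  by rewrite natrD natrM natrX; field; rewrite !gt_eqF.
have x0 : 0 < 2 ^- size x :> R by rewrite invr_gt0.
by split; nra.
Qed.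

(** The request of index [r] gets the first dyadic interval of length
    [2 ^- (l r).+1] that fits after the lengths [2 ^- l i] reserved for the
    earlier requests; reserving twice the needed length guarantees that it fits. *)
Lemma request_machine (req : nat -> bool) (l out : nat -> nat) (c : nat) :
  comp (fun r => nat_of_bool (req r)) -> comp l -> comp out ->
  (forall r, (l r <= r + c)%N) ->
  (forall M, \sum_(0 <= r < M) (req r)%:R * 2 ^- l r <= 1 :> R) ->
  exists2 F, prefix_free_machine F & forall r, req r ->
    exists2 p, size p = (l r).+1 & F p = Some (str_of (out r)).
Proof.
move=> Hreq Hl Hout l_le sum1.
have p0 k : 0 < 2 ^+ k :> R by rewrite exprn_gt0.
pose num r := (\sum_(0 <= i < r) req i * 2 ^ (r + c - l i))%N.
pose cw r := ((num r * 2 ^ (l r).+1 + (2 ^ (r + c)).-1) %/ 2 ^ (r + c))%N.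
pose s r : R := \sum_(0 <= i < r) (req i)%:R * 2 ^- l i.
have numE r : (num r)%:R = s r * 2 ^+ (r + c).
  rewrite /num /s natr_sum mulr_suml; apply: eq_big_nat => i /andP[_ ir].
  have li : (l i <= r + c)%N by apply: leq_trans (l_le i) _; rewrite leq_add2r ltnW.
  rewrite natrM natrX -mulrA; congr (_ * _).
  by rewrite -[in RHS](subnKC li) exprD mulKf ?gt_eqF.
have cw_ge r : s r * 2 ^+ (l r).+1 <= (cw r)%:R.
  have H : (num r * 2 ^ (l r).+1 <= cw r * 2 ^ (r + c))%N.
    have d0 : (0 < 2 ^ (r + c))%N by rewrite expn_gt0.
    have := ltn_ceil (num r * 2 ^ (l r).+1 + (2 ^ (r + c)).-1) d0.
    rewrite -/(cw r); lia.
  rewrite -(ler_nat R) !natrM !natrX numE mulrAC in H.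
  by rewrite -(ler_pM2r (p0 (r + c)%N)).
have cw_lt r : (cw r)%:R < s r * 2 ^+ (l r).+1 + 1.
  have d0 : (0 < 2 ^ (r + c))%N by rewrite expn_gt0.
  have H : (cw r * 2 ^ (r + c) < num r * 2 ^ (l r).+1 + 2 ^ (r + c))%N.
    have := leq_divM (num r * 2 ^ (l r).+1 + (2 ^ (r + c)).-1) (2 ^ (r + c)).
    rewrite -/(cw r); lia.
  rewrite -(ltr_nat R) natrD !natrM !natrX numE mulrAC in H.
  by rewrite -(ltr_pM2r (p0 (r + c)%N)) mulrDl mul1r.
have sS r : req r -> s r.+1 = s r + 2 ^- l r.
  by move=> rr; rewrite /s big_nat_recr //= rr mul1r.
have s_mono : {homo s : m n / (m <= n)%N >-> m <= n}.
  apply: homo_leq => // [y x z|n]; first exact: le_trans.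
  by rewrite /s big_nat_recr //= lerDl mulr_ge0 // invr_ge0 ltW.
pose ok x r := [&& req r, slen x == (l r).+1 & sval x == cw r].
have Hslen : comp slen := comp_slen comp_id.
have Hsval : comp sval := comp_sval comp_id.
have Hnum : comp num.
  apply: comp_sum_nat; first by comp_step.
  apply: compM; first exact: (comp_comp Hreq comp_pr).
  by apply: compX; first exact: comp_const; apply: compB; repeat (comp_step || apply: compD).
have Hcw : comp cw.
  apply: comp_div; last by apply: compX; repeat (comp_step || apply: compD).
  apply: compD; first by apply: compM => //; apply: compX; repeat comp_step.
  by apply: comp_pred; apply: compX; repeat (comp_step || apply: compD).
have Hok : comp2 (fun x r => ~~ ok x r).
  apply: comp_neg; apply: comp_and; first exact: (comp_comp Hreq comp_pr).
  by apply: comp_and; apply: comp_eq; do !comp_step.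
have [F [Frec FP Fdom]] := search_machine Hok (comp_comp Hout comp_pr : comp2 (fun _ r => out r)).
have okP p r : ok (str_code p) r -> [/\ req r, size p = (l r).+1,
    s r <= dyadic_left p & dyadic_left p + 2 ^- size p <= s r + 2 ^- l r].
  case/and3P=> rr /eqP; rewrite slen_code => sp /eqP vp; split=> //.
    by rewrite /dyadic_left vp sp ler_pdivlMr.
  have := cw_lt r; rewrite /dyadic_left vp sp => H.
  rewrite -[X in _ + X]mul1r -mulrDl ler_pdivrMr // mulrDl [2 ^- _ * _](_ : _ = 2); first by lra.
  by rewrite exprS; field; rewrite gt_eqF.
have ok_prefix p q r r' : ok (str_code p) r -> ok (str_code q) r' -> prefix p q -> r = r'.
  move=> /okP [rr sp lp up] /okP [rr' sq lq uq] /prefix_interval [H1 H2].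
  have q0 : 0 < 2 ^- size q :> R by rewrite invr_gt0.
  have [rr'_lt|rr'_gt|//] := ltngtP r r'.
    have := s_mono _ _ rr'_lt; rewrite sS // => H3.
    suff : dyadic_left p < dyadic_left p by rewrite ltxx.
    by lra.
  have := s_mono _ _ rr'_gt; rewrite sS // => H3.
  suff : dyadic_left p < dyadic_left p by rewrite ltxx.
  by lra.
exists F.
  split=> // p q dp dq pq.
  have [r /eqP] := Fdom p dp; rewrite eqb0 negbK => okp.
  have [r' /eqP] := Fdom q dq; rewrite eqb0 negbK => okq.
  have E := ok_prefix _ _ _ _ okp okq pq; rewrite -E in okq.
  have [_ sp _ _] := okP _ _ okp; have [_ sq _ _] := okP _ _ okq.
  move: pq => /prefixP [z Ez]; move: sq; rewrite Ez size_cat sp => /eqP.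
  by rewrite -[X in _ == X]addn0 eqn_add2l => /nilP ->; rewrite cats0.
move=> r rr.
have cw2 : (cw r < 2 ^ (l r).+1)%N.
  rewrite -(ltr_nat R) natrX; apply: lt_le_trans (cw_lt r) _.
  have := sum1 r.+1; rewrite -/(s r.+1) sS // -(ler_pM2r (p0 (l r).+1)) mul1r mulrDl.
  rewrite [2 ^- _ * _](_ : _ = 2); first by lra.
  by rewrite exprS; field; rewrite gt_eqF.
have [p sp vp] := sval_onto cw2; exists p => //.
have okp : ok (str_code p) r by rewrite /ok rr slen_code sp vp !eqxx.
have [|r' [/eqP]] := FP p; first by exists r; rewrite okp.
rewrite eqb0 negbK => okp' _ ->.
by rewrite (ok_prefix _ _ _ _ okp okp' (prefix_refl p)).
Qed.

End Requests.

(** * Reading the oracle's answers *)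

Section Answers.
Local Open Scope nat_scope.

Lemma bits_sum_div (b : nat -> bool) n j : j < n ->
  odd ((\sum_(0 <= i < n) b i * 2 ^ i) %/ 2 ^ j) = b j.
Proof.
have small m : \sum_(0 <= i < m) b i * 2 ^ i < 2 ^ m.
  elim: m => [|m IH]; first by rewrite big_geq.
  by rewrite big_nat_recr //= expnS; case: (b m); lia.
elim: n => // n IH; rewrite ltnS leq_eqVlt => /predU1P [->|jn].
  rewrite big_nat_recr //= addnC divnMDl ?expn_gt0 // divn_small //.
  by rewrite addn0; case: (b n).
rewrite big_nat_recr //= -(subnKC (ltnW jn)) expnD mulnCA mulnC divnDMl ?expn_gt0 //.
by rewrite oddD subnKC ?(ltnW jn) // IH // oddM oddX subn_eq0 leqNgt jn /= andbF addbF.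
Qed.

Lemma answers_bit (B : set str) n j : j < n ->
  odd (answers B n %/ 2 ^ j) = (str_of j \in B).
Proof. exact: (bits_sum_div (fun i => str_of i \in B)). Qed.

(** The number of strings of length at most [m]. *)
Definition ball m := (2 ^ m.+1).-1.

Lemma str_of_ball m i : i < ball m -> size (str_of i) <= m.
Proof. by rewrite -str_code_lt str_ofK. Qed.

Lemma comp_ball f : comp f -> comp (fun x => ball (f x)).
Proof. by move=> Hf; apply: comp_pred; apply: compX; do !comp_step. Qed.

(** The strings of length [m] have the codes [(2 ^ m + w).-1] for [w < 2 ^ m], and
    the oracle accepts exactly one of them. *)
Lemma Pf_answers (R : realType) (a : R) m u : (0 <= a)%R ->
  (u%:R <= 2 ^+ m * a < u%:R + 1)%R ->
  \sum_(0 <= w < 2 ^ m) w * odd (answers (Pf a) (ball m) %/ 2 ^ (2 ^ m + w).-1) = u %% 2 ^ m.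
Proof.
move=> a0 Hu; have um : u %% 2 ^ m < 2 ^ m by rewrite ltn_mod expn_gt0.
have bitE w : w < 2 ^ m ->
    odd (answers (Pf a) (ball m) %/ 2 ^ (2 ^ m + w).-1) = (w == u %% 2 ^ m).
  move=> /sval_onto [x xm xw].
  have xE : (2 ^ m + w).-1 = str_code x by rewrite -xw -xm -str_code_val.
  rewrite xE answers_bit; last by rewrite str_code_lt xm.
  by rewrite str_codeK (@Pf_sval _ a x u) ?xm // xw.
rewrite (eq_big_nat _ _ (F2 := fun w => if w == u %% 2 ^ m then w else 0)); last first.
  by move=> w /andP[_ wm]; rewrite bitE //; case: eqP; rewrite ?muln1 ?muln0.
by rewrite big_mkord -big_mkcond (big_pred1 (Ordinal um)) //.
Qed.

End Answers.

Section HaltingTimes.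

Lemma machine_stage_dom (F : str -> option str) (H : nat -> nat -> nat) :
  (forall p y, (exists t, H t (str_code p) = y.+1) <-> omap str_code (F p) = Some y) ->
  forall p, domain F p <-> exists t, (0 < H t (str_code p))%N.
Proof.
move=> HF p; rewrite /domain /=; split=> [|[t]].
  case E: (F p) => [w|//] _.
  have [t Ht] : exists t, H t (str_code p) = (str_code w).+1 by apply/HF; rewrite E.
  by exists t; rewrite Ht.
case E: (H t _) => [//|y] _.
by have /HF : exists t, H t (str_code p) = y.+1 by [exists t]; case: (F p).
Qed.

(** Applied to this machine, optimality compresses halting times: a short program
    yields a bound on the time [W] takes. *)
Lemma halting_time_machine (W : str -> option str) (H : nat -> nat -> nat) :
  prefix_free (domain W) -> comp2 H ->
  (forall p, domain W p <-> exists t, (0 < H t (str_code p))%N) ->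
  exists2 F, prefix_free_machine F & forall p, domain W p ->
    exists2 t, (0 < H t (str_code p))%N & F p = Some (str_of t).
Proof.
move=> pf HH HW.
have HP : comp2 (fun x r => H r x == 0%N).
  by apply: comp_eq; [apply: (comp2E HH) | ]; do !comp_step.
have [F [Frec FP Fdom]] := search_machine HP (comp_pr : comp2 (fun _ r => r)).
have key p r : (H r (str_code p) == 0%N) = 0%N :> nat -> (0 < H r (str_code p))%N.
  by case: (H r _).
exists F.
  split=> // p q dp dq; apply: pf.
    by apply/HW; have [r /key] := Fdom p dp; exists r.
  by apply/HW; have [r /key] := Fdom q dq; exists r.
move=> p /HW [t Ht]; have [|r [/key Hr _ ->]] := FP p; last by exists r.
by exists t; case: (H t _) Ht.
Qed.

End HaltingTimes.

(** * The two reductions *)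

Section Reductions.
Variables (R : realType) (T : R) (V W : str -> option str).
Hypotheses (T_computable : computable_real T) (T_gt0 : 0 < T) (T_lt1 : T < 1).
Hypotheses (V_optimal : optimal V) (W_optimal : optimal W).

Notation Z := (partition_fun V T).

Let p0 k : 0 < 2 ^+ k :> R. Proof. by rewrite exprn_gt0. Qed.

Let Z_ge0 : 0 <= Z.
Proof. by rewrite /partition_fun fine_ge0 // esum_ge0 // => p _; rewrite lee_fin powR_ge0. Qed.

Let comp_halted (HV : nat -> nat -> nat) : comp2 HV -> comp2 (fun t q => halted HV t q).
Proof. by move=> HH; apply: comp_and; apply: comp_ltn; do !comp_step. Qed.

Let comp_lower_num (HV E : nat -> nat -> nat) : comp2 HV -> comp2 E -> comp (lower_num HV E).
Proof.
move=> HH HE; have Hh := comp_halted HH.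
apply: comp_sum_nat; first by comp_step.
by apply: compM; [apply: (comp2E Hh) | apply: (comp2E HE)]; repeat (comp_step || apply: comp_slen).
Qed.

(** The integer part of [Z] is a constant [z0] of the algorithm; [v a m] reads the
    first [m] bits of [Z] off the answers [a], and [S t], the sum of the
    successors of the outputs of the programs counted at stage [t], exceeds each of
    these outputs and serves as time bound for [W]. *)
Lemma domain_reducible_Pf : exists c : R, forall f, comp f ->
  (forall n, n%:R / T + c <= (f n)%:R) -> reducible_in_query_size f (domain W) (Pf Z).
Proof.
have [[V_rec V_pf] V_opt] := V_optimal; have [[W_rec W_pf] _] := W_optimal.
have [HV [HV1 HV2 HV3]] := machine_stages V_rec.
have [HW [HW1 HW2 HW3]] := machine_stages W_rec.
have [K [E [E1 E2 E3 E4 E5]]] := weight_approx T_gt0 T_computable.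
have domW := machine_stage_dom HW2.
have [F F_pf FP] := halting_time_machine W_pf HW1 domW.
have [d Hd] := V_opt F F_pf.
(* The additional 1 yields the factor 2 by which the weight of a program of
   length [n + d] reaches the uncertainty [2 * 2 ^ - m]. *)
exists (d%:R / T + 1) => f Hf f_ge.
pose z0 := Num.truncn Z.
pose A := lower_num HV E.
have HA : comp A by exact: comp_lower_num.
have Hh := comp_halted HV1.
pose v a m := (\sum_(0 <= w < 2 ^ m) w * odd (a %/ 2 ^ (2 ^ m + w).-1))%N.
pose S t := (\sum_(0 <= q < t) halted HV t q * HV t q)%N.
pose D t a X := let m := f (slen X) in
  if (2 ^ (K.+2 * t) * (z0 * 2 ^ m + v a m) <= 2 ^ m * A t + 2 ^ (K.+2 * t))%N
  then (0 < HW (S t) X)%N.+1 else 0%N.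
have Hv : comp2 v.
  apply: comp_sum_nat; first by apply: compX; do !comp_step.
  apply: compM; first by do !comp_step.
  apply: comp_odd; apply: comp_div; first by do !comp_step.
  by apply: compX; [| apply: comp_pred; apply: compD; [apply: compX |]]; do !comp_step.
have HS : comp S.
  apply: comp_sum_nat; first by comp_step.
  by apply: compM; [apply: (comp2E Hh) | apply: (comp2E HV1)]; do !comp_step.
have HD : comp3 D.
  have Hm : comp (fun z => f (slen (pr (pr z)))).
    by apply: (comp_comp Hf); apply: comp_slen; do !comp_step.
  have Hk : comp (fun z => 2 ^ (K.+2 * pl z))%N.
    by apply: compX; [| apply: compM]; do !comp_step.
  have H2m : comp (fun z => 2 ^ f (slen (pr (pr z))))%N by apply: compX => //; comp_step.
  apply: comp_if; last exact: comp_const.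
    apply: comp_leq; last first.
      by apply: compD => //; apply: compM => //; apply: (comp_comp HA); do !comp_step.
    apply: compM => //; apply: compD; first by apply: compM => //; comp_step.
    by apply: (comp2E Hv) => //; do !comp_step.
  apply: comp_succE; apply: comp_ltn; first exact: comp_const.
  by apply: (comp2E HW1); [apply: (comp_comp HS)|]; do !comp_step.
apply: (@reducible_by_stages (fun X => ball (f (slen X))) D) => //.
- by apply: comp_ball; apply: (comp_comp Hf); apply: comp_slen; comp_step.
- by move=> x i; rewrite slen_code; exact: str_of_ball.
move=> x D'; rewrite /D' /D slen_code {D'}.
set m := f (size x); set n := size x in m *.
pose u := Num.truncn (2 ^+ m * Z).
have Zm0 : 0 <= 2 ^+ m * Z by rewrite mulr_ge0 // ltW.
have /andP[u1 u2] : u%:R <= 2 ^+ m * Z < u%:R + 1 by rewrite natr1; exact: truncn_itv.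
have /andP[z1 z2] : z0%:R <= Z < z0%:R + 1 by rewrite natr1; exact: truncn_itv.
rewrite /v (@Pf_answers _ Z m u) ?u1 //.
have uE : (z0 * 2 ^ m + u %% 2 ^ m = u)%N.
  have H1 : (z0 * 2 ^ m < u.+1)%N.
    rewrite -(ltr_nat R) natrM natrX -[u.+1%:R]natr1; apply: le_lt_trans u2.
    by rewrite mulrC ler_pM2l.
  have H2 : (u < z0.+1 * 2 ^ m)%N.
    rewrite -(ltr_nat R) natrM natrX -[z0.+1%:R]natr1; apply: le_lt_trans u1 _.
    by rewrite mulrC ltr_pM2r.
  have E0 : u = (z0 * 2 ^ m + (u - z0 * 2 ^ m))%N by rewrite subnKC.
  by rewrite {1}E0 modnMDl modn_small // ltn_subLR // -mulSnr.
rewrite uE.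
have testE t : (2 ^ (K.+2 * t) * u <= 2 ^ m * A t + 2 ^ (K.+2 * t))%N =
    (u%:R - 1 <= 2 ^+ m * lower_sum R HV K E t).
  rewrite -(ler_nat R) natrD !natrM !natrX lerBlDr -[RHS](ler_pM2l (p0 (K.+2 * t)%N)).
  congr (_ <= _); rewrite mulrDr mulr1 /lower_sum -/(A t); congr (_ + _).
  by field; rewrite gt_eqF.
split.
  have [|t Ht] := lower_sum_sup T_gt0 T_lt1 V_pf HV2 HV3 E3 (eps := 2 ^- m).
    by rewrite invr_gt0.
  exists t; rewrite testE ifT //.
  move: Ht; rewrite -(ltr_pM2l (p0 m)) mulrBr divff ?gt_eqF // => Ht.
  by move: u1 Ht; lra.
move=> t; rewrite testE; case: ifP => // test _; congr _.+1.
congr nat_of_bool; apply/idP/idP => [Hx|].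
  by rewrite inE; apply/domW; exists (S t).
rewrite inE => Wx; have [t0 Ht0 Fx] := FP x Wx.
have [|q [Vq VqF sq]] := Hd x; first by rewrite /domain /= Fx.
rewrite Fx in VqF.
have iq : in_dom V (str_code q) by rewrite /in_dom str_codeK.
(* A program still missing would be heavier than the gap left by the test. *)
have hq : halted HV t (str_code q).
  apply/negP => /negP nh.
  have := lower_sum_missing T_gt0 T_lt1 V_pf HV2 E2 iq nh; rewrite slen_code => Hm.
  have wq : 2 * 2 ^- m <= weight T (size q).
    rewrite -{1}[2](@powRr1 R 2) // -powR_invn // -powRD ?pnatr_eq0 ?implybT //.
    rewrite ler_powR ?ler1n //.
    have : (size q)%:R / T <= n%:R / T + d%:R / T.
      by rewrite -mulrDl ler_pM2r ?invr_gt0 // -natrD ler_nat.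
    have := f_ge n; rewrite -/m; lra.
  suff : 2 ^+ m * Z < 2 ^+ m * Z by rewrite ltxx.
  have : 2 ^+ m * (lower_sum R HV K E t + 2 * 2 ^- m) <= 2 ^+ m * Z.
    by rewrite ler_pM2l //; apply: le_trans Hm; rewrite lerD2l.
  rewrite mulrDr [2 ^+ m * (2 * _)](_ : _ = 2); last by field; rewrite gt_eqF.
  by move: test u2; lra.
have /andP[qt] := hq; case Ey: (HV t (str_code q)) => [//|y] _.
have yE : y = t0.
  have /HV2 : exists t, HV t (str_code q) = y.+1 by exists t.
  by rewrite VqF /= str_ofK => -[].
have St : (t0 <= S t)%N.
  rewrite /S big_mkord (bigD1 (Ordinal qt)) //= hq Ey yE mul1n.
  by apply: leq_trans (leqnSn t0) _; rewrite leq_addr.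
by case Ez: (HW t0 _) Ht0 => [//|z] _; rewrite (HW3 _ _ _ _ St Ez).
Qed.

(** Pairing is injective, and both components of a code are at most the code. *)
Lemma sum_pairs_le (G : nat -> nat -> R) M : (forall n t, 0 <= G n t) ->
  \sum_(0 <= r < M) G (pl r) (pr r) <= \sum_(0 <= n < M) \sum_(0 <= t < M) G n t.
Proof.
move=> G0; rewrite !big_mkord.
under [leRHS]eq_bigr do rewrite big_mkord.
rewrite pair_big /=.
case: M => [|M]; first by rewrite !big_ord0 sumr_ge0.
pose h (r : 'I_M.+1) : 'I_M.+1 * 'I_M.+1 := (inord (pl r), inord (pr r)).
have lt_r (r : 'I_M.+1) : (pl r < M.+1)%N /\ (pr r < M.+1)%N.
  have := cpair_ge1 (pl r) (pr r); have := cpair_ge2 (pl r) (pr r).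
  by rewrite cpairK; have := ltn_ord r; split; lia.
have h_inj : injective h.
  move=> r r' [] /(congr1 val) /=; rewrite !inordK ?(lt_r _).1 // => e1.
  move=> /(congr1 val) /=; rewrite !inordK ?(lt_r _).2 // => e2.
  by apply: val_inj; rewrite /= -(cpairK r) -(cpairK r') e1 e2.
rewrite (partition_big h xpredT) //=; apply: ler_sum => -[n t] _.
have [[r hr]|no] := pselect (exists r, h r = (n, t)).
  rewrite (big_pred1 r) => [|r']; last by rewrite -hr (inj_eq h_inj).
  move: hr => [<- <-]; rewrite !inordK ?(lt_r _).1 ?(lt_r _).2 //.
by rewrite big1 // => r /eqP hr; case: no; exists r.
Qed.

Let is_integer n : bool := `[< exists a : nat, 2 ^+ n * Z = a%:R >].

(** Computability is not uniform here: if [2 ^ n * Z] is ever an integer, it is so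
    from some least [n] on, and this [n] is a constant of the algorithm. *)
Let comp_is_integer : comp (fun n => nat_of_bool (is_integer n)).
Proof.
have [[j Hj]|no] := pselect (exists j, is_integer j); last first.
  apply: comp_ext comp_zero => n; case E: (is_integer n) => //.
  by case: no; exists n.
have [k Hk kmin] := ex_minnP (ex_intro (fun j => is_integer j) j Hj).
apply: (@comp_ext (fun n => nat_of_bool (k <= n)%N)).
  move=> n; congr nat_of_bool; apply/idP/idP => [kn|]; last exact: kmin.
  move: Hk => /asboolP [a Ha]; apply/asboolP; exists (2 ^ (n - k) * a)%N.
  by rewrite natrM natrX -Ha mulrA -exprD subnK.
by apply: comp_leq; [exact: comp_const | comp_step].
Qed.

(** Some machine has a nonempty domain. *)
Lemma optimal_nonempty (U : str -> option str) : optimal U -> exists q, domain U q.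
Proof.
case=> _ U_opt.
have HP : comp2 (fun x _ => x) by exact: comp_pl.
have [F [Frec FP Fdom]] := search_machine HP HP.
have F_pf : prefix_free_machine F.
  split=> // p q dp dq _; apply: str_code_inj.
  by have [_ ->] := Fdom p dp; have [_ ->] := Fdom q dq.
have [d Hd] := U_opt F F_pf.
have [|r [_ _ FE]] := FP [::]; first by exists 0%N.
by have [|q [dq _ _]] := Hd [::]; [rewrite /domain /= FE | exists q].
Qed.

(** At a stage [t] at which all the relevant programs of [W] have halted, the sum
    [S t a N] of the successors of their outputs exceeds every stage at which the
    first [n] bits change.  All lower bounds being strict, those bits are the greatest integer
    below [2 ^ n * Z], from which the rounded value differs by 1 exactly when
    [2 ^ n * Z] is an integer. *)
Lemma Pf_reducible_domain : exists c : R, forall g, comp g ->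
  (forall n, n%:R * T + c <= (g n)%:R) -> reducible_in_query_size g (Pf Z) (domain W).
Proof.
have [[V_rec V_pf] V_opt] := V_optimal; have [[W_rec W_pf] W_opt] := W_optimal.
have [HV [HV1 HV2 HV3]] := machine_stages V_rec.
have [HW [HW1 HW2 HW3]] := machine_stages W_rec.
have [K [E [E1 E2 E3 E4 E5]]] := weight_approx T_gt0 T_computable.
have domW := machine_stage_dom HW2.
have [C C0 HC] := changes_weight T_gt0 T_lt1 V_pf HV2 HV3 E2 E3 E4 E5.
have [B HB] := dyadic_T T_gt0 T_computable.
have [phi [Hphi _ phiP]] := linear_order_function T_gt0 HB.
(* The factor 4 compensates for the error 2 in [phi]. *)
have [c0 Hc0] := pow2_unbounded (4 * C).
pose A := lower_num HV E.
have HA : comp A by exact: comp_lower_num.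
pose lead := leading HV K E.
have Hlead : comp2 lead.
  apply: comp_div; last by apply: compX; [|apply: compM]; do !comp_step.
  by apply: compM; [apply: compX|]; do !comp_step.
pose req r := lead (pl r) (pr r).+1 != lead (pl r) (pr r).
have Hreq : comp (fun r => nat_of_bool (req r)).
  by apply: comp_neg; apply: comp_eq; do !comp_step.
pose len n := (phi n + c0)%N.
have Hlen : comp len by apply: compD; do !comp_step.
have len_le r : (len (pl r) <= r + (c0 + 2))%N.
  have := phiP (pl r); rewrite ler_norml => /andP[_ H].
  have plr : (pl r <= r)%N by have := cpair_ge1 (pl r) (pr r); rewrite cpairK.
  have H2 : (phi (pl r))%:R <= (r + 2)%N%:R :> R.
    rewrite natrD; have : (pl r)%:R <= r%:R :> R by rewrite ler_nat.
    have : T * (pl r)%:R <= (pl r)%:R by rewrite ler_piMl // ltW.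
    by move: H; lra.
  by rewrite ler_nat in H2; rewrite /len; lia.
have weight_len n : 2 ^- len n <= 4 * 2 ^- c0 * rate T ^+ n.
  rewrite /len exprD invfM mulrAC ler_pM2r ?invr_gt0 //.
  have := phiP n; rewrite ler_norml => /andP[H _].
  rewrite (_ : 4 * rate T ^+ n = 2 `^ (2 - T * n%:R)); last first.
    rewrite powRD ?pnatr_eq0 ?implybT //; congr (_ * _).
      by rewrite powR_mulrn // expr2; lra.
    by rewrite /rate -powR_mulrn ?powR_ge0 // -powRrM mulNr.
  by rewrite -powR_invn // ler_powR ?ler1n //; lra.
have sum1 M : \sum_(0 <= r < M) (req r)%:R * 2 ^- len (pl r) <= 1 :> R.
  apply: le_trans (@sum_pairs_le (fun n t => (lead n t.+1 != lead n t)%:R * 2 ^- len n) M _) _.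
    by move=> n t; rewrite mulr_ge0 // invr_ge0 ltW.
  apply: le_trans (_ : \sum_(0 <= n < M) \sum_(0 <= t < M)
      (4 * 2 ^- c0) * ((lead n t.+1 != lead n t)%:R * rate T ^+ n) <= _).
    apply: ler_sum => n _; apply: ler_sum => t _.
    by rewrite mulrCA ler_wpM2l.
  under eq_bigr do rewrite -mulr_sumr.
  rewrite -mulr_sumr.
  apply: le_trans (ler_wpM2l _ (HC M)) _; first by rewrite mulr_ge0 // invr_ge0 ltW.
  by rewrite mulrAC ler_pdivrMr // mul1r.
have [F F_pf FP] := request_machine Hreq (comp_comp Hlen comp_pl) (comp_comp comp_succ comp_pr)
  len_le sum1.
have [d Hd] := W_opt F F_pf.
(* The error 2 of [phi], and the extra bit of the allocated programs. *)
exists ((c0 + d + 3)%N%:R) => g Hg g_ge.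
have g_len n : ((len n).+1 + d <= g n)%N.
  rewrite -(ler_nat R); apply: le_trans (g_ge n); rewrite /len.
  have := phiP n; rewrite ler_norml => /andP[_ H].
  by rewrite (_ : (phi n + c0).+1 + d = phi n + (c0 + d + 1))%N ?natrD; [lra|lia].
pose S t a N := (\sum_(0 <= i < N) odd (a %/ 2 ^ i) * HW t i)%N.
pose pending t a N := (\sum_(0 <= i < N) odd (a %/ 2 ^ i) * (HW t i == 0))%N.
pose D t a X := let N := ball (g (slen X)) in
  if pending t a N == 0%N
  then ((sval X == (lead (slen X) (S t a N) + is_integer (slen X)) %% 2 ^ slen X)%N).+1
  else 0%N.
have HD : comp3 D.
  have Hs : comp (fun z => slen (pr (pr z))) by apply: comp_slen; do !comp_step.
  have HN : comp (fun z => ball (g (slen (pr (pr z))))) by apply: comp_ball; apply: (comp_comp Hg).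
  have Hodd : comp (fun z => nat_of_bool (odd (pl (pr (pl z)) %/ 2 ^ pr z))).
    by apply: comp_odd; apply: comp_div; [|apply: compX]; do !comp_step.
  have HWz : comp (fun z => HW (pl (pl z)) (pr z)) by do !comp_step.
  have HS : comp (fun z => S (pl z) (pl (pr z)) (ball (g (slen (pr (pr z)))))).
    by apply: comp_sum_nat => //; apply: compM.
  have Hpend : comp (fun z => pending (pl z) (pl (pr z)) (ball (g (slen (pr (pr z)))))).
    by apply: comp_sum_nat => //; apply: compM => //; apply: comp_eq => //; exact: comp_const.
  apply: comp_if; last exact: comp_const.
    by apply: comp_eq => //; exact: comp_const.
  apply: comp_succE; apply: comp_eq; first by apply: comp_sval; do !comp_step.
  apply: comp_mod; last by apply: compX => //; comp_step.
  apply: compD; first exact: (comp2E Hlead).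
  exact: (comp_comp comp_is_integer Hs).
apply: (@reducible_by_stages (fun X => ball (g (slen X))) D) => //.
- by apply: comp_ball; apply: (comp_comp Hg); apply: comp_slen; comp_step.
- by move=> x i; rewrite slen_code; exact: str_of_ball.
move=> x D'; rewrite /D' /D slen_code {D'}.
set n := size x; set N := ball (g n); set a := answers _ _.
have aE i : (i < N)%N -> odd (a %/ 2 ^ i) = (str_of i \in domain W) by exact: answers_bit.
have pendP t : pending t a N = 0%N <->
    forall i, (i < N)%N -> domain W (str_of i) -> (0 < HW t i)%N.
  split=> [/eqP + i iN Wi|H].
    rewrite /pending big_mkord sum_nat_eq0 => /forallP /(_ (Ordinal iN)) /=.
    by rewrite aE // mem_set // mul1n; case: (HW t i).
  rewrite /pending big_nat_cond big1 // => i; rewrite andbT => /andP[_ iN].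
  rewrite aE //; case: (boolP (str_of i \in domain W)) => //; rewrite inE => /(H i iN).
  by case: (HW t i).
split.
  have [t [_ Ht]] := halted_all HW2 HW3 N.
  exists t; rewrite ifT //; apply/eqP/pendP => i iN Wi.
  by have /andP[_] := Ht i iN Wi.
move=> t; case: eqP => // /pendP ready _; congr _.+1.
set s := S t a N.
(* A change at stage [t0] would have been requested, and its stage would be among
   the outputs summed up in [s]. *)
have late t0 : (s <= t0)%N -> lead n t0.+1 = lead n t0.
  move=> st0; apply/eqP; apply: contraLR st0 => ev; rewrite -ltnNge.
  have [|p sp Fp] := FP (cpair n t0); first by rewrite /req pl_cpair pr_cpair.
  have [|q [Wq WqF sq]] := Hd p; first by rewrite /domain /= Fp.
  rewrite Fp pr_cpair in WqF; rewrite sp pl_cpair in sq.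
  have qN : (str_code q < N)%N by rewrite str_code_lt (leq_trans sq).
  have := ready _ qN; rewrite str_codeK => /(_ Wq).
  case Ey: (HW t (str_code q)) => [//|y] _.
  have yE : y = t0.+1.
    have /HW2 : exists t, HW t (str_code q) = y.+1 by exists t.
    by rewrite WqF /= str_ofK => -[].
  rewrite /s /S big_mkord (bigD1 (Ordinal qN)) //= aE // str_codeK mem_set // mul1n Ey yE.
  by rewrite addSn ltnS ltnW // ltn_addr.
have late' t0 : (s <= t0)%N -> lead n t0 = lead n s.
  by move=> /subnK <-; elim: (t0 - s)%N => // k IH; rewrite addSn late ?leq_addl.
set v := lead n s in late' *.
have v_lt : v%:R < 2 ^+ n * Z.
  have [q Vq] := optimal_nonempty V_optimal.
  have iq : in_dom V (str_code q) by rewrite /in_dom str_codeK.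
  have /andP[H _] := leading_real R HV K E n s; apply: le_lt_trans H _.
  by rewrite ltr_pM2l //; exact: (lower_sum_lt T_gt0 T_lt1 V_pf HV2 E2 s iq).
have v_ge : 2 ^+ n * Z <= v%:R + 1.
  rewrite leNgt; apply/negP => Hlt.
  have [|t0 Ht0] := lower_sum_sup T_gt0 T_lt1 V_pf HV2 HV3 E3 (eps := Z - (v%:R + 1) / 2 ^+ n).
    by rewrite subr_gt0 ltr_pdivrMr // mulrC.
  have le1 := lower_sum_mono HV3 E4 (leq_maxl t0 s).
  have /andP[_] := leading_real R HV K E n (maxn t0 s).
  rewrite -/lead late' ?leq_maxr // ltNge => /negP; apply.
  rewrite -ler_pdivrMl // mulrC; apply: le_trans le1; apply: ltW.
  by move: Ht0; rewrite opprB addrC subrK.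
have u_floor : (v + is_integer n)%N%:R <= 2 ^+ n * Z < (v + is_integer n)%N%:R + 1.
  case: (boolP (is_integer n)) => [/asboolP [b Hb]|/asboolPn nint].
    rewrite Hb in v_lt v_ge *; rewrite ltr_nat in v_lt; rewrite natr1 ler_nat in v_ge.
    have -> : b = v.+1 by lia.
    by rewrite /= addn1 lexx /= ltrDl ltr01.
  rewrite /= addn0 ltW //= lt_neqAle v_ge andbT; apply/eqP => Heq.
  by apply: nint; exists v.+1; rewrite Heq natr1.
by rewrite (Pf_sval Z_ge0 u_floor).
Qed.

End Reductions.

(** * Composing the query bounds *)

Section Bidirectionality.
Variable R : realType.

Lemma order_function_linear (y : R) (phi : nat -> nat) (a : nat) : 0 < y -> comp phi ->
  {homo phi : m n / (m <= n)%N} -> (forall n, `|(phi n)%:R - y * n%:R| <= 2) ->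
  order_function (fun n => phi n + a)%N.
Proof.
move=> y0 Hphi phi_mono phiP; split.
- by move=> m n mn; rewrite leq_add2r phi_mono.
- by apply: recursive_of_comp; apply: compD => //; exact: comp_const.
apply/cvgnyPge => A; exists (Num.truncn ((A + 2)%N%:R / y)).+1 => // n /= Hn.
apply: leq_trans (leq_addr _ _); rewrite -(ler_nat R).
have := phiP n; rewrite ler_norml => /andP[H _].
have : (A + 2)%N%:R / y <= n%:R by apply: le_trans (_ : _ <= (Num.truncn ((A + 2)%N%:R / y)).+1%:R) _; rewrite ?ler_nat // ltW // truncnS_gt.
by rewrite ler_pdivrMr // natrD mulrC; move: H; lra.
Qed.

Lemma bounded_composition (y z : R) (phi psi : nat -> nat) (a b : nat) :
  0 < z -> z * y = 1 ->
  (forall n, `|(phi n)%:R - y * n%:R| <= 2) -> (forall n, `|(psi n)%:R - z * n%:R| <= 2) ->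
  bounded_int_seq (fun n => (psi (phi n + a) + b)%N%:Z - n%:Z).
Proof.
move=> z0 zy phiP psiP.
pose c : R := z * (2 + a%:R) + 2 + b%:R.
exists (Num.truncn c).+1 => n.
rewrite -(ler_int R) intr_norm rmorphB /=.
apply: le_trans (_ : c <= _); last by rewrite ltW // truncnS_gt.
have := psiP (phi n + a)%N; rewrite !ler_norml natrD => /andP[H1 H2].
have := phiP n; rewrite ler_norml => /andP[H3 H4].
have H5 : z * ((phi n)%:R - y * n%:R) <= z * 2 by rewrite ler_pM2l.
have H6 : z * (- 2) <= z * ((phi n)%:R - y * n%:R) by rewrite ler_pM2l.
rewrite mulrBr mulrA zy mul1r in H5 H6.
have a0 : 0 <= z * a%:R by rewrite mulr_ge0 // ltW.
have b0 : 0 <= b%:R :> R by [].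
rewrite -!pmulrn natrD /c mulrDr.
by apply/andP; split; lra.
Qed.

End Bidirectionality.

Theorem theorem6p3 (R : realType) (T : R) (V W : str -> option str)
    (T_computable : computable_real T) (T_gt0 : 0 < T) (T_lt1 : T < 1)
    (V_optimal : optimal V) (W_optimal : optimal W) :
  bidirectional (Pf (partition_fun V T)) (domain W).
Proof.
have [B HB] := dyadic_T T_gt0 T_computable.
have [C HC] := dyadic_invT T_gt0 T_computable.
have Ti_gt0 : 0 < T^-1 by rewrite invr_gt0.
have T_neq0 : T != 0 by rewrite gt_eqF.
have [phi [phi_comp phi_mono phiP]] := linear_order_function Ti_gt0 HC.
have [psi [psi_comp psi_mono psiP]] := linear_order_function T_gt0 HB.
have [c1 H1] := domain_reducible_Pf T_computable T_gt0 T_lt1 V_optimal W_optimal.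
have [c2 H2] := Pf_reducible_domain T_computable T_gt0 T_lt1 V_optimal W_optimal.
pose a := (Num.truncn (c1 + 2)).+1; pose b := (Num.truncn (c2 + 2)).+1.
have red1 : reducible_in_query_size (fun n => phi n + a)%N (domain W) (Pf (partition_fun V T)).
  apply: H1 => [|n]; first by apply: compD => //; exact: comp_const.
  have := phiP n; rewrite ler_norml natrD mulrC => /andP[H _].
  by have := truncnS_gt (c1 + 2); rewrite -/a; move: H; lra.
have red2 : reducible_in_query_size (fun n => psi n + b)%N (Pf (partition_fun V T)) (domain W).
  apply: H2 => [|n]; first by apply: compD => //; exact: comp_const.
  have := psiP n; rewrite ler_norml natrD mulrC => /andP[H _].
  by have := truncnS_gt (c2 + 2); rewrite -/b; move: H; lra.
have ord1 := order_function_linear a Ti_gt0 phi_comp phi_mono phiP.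
have ord2 := order_function_linear b T_gt0 psi_comp psi_mono psiP.
split=> [/(_ _ _ ord1 ord2 red1 red2)|/(_ _ _ ord2 ord1 red2 red1)]; apply.
  exact: (bounded_composition a b T_gt0 (mulfV T_neq0) phiP psiP).
exact: (bounded_composition b a Ti_gt0 (mulVf T_neq0) psiP phiP).
Qed.
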